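(* Let $\mathcal{G}$ be Spielberg's groupoid associated with the mixed graph $\Omega$ built from irreducible directed graphs $E_0,E_1,F_0,F_1$ and the graph $D$ (as constructed in the context). Fix a vertex $(y,z)\in E_0^0\times F_0^0$ and let $\mu=(y,z)$. Then the restriction $\mathcal{H}=\mathcal{G}|_{Z(\mu)}=\{\gamma\in\mathcal{G}:s(\gamma),r(\gamma)\in Z(\mu)\}$ to the compact open set $Z(\mu)\subseteq\mathcal{G}^{(0)}$ is purely infinite, and thus almost elementary.
   Context: The mixed graph $\Omega$. $D$ is the directed graph with vertices $u_0,u_1,a_0,a_1$ and edges $\alpha_0:u_0\to a_0$, $\delta_0:a_0\to u_1$, $\alpha_1:u_1\to a_1$, $\delta_1:a_1\to u_0$, $\varepsilon_0:u_0\to u_1$, $\varepsilon_1:u_1\to u_0$, loops $\beta_0,\gamma_0$ at $a_0$ and loops $\beta_1,\gamma_1$ at $a_1$. $E_0,E_1,F_0,F_1$ are (countable) irreducible directed graphs (any two vertices are connected by a directed path). For $i=0,1$, $L_i\subseteq E_i^0$ and $M_i\subseteq F_i^0$ are the sets of vertices emitting infinitely many edges; all are assumed nonempty, and $v_i\in L_i$, $w_i\in M_i$ are fixed. $\Omega$ is obtained from $D$ and the product 2-graphs $E_i\times F_i$ by identifying $u_i$ with $(v_i,w_i)$, $i=0,1$. A vertex of $\Omega$ is an element of $\bigcup_i(E_i^0\times F_i^0)\cup D^0$ with these identifications; edges are elements of $\bigcup_i\big((E_i^1\times F_i^0)\cup(E_i^0\times F_i^1)\big)\cup D^1$. Paths.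 A finite path element of type $D$ is a finite directed path in $D$ of nonzero length; an infinite path element of type $D$ is an infinite directed path in $D$ or a finite path element of type $D$ ending at $u_0$ or $u_1$. A finite path element of type $(E_i,F_i)$ is a pair $(p,q)\in E_i^*\times F_i^*$ of finite directed paths, at least one of positive length; an infinite path element of type $(E_i,F_i)$ is a pair $(p,q)$, not both of length zero, where $p$ is an infinite path in $E_i$ or a finite path terminating in $L_i$, and $q$ is an infinite path in $F_i$ or a finite path terminating in $M_i$. Origin and terminus $o,t$ are defined coordinatewise, and $(p',q')$ extends $(p,q)$ if $p'$ extends $p$ and $q'$ extends $q$. A finite path is a vertex of $\Omega$ or a finite string $\mu_1\cdots\mu_k$ of finite path elements with $t(\mu_i)=o(\mu_{i+1})$ and with $\mu_i,\mu_{i+1}$ of different types. An infinite path is a vertex in some $L_i\times M_i$, an infinite string of finite path elements with these two properties, or a finite string $\mu_1\cdots\mu_{k+1}$ with these two properties in which $\mu_1,\dots,\mu_k$ are finite path elements and $\mu_{k+1}$ is an infinite path element. $\mu\preceq\nu$ means $\nu$ extends $\mu$. Paths are concatenated in the obvious way, adjacent path elements of the same type being merged (coordinatewise for type $(E_i,F_i)$). Let $X$ be the set of all infinite paths. Topology. For a finite path $\mu=\mu_1\cdots\mu_k$, $Z(\mu)=\{\sigma=\sigma_1\sigma_2\cdots\in X:\sigma_i=\mu_i\text{ for }i<k,\ \mu_k\preceq\sigma_k\}$ (for a vertex $\mu$, the infinite paths with origin $\mu$). $V(\mu)=Z(\mu)$ if $t(\mu)\notin\{u_0,u_1\}$, and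 $V(\mu)=Z(\mu)\setminus(Z(\mu\alpha_i)\cup Z(\mu\varepsilon_i))$ if $t(\mu)=u_i$. If $t(\mu)=(y,z)\in E_i^0\times F_i^0$ and $B$, $C$ are finite sets of edges of $E_i$, $F_i$ emitted from $y$, $z$ respectively (with $B=\emptyset$ if $y\notin L_i$ and $C=\emptyset$ if $z\notin M_i$), put $V(\mu;B,C)=V(\mu)\setminus\big(\bigcup_{e\in B}Z(\mu(e,z))\cup\bigcup_{f\in C}Z(\mu(y,f))\big)$. The sets $Z(\mu)$ and $V(\mu;B,C)$ form a base of a locally compact metrizable topology on $X$. The groupoid. $\ell(\mu)\in\mathbb{N}^2$ is $(0,0)$ for a vertex, $(\ell(p),\ell(p))$ for a finite path element $p$ of type $D$, $(\ell(p),\ell(q))$ for $(p,q)$ of type $(E_i,F_i)$, and is additive over the path elements of a finite path. $\mathcal{G}$ is the set of $(x,n,y)\in X\times\mathbb{Z}^2\times X$ such that there are $z\in X$ and finite paths $\mu,\nu$ with $x=\mu z$, $y=\nu z$, $\ell(\mu)-\ell(\nu)=n$, with $(x,n,y)(y,m,z)=(x,n+m,z)$ and $(x,n,y)^{-1}=(y,-n,x)$. Its topology has as base the compact open bisections $U(\mu_1,\mu_2)=\{(\mu_1z,\ell(\mu_1)-\ell(\mu_2),\mu_2z)\}$ (with $\mu_iz\in Z(\mu_i)$) and $U_0(\mu_1,\mu_2;B,C)$, the subset of $U(\mu_1,\mu_2)$ with $\mu_iz\in V(\mu_i;B,C)$, where $\mu_1,\mu_2$ are finite paths with $t(\mu_1)=t(\mu_2)$.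 $\mathcal{G}$ is a locally compact Hausdorff ample étale groupoid with unit space $X$, source $s$ and range $r$. Purely infinite. For a groupoid $\mathcal{H}$ (locally compact, Hausdorff, $\sigma$-compact, étale), an open $s$-section is an open set $A\subseteq\mathcal{H}$ such that $s|_A$ is a homeomorphism onto an open subset of $\mathcal{H}^{(0)}$. For $K\subseteq\mathcal{H}^{(0)}$ and $O\subseteq\mathcal{H}^{(0)}$ open, $K\prec_{\mathcal{H}}O$ means that there is an open $s$-section $A$ with $K\subseteq r(A)$, $s(A)\subseteq O$. For open $U,V$, $U\precsim_{\mathcal{H},2}V$ means that for every compact $K\subseteq U$ there are disjoint nonempty open $V_1,V_2\subseteq V$ with $K\prec_{\mathcal{H}}V_1$, $K\prec_{\mathcal{H}}V_2$. $\mathcal{H}$ is purely infinite if $O_1\precsim_{\mathcal{H},2}O_2$ for all nonempty open $O_1,O_2\subseteq\mathcal{H}^{(0)}$ with $O_1\subseteq r(\{\gamma\in\mathcal{H}:s(\gamma)\in O_2\})$. Almost elementary. A castle in $\mathcal{H}$ is a finite collection $\mathcal{S}$ of pairwise disjoint nonempty subsets of $\mathcal{H}$ such that (i) $r(C),s(C),C^{-1}\in\mathcal{S}$ for all $C\in\mathcal{S}$; (ii) $CC'\in\mathcal{S}\cup\{\emptyset\}$ for all $C,C'\in\mathcal{S}$; (iii) $C\mapsto(r(C),s(C))$ is injective on $\mathcal{S}$. It is open if all its members are open. Put $\mathcal{S}^{(0)}=\{C\in\mathcal{S}:C\subseteq\mathcal{H}^{(0)}\}$. $\mathcal{S}$ is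 $K$-extendable to a castle $\mathcal{T}$ if every $C\in\mathcal{S}$ belongs to $\mathcal{T}$ and $(K\cup K^{-1})C\subseteq\bigcup\mathcal{T}$, $C(K\cup K^{-1})\subseteq\bigcup\mathcal{T}$. $\mathcal{H}$ with compact unit space is almost elementary if for every compact $K\subseteq\mathcal{H}$, every finite open cover $\mathcal{V}$ of $\mathcal{H}^{(0)}$ and every nonempty open $O\subseteq\mathcal{H}^{(0)}$ there is a nonempty open castle $\mathcal{S}$ that is $K$-extendable to an open castle, with every member of $\mathcal{S}^{(0)}$ contained in a member of $\mathcal{V}$, and with $\mathcal{H}^{(0)}\setminus\bigcup\mathcal{S}^{(0)}\prec_{\mathcal{H}}O$. *)

(* Defs.v *)
From HB Require Import structures.
From mathcomp Require Import all_boot all_order all_algebra.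
From mathcomp Require Import all_classical topology.

Set Implicit Arguments.
Unset Strict Implicit.
Unset Printing Implicit Defensive.

Import GRing.Theory.
Local Open Scope classical_set_scope.
Local Open Scope ring_scope.

Record digraph := Digraph {
  vert : Type;
  edge : Type;
  org : edge -> vert;
  ter : edge -> vert }.

Section Digraph.
Variable G : digraph.

Definition countable_digraph : Prop :=
  countable [set: vert G] /\ countable [set: edge G].

Definition infinite_emitters : set (vert G) :=
  [set x | infinite_set [set e | org e = x]].

(* [Fin x s] is the path with edges [s] starting at [x]; carrying the origin
   gives every vertex its path [Fin x [::]] of length zero. *)
Inductive gpath := Fin of vert G & seq (edge G) | Inf of nat -> edge G.

Fixpoint chain (x : vert G) (s : seq (edge G)) : Prop :=
  if s is e :: s' then org e = x /\ chain (ter e) s' else True.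

Definition is_gpath (p : gpath) : Prop :=
  match p with
  | Fin x s => chain x s
  | Inf f => forall n, ter (f n) = org (f n.+1)
  end.

Definition gorg (p : gpath) : vert G :=
  match p with Fin x _ => x | Inf f => org (f 0%N) end.

Definition gter (p : gpath) : option (vert G) :=
  match p with Fin x s => Some (last x (map (@ter G) s)) | Inf _ => None end.

Definition irreducible : Prop :=
  forall x y, exists s, chain x s /\ gter (Fin x s) = Some y.

Definition infinite_gpath (p : gpath) : bool :=
  if p is Inf _ then true else false.

Definition zero_length (p : gpath) : bool :=
  if p is Fin _ [::] then true else false.

(* Only meaningful for finite paths. *)
Definition glen (p : gpath) : nat :=
  match p with Fin _ s => size s | Inf _ => 0%N end.

(* Only meaningful when [gter p = Some (gorg q)]. *)
Definition gcat (p q : gpath) : gpath :=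
  match p, q with
  | Fin x s, Fin _ t => Fin x (s ++ t)
  | Fin x s, Inf f => Inf (fun n => nth (f (n - size s)%N) s n)
  | Inf _, _ => p
  end.

(* [q] extends the finite path [p]. *)
Definition gext (p q : gpath) : Prop :=
  exists r, [/\ is_gpath r, gter p = Some (gorg r) & q = gcat p r].

End Digraph.

Arguments infinite_emitters : clear implicits.

(* Booleans stand for the indices 0 ([false]) and 1 ([true]). *)
Inductive D_vert := U of bool | A of bool.
Inductive D_edge :=
  | alpha of bool | beta of bool | gamma of bool | delta of bool
  | epsilon of bool.

Definition D_org (e : D_edge) : D_vert :=
  match e with
  | alpha i | epsilon i => U i
  | beta i | gamma i | delta i => A i
  end.

Definition D_ter (e : D_edge) : D_vert :=
  match e with
  | alpha i | beta i | gamma i => A i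
  | delta i | epsilon i => U (~~ i)
  end.

Definition D : digraph := Digraph D_org D_ter.

Section MixedGraph.
Variables (E F : bool -> digraph).
Variables (v : forall i, vert (E i)) (w : forall i, vert (F i)).

Local Notation L i := (infinite_emitters (E i)).
Local Notation M i := (infinite_emitters (F i)).

(* The vertices of Omega: since [u_i] is identified with [(v_i, w_i)], only the
   [a_i] remain besides the vertices of the products. *)
Inductive overt :=
  | Va of bool
  | Vprod (i : bool) of vert (E i) & vert (F i).

Definition of_D (x : D_vert) : overt :=
  match x with U i => Vprod (v i) (w i) | A i => Va i end.

(* Path elements, finite or infinite. The tag is the type of the element:
   [None] for D and [Some i] for (E_i, F_i). *)
Definition elt (t : option bool) : Type :=
  match t with
  | None => gpath D
  | Some i => (gpath (E i) * gpath (F i))%type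
  end.

Definition is_fin_elt (t : option bool) : elt t -> Prop :=
  match t return elt t -> Prop with
  | None => fun p => [/\ is_gpath p, ~~ infinite_gpath p & ~~ zero_length p]
  | Some i => fun pq =>
      [/\ is_gpath pq.1, is_gpath pq.2,
          ~~ infinite_gpath pq.1, ~~ infinite_gpath pq.2
        & ~~ (zero_length pq.1 && zero_length pq.2)]
  end.

Definition ends_in (G : digraph) (S : set (vert G)) (p : gpath G) : Prop :=
  exists2 x, gter p = Some x & S x.

Definition is_inf_elt (t : option bool) : elt t -> Prop :=
  match t return elt t -> Prop with
  | None => fun p =>
      [/\ is_gpath p, ~~ zero_length p
        & infinite_gpath p \/ @ends_in D (range U) p]
  | Some i => fun pq =>
      [/\ is_gpath pq.1, is_gpath pq.2,
          ~~ (zero_length pq.1 && zero_length pq.2),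
          infinite_gpath pq.1 \/ ends_in (L i) pq.1
        & infinite_gpath pq.2 \/ ends_in (M i) pq.2]
  end.

Definition elt_org (t : option bool) : elt t -> overt :=
  match t return elt t -> overt with
  | None => fun p => of_D (gorg p)
  | Some i => fun pq => Vprod (gorg pq.1) (gorg pq.2)
  end.

Definition elt_ter (t : option bool) : elt t -> option overt :=
  match t return elt t -> option overt with
  | None => fun p => omap of_D (gter p)
  | Some i => fun pq =>
      if gter pq.1 is Some x then omap (Vprod x) (gter pq.2) else None
  end.

Definition elt_cat (t : option bool) : elt t -> elt t -> elt t :=
  match t return elt t -> elt t -> elt t with
  | None => @gcat D
  | Some i => fun pq pq' => (gcat pq.1 pq'.1, gcat pq.2 pq'.2)
  end.

Definition elt_ext (t : option bool) : elt t -> elt t -> Prop :=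
  match t return elt t -> elt t -> Prop with
  | None => @gext D
  | Some i => fun pq pq' => gext pq.1 pq'.1 /\ gext pq.2 pq'.2
  end.

Definition elt_len (t : option bool) : elt t -> int * int :=
  match t return elt t -> int * int with
  | None => fun p => ((glen p)%:Z, (glen p)%:Z)
  | Some i => fun pq => ((glen pq.1)%:Z, (glen pq.2)%:Z)
  end.

Definition pelt : Type := {t : option bool & elt t}.

Definition pelt_ext (m m' : pelt) : Prop :=
  tag m = tag m' /\ elt_ext (tagged m) (tagged_as m m').

(* [Str o s] is the finite string [s] with origin [o]; carrying the origin
   makes [Str o [::]] the vertex [o]. *)
Inductive opath := Str of overt & seq pelt | IStr of nat -> pelt.

Definition elt_at (x : opath) (n : nat) : option pelt :=
  match x with Str _ s => onth s n | IStr f => Some (f n) end.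

Definition porg (x : opath) : overt :=
  match x with Str o _ => o | IStr f => elt_org (tagged (f 0%N)) end.

Definition pter (x : opath) : option overt :=
  match x with
  | Str o [::] => Some o
  | Str o (m :: s) => elt_ter (tagged (last m s))
  | IStr _ => None
  end.

Definition composable (x : opath) : Prop :=
  (forall m, elt_at x 0%N = Some m -> porg x = elt_org (tagged m)) /\
  (forall n m m', elt_at x n = Some m -> elt_at x n.+1 = Some m' ->
     elt_ter (tagged m) = Some (elt_org (tagged m')) /\ tag m <> tag m').

Definition is_fpath (x : opath) : Prop :=
  composable x /\
  match x with
  | Str _ s => forall n m, onth s n = Some m -> is_fin_elt (tagged m)
  | IStr _ => False
  end.

Definition is_ipath (x : opath) : Prop :=
  composable x /\
  match x with
  | Str (Va _) [::] => False
  | Str (Vprod i y z) [::] => L i y /\ M i z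
  | Str _ s => forall n m, onth s n = Some m ->
      if n.+1 == size s then is_inf_elt (tagged m) else is_fin_elt (tagged m)
  | IStr f => forall n, is_fin_elt (tagged (f n))
  end.

Definition merge (m m' : pelt) : seq pelt :=
  if tag m == tag m'
  then [:: Tagged elt (elt_cat (tagged m) (tagged_as m m'))]
  else [:: m; m'].

Definition pcons (m : pelt) (x : opath) : opath :=
  match x with
  | Str _ [::] => Str (elt_org (tagged m)) [:: m]
  | Str _ (m' :: s) => Str (elt_org (tagged m)) (merge m m' ++ s)
  | IStr f => let s := merge m (f 0%N) in
              IStr (fun n => nth (f (n.+1 - size s)%N) s n)
  end.

(* Only meaningful when [mu] is a finite path with [pter mu = Some (porg x)]. *)
Definition pcat (mu x : opath) : opath :=
  match mu with Str _ s => foldr pcons x s | IStr _ => mu end.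

Definition plen (mu : opath) : int * int :=
  match mu with
  | Str _ s => \sum_(m <- s) elt_len (tagged m)
  | IStr _ => 0
  end.

Definition vertex_path (i : bool) (y : vert (E i)) (z : vert (F i)) : opath :=
  Str (Vprod y z) [::].

Definition D_edge_path (e : D_edge) : opath :=
  Str (of_D (D_org e)) [:: Tagged elt (Fin (G := D) (D_org e) [:: e] : elt None)].

Definition E_edge_path (i : bool) (e : edge (E i)) (z : vert (F i)) : opath :=
  Str (Vprod (org e) z)
    [:: Tagged elt ((Fin (org e) [:: e], Fin z [::]) : elt (Some i))].

Definition F_edge_path (i : bool) (y : vert (E i)) (f : edge (F i)) : opath :=
  Str (Vprod y (org f))
    [:: Tagged elt ((Fin y [::], Fin (org f) [:: f]) : elt (Some i))].

Record ipath := IPath { ipval :> opath; ipathP : is_ipath ipval }.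

HB.instance Definition _ := gen_eqMixin ipath.
HB.instance Definition _ := gen_choiceMixin ipath.

(* For a finite path [mu]; when [mu] is a vertex only the condition on the
   origin remains, otherwise that condition is redundant. *)
Definition Z (mu : opath) : set ipath :=
  [set x : ipath | porg x = porg mu /\
    forall n m, elt_at mu n = Some m ->
      exists2 m', elt_at x n = Some m' &
        if elt_at mu n.+1 is Some _ then m' = m else pelt_ext m m'].

Definition V (mu : opath) : set ipath :=
  Z mu `\` \bigcup_(i in [set i | pter mu = Some (of_D (U i))])
             (Z (pcat mu (D_edge_path (alpha i))) `|`
              Z (pcat mu (D_edge_path (epsilon i)))).

Definition VBC (mu : opath) (i : bool) (y : vert (E i)) (z : vert (F i))
    (B : set (edge (E i))) (C : set (edge (F i))) : set ipath :=
  V mu `\` (\bigcup_(e in B) Z (pcat mu (E_edge_path e z)) `|`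
            \bigcup_(f in C) Z (pcat mu (F_edge_path y f))).

Definition admissible (i : bool) (y : vert (E i)) (z : vert (F i))
    (B : set (edge (E i))) (C : set (edge (F i))) : Prop :=
  [/\ finite_set B, finite_set C,
      B `<=` [set e | org e = y] /\ C `<=` [set f | org f = z],
      ~ L i y -> B = set0 & ~ M i z -> C = set0].

Inductive ipath_base : set (set ipath) :=
  | base_Z mu of is_fpath mu : ipath_base (Z mu)
  | base_V mu (i : bool) (y : vert (E i)) (z : vert (F i)) B C of
      is_fpath mu & pter mu = Some (Vprod y z) & admissible y z B C :
      ipath_base (VBC mu y z B C).

(* [ipath_base] is a base, so the topology it generates as a subbase is the one
   it is a base of; likewise for [sarrow_base]. *)
HB.instance Definition _ := isSubBaseTopological.Build ipath ipath_base id.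

Record sarrow := SArrow {
  sa_rng : ipath;
  sa_deg : int * int;
  sa_src : ipath;
  sarrowP : exists mu nu (z : ipath),
    [/\ is_fpath mu, is_fpath nu,
        pter mu = Some (porg z) /\ pter nu = Some (porg z),
        sa_rng = pcat mu z :> opath /\ sa_src = pcat nu z :> opath
      & sa_deg = plen mu - plen nu] }.

HB.instance Definition _ := gen_eqMixin sarrow.
HB.instance Definition _ := gen_choiceMixin sarrow.

Definition Ubis (mu1 mu2 : opath) : set sarrow :=
  [set g | exists z : ipath,
    [/\ pter mu1 = Some (porg z) /\ pter mu2 = Some (porg z),
        sa_rng g = pcat mu1 z :> opath /\ sa_src g = pcat mu2 z :> opath,
        sa_deg g = plen mu1 - plen mu2
      & Z mu1 (sa_rng g) /\ Z mu2 (sa_src g)]].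

Definition U0bis (mu1 mu2 : opath) (i : bool)
    (y : vert (E i)) (z : vert (F i))
    (B : set (edge (E i))) (C : set (edge (F i))) : set sarrow :=
  [set g | [/\ Ubis mu1 mu2 g,
               VBC mu1 y z B C (sa_rng g) & VBC mu2 y z B C (sa_src g)]].

Inductive sarrow_base : set (set sarrow) :=
  | base_U mu1 mu2 of is_fpath mu1 & is_fpath mu2 & pter mu1 = pter mu2 :
      sarrow_base (Ubis mu1 mu2)
  | base_U0 mu1 mu2 (i : bool) (y : vert (E i)) (z : vert (F i)) B C of
      is_fpath mu1 & is_fpath mu2 & pter mu1 = Some (Vprod y z) &
      pter mu2 = Some (Vprod y z) & admissible y z B C :
      sarrow_base (U0bis mu1 mu2 y z B C).

HB.instance Definition _ := isSubBaseTopological.Build sarrow sarrow_base id.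

Lemma sa_idn_subproof (x : ipath) : exists mu nu (z : ipath),
  [/\ is_fpath mu, is_fpath nu,
      pter mu = Some (porg z) /\ pter nu = Some (porg z),
      x = pcat mu z :> opath /\ x = pcat nu z :> opath
    & 0 = plen mu - plen nu].
Proof.
have o_fin : is_fpath (Str (porg x) [::]).
  by do 2?split => //=; move=> n m; rewrite onth0n.
by exists (Str (porg x) [::]), (Str (porg x) [::]), x; split; rewrite ?subrr.
Qed.

Definition sa_idn (x : ipath) : sarrow := SArrow (sa_idn_subproof x).

Lemma sa_inv_subproof (g : sarrow) : exists mu nu (z : ipath),
  [/\ is_fpath mu, is_fpath nu,
      pter mu = Some (porg z) /\ pter nu = Some (porg z),
      sa_src g = pcat mu z :> opath /\ sa_rng g = pcat nu z :> opath
    & - sa_deg g = plen mu - plen nu].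
Proof.
case: g => x n y /= [mu [nu [z [mu_fin nu_fin [muz nuz] [xE yE] ->]]]].
by exists nu, mu, z; split => //; rewrite opprB.
Qed.

Definition sa_inv (g : sarrow) : sarrow := SArrow (sa_inv_subproof g).

Definition sa_comp (g h k : sarrow) : Prop :=
  [/\ sa_src g = sa_rng h, sa_rng k = sa_rng g,
      sa_deg k = sa_deg g + sa_deg h & sa_src k = sa_src h].

End MixedGraph.

(* Only the data and laws needed to state the notions below are recorded. The
   unit space is a separate type, embedded in the arrows by [idn]; [comp g h k]
   states that [src g = rng h] and that [k] is the product [g h]. *)
Record groupoid := Groupoid {
  arrow : topologicalType;
  units : topologicalType;
  src : arrow -> units;
  rng : arrow -> units;
  idn : units -> arrow;
  inv : arrow -> arrow;
  comp : arrow -> arrow -> arrow -> Prop;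
  src_idn : forall x, src (idn x) = x;
  rng_idn : forall x, rng (idn x) = x;
  src_inv : forall g, src (inv g) = rng g;
  rng_inv : forall g, rng (inv g) = src g }.

Definition spielberg_groupoid (E F : bool -> digraph)
    (v : forall i, vert (E i)) (w : forall i, vert (F i)) : groupoid :=
  @Groupoid (sarrow v w) (ipath v w) (@sa_src _ _ v w) (@sa_rng _ _ v w)
    (@sa_idn _ _ v w) (@sa_inv _ _ v w) (@sa_comp _ _ v w)
    (fun=> erefl) (fun=> erefl) (fun=> erefl) (fun=> erefl).

Section Restriction.
Variables (G : groupoid) (W : set (units G)).

Definition restr_arrows : set (arrow G) := @src G @^-1` W `&` @rng G @^-1` W.

(* [set_type] carries the subspace topology. *)
Lemma restr_src_subproof (g : set_type restr_arrows) : W (src (val g)).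
Proof. exact: (set_mem (valP g)).1. Qed.

Lemma restr_rng_subproof (g : set_type restr_arrows) : W (rng (val g)).
Proof. exact: (set_mem (valP g)).2. Qed.

Definition restr_src (g : set_type restr_arrows) : set_type W :=
  SigSub (mem_set (restr_src_subproof g)).

Definition restr_rng (g : set_type restr_arrows) : set_type W :=
  SigSub (mem_set (restr_rng_subproof g)).

Lemma restr_idn_subproof (x : set_type W) : restr_arrows (idn (val x)).
Proof. by split; rewrite /= ?src_idn ?rng_idn; apply/set_mem/valP. Qed.

Definition restr_idn (x : set_type W) : set_type restr_arrows :=
  SigSub (mem_set (restr_idn_subproof x)).

Lemma restr_inv_subproof (g : set_type restr_arrows) :
  restr_arrows (inv (val g)).
Proof.
by have [Ws Wr] := set_mem (valP g); split; rewrite /= ?src_inv ?rng_inv.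
Qed.

Definition restr_inv (g : set_type restr_arrows) : set_type restr_arrows :=
  SigSub (mem_set (restr_inv_subproof g)).

Definition restr_comp (g h k : set_type restr_arrows) : Prop :=
  comp (val g) (val h) (val k).

Definition restriction : groupoid.
Proof.
refine (@Groupoid (set_type restr_arrows) (set_type W)
  restr_src restr_rng restr_idn restr_inv restr_comp _ _ _ _).
- by move=> x; apply: val_inj; rewrite /= src_idn.
- by move=> x; apply: val_inj; rewrite /= rng_idn.
- by move=> g; apply: val_inj; rewrite /= src_inv.
- by move=> g; apply: val_inj; rewrite /= rng_inv.
Defined.

End Restriction.

Section Properties.
Variable H : groupoid.

Local Notation s := (@src H).
Local Notation r := (@rng H).

(* The last clause says that [s] restricted to [A] is a homeomorphism onto
   [s @` A], with inverse [t]. *)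
Definition open_s_section (A : set (arrow H)) : Prop :=
  [/\ open A, open (s @` A) & {within A, continuous s} /\
      exists t : units H -> arrow H,
        {within s @` A, continuous t} /\ forall g, A g -> t (s g) = g].

Definition prec (K O : set (units H)) : Prop :=
  exists A, [/\ open_s_section A, K `<=` r @` A & s @` A `<=` O].

Definition precsim2 (O1 O2 : set (units H)) : Prop :=
  forall K, compact K -> K `<=` O1 ->
    exists V1 V2 : set (units H),
      [/\ open V1 /\ V1 !=set0, open V2 /\ V2 !=set0,
          V1 `<=` O2 /\ V2 `<=` O2, V1 `&` V2 = set0
        & prec K V1 /\ prec K V2].

Definition purely_infinite : Prop :=
  forall O1 O2 : set (units H),
    open O1 -> O1 !=set0 -> open O2 -> O2 !=set0 ->
    O1 `<=` r @` (s @^-1` O2) -> precsim2 O1 O2.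

Definition set_mul (A B : set (arrow H)) : set (arrow H) :=
  [set k | exists g h, [/\ A g, B h & comp g h k]].

Definition unit_members (S : set (set (arrow H))) : set (set (arrow H)) :=
  [set C | S C /\ C `<=` range (@idn H)].

Definition castle (S : set (set (arrow H))) : Prop :=
  [/\ finite_set S /\ (forall C, S C -> C !=set0), trivIset S id,
      forall C, S C ->
        [/\ S (@idn H @` (r @` C)), S (@idn H @` (s @` C))
          & S (@inv H @` C)],
      forall C C', S C -> S C' -> S (set_mul C C') \/ set_mul C C' = set0
    & forall C C', S C -> S C' ->
        r @` C = r @` C' -> s @` C = s @` C' -> C = C'].

Definition open_castle (S : set (set (arrow H))) : Prop :=
  castle S /\ forall C, S C -> open C.

Definition extendable (K : set (arrow H)) (S T : set (set (arrow H))) : Prop :=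
  forall C, S C ->
    [/\ T C,
        set_mul (K `|` @inv H @` K) C `<=` \bigcup_(C' in T) C'
      & set_mul C (K `|` @inv H @` K) `<=` \bigcup_(C' in T) C'].

(* The notion is reserved for groupoids with compact unit space, whence the
   first conjunct. *)
Definition almost_elementary : Prop :=
  compact [set: units H] /\
  forall (K : set (arrow H)) (VV : set (set (units H))) (O : set (units H)),
    compact K ->
    finite_set VV -> (forall W, VV W -> open W) ->
    \bigcup_(W in VV) W = [set: units H] ->
    open O -> O !=set0 ->
    exists S, [/\ open_castle S, S !=set0,
      exists2 T, open_castle T & extendable K S T,
      forall C, unit_members S C -> exists2 W, VV W & C `<=` @idn H @` W
      & prec (~` (@idn H @^-1` \bigcup_(C in unit_members S) C)) O].

End Properties.

(* Main.v *)
From mathcomp Require Import all_boot all_order all_algebra.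
From mathcomp Require Import all_classical topology.
From mathcomp Require Import finmap zify.
Require Import Defs.

(* For a finite path nu from mu = (y, z) back to mu, concatenation x |-> nu x is
   implemented by the bisection U(mu, nu), which maps Z(nu) onto all of Z(mu).
   Every nonempty open subset of Z(mu) contains such a Z(nu), because infinite
   paths are limits of finite ones (a finite coordinate ends at an infinite
   emitter and can be prolonged by fresh edges) and Omega is irreducible. So the
   whole unit space is below every nonempty open set, which gives pure
   infiniteness.

   It also reduces almost elementarity to finding one small open W = Z(nu) that
   is a level of an open castle T containing K W and W K. Cover K by finitely
   many bisections U(mu_j, nu_j) and prolong nu so that each nu_j is either a
   prefix of nu, say nu = nu_j rho_j, or has Z(nu_j) disjoint from Z(nu). The
   levels of T are the sets Z(mu_j rho_j tau), where the tail tau = alpha_0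
   beta_0^N is long enough to make the levels with distinct mu_j rho_j disjoint.

   Compactness of Z(mu): the finite paths nu with Z(nu) in a given ultrafilter
   are directed by extension, and their union is the limit. *)

Set Implicit Arguments.
Unset Strict Implicit.
Unset Printing Implicit Defensive.

Import Order.TTheory GRing.Theory Num.Theory.
Local Open Scope classical_set_scope.
Local Open Scope ring_scope.

(** Castle levels must be disjoint, but the cylinders of two paths mu_j rho_j may overlap, since K
    can move Z(nu) onto overlapping sets. A tail cures this only if it can be located inside an
    infinite path. It is therefore placed in D: a product element has two independent coordinates,
    while an element of type D is a single word. The edge alpha_0 marks where the tail starts, and
    the run of beta_0 after it is at least as long as any D-element of the paths in question, so two
    tails at different places contradict each other. The topology is the other difficulty. Adjacent
    elements of one type merge, and the coordinates of a product element grow independently, so two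
    cylinders that meet need not be nested. What replaces nesting is a join: the intersection of two
    cylinders is empty or again a cylinder. Joins, left cancellation and the fact that the length in
    N^2 singles out a prefix carry the arguments about arrows. Continuity with respect to the
    smaller neighbourhoods V(mu;B,C) rests on cylinders being closed. *)

(** * Partial sequences and finite sets *)

(** A limit of finite paths may be finite or infinite. It is first obtained as a partial sequence
    and only then sorted into one of the two constructors. *)
Lemma seq_of_partial (T : Type) (g : nat -> option T) :
  (forall n, g n = None -> g n.+1 = None) ->
  (exists s : seq T, onth s =1 g) \/ (exists f, forall n, g n = Some (f n)).
Proof.
move=> g_closed; have [[n gn]|g_total] := pselect (exists n, g n = None).
  left; elim: n g g_closed gn => [|n IHn] g g_closed gn.
    by exists [::] => m; rewrite onth0n; elim: m => // m /esym/g_closed ->.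
  case g0: (g 0%N) => [a|].
    have [//|s sg] := IHn (fun m => g m.+1) _ gn.
      by move=> m; apply: g_closed.
    by exists (a :: s) => -[|m] /=; rewrite ?g0.
  by exists [::] => m; rewrite onth0n; elim: m => // m /esym/g_closed ->.
right; have /choice[f fg] : forall n, exists a, g n = Some a; last by exists f.
by move=> n; case gn: (g n) => [a|]; [exists a|case: g_total; exists n].
Qed.

Lemma infinite_set_seq (T : Type) (A : set T) : infinite_set A ->
  exists2 h : nat -> T, injective h & forall n, A (h n).
Proof.
move=> /infiniteP/card_leP[f].
pose j n : set_type [set: nat] := SigSub (mem_set (I : [set: nat] n)).
exists (fun n => val (f (j n))) => [m n /val_inj fmn|n]; last exact: set_valP.
by have /(congr1 val) := @inj _ _ _ f _ _ (mem_set I) (mem_set I) fmn.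
Qed.

(** Paths carry no decidable equality, so the enumeration is expressed by [onth] instead of list
    membership. *)
Lemma finite_set_onth (T : Type) (A : set T) : finite_set A ->
  exists s : seq T, forall x, A x -> exists n, onth s n = Some x.
Proof.
move=> A_fin; have /finite_seqP[s s_eq] : finite_set (A : set {classic T}) by [].
by exists s => x; rewrite s_eq => /onthP.
Qed.

Lemma finite_set_bound (T : Type) (A : set T) (P : nat -> T -> Prop) :
  finite_set A -> (forall M N x, (M <= N)%N -> P M x -> P N x) ->
  (forall x, A x -> exists N, P N x) -> exists N, forall x, A x -> P N x.
Proof.
move=> A_fin P_mono P_ex; have [s sA] := finite_set_onth A_fin.
suff [N PN] : exists N, forall n x, onth s n = Some x -> A x -> P N x.
  by exists N => x Ax; have [n sn] := sA x Ax; apply: PN sn Ax.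
elim: s {sA} => [|a s [N PN]]; first by exists 0%N => n x; rewrite onth0n.
have [/P_ex[M PM]|nAa] := pselect (A a).
  exists (maxn M N) => -[|n] x /=; last by move=> /PN/[apply]; apply: P_mono; apply: leq_maxr.
  by move=> [<-] _; apply: P_mono PM; apply: leq_maxl.
by exists N => -[|n] x /=; [move=> [<-]|apply: PN].
Qed.

Lemma filter_bigcap_finite (T U : Type) (Phi : set_system T) (S : set U)
    (A : U -> set T) : Filter Phi -> finite_set S ->
  (forall c, S c -> Phi (A c)) -> Phi (\bigcap_(c in S) A c).
Proof.
move=> Phi_filter S_fin SA.
have /finite_fsetP[D SD] : finite_set (S : set {classic U}) by [].
rewrite SD; apply: (@filter_bigI T {classic U}) => c cD.
by apply: SA; rewrite SD.
Qed.

(** * Paths in a directed graph *)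

Section GeneralPaths.
Variable G : digraph.
Implicit Types (p q r : gpath G) (x : vert G) (s : seq (edge G)).

(** Reading both constructors as partial sequences of edges turns equality, concatenation and
    extension into pointwise statements. *)
Definition gat p n : option (edge G) :=
  match p with Fin _ s => onth s n | Inf f => Some (f n) end.

Lemma gpath_ext p q : gorg p = gorg q -> gat p =1 gat q -> p = q.
Proof.
case: p q => [x s|f] [y t|g] /= pq_org pq.
- by rewrite pq_org (eq_from_onth pq).
- by have := pq (size s); rewrite /= onth_default.
- by have := pq (size t); rewrite /= onth_default.
- by congr Inf; apply/funext => n; have [] := pq n.
Qed.

Lemma gpath_of_partial x (g : nat -> option (edge G)) :
  (forall n, g n = None -> g n.+1 = None) ->
  (forall e, g 0%N = Some e -> org e = x) ->
  exists p, gorg p = x /\ gat p =1 g.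
Proof.
move=> /seq_of_partial[[s sg] _|[f fg] /(_ (f 0%N))/(_ (fg _)) f0].
  by exists (Fin x s).
by exists (Inf f); split=> // n; rewrite fg.
Qed.

Lemma is_gpathP p : is_gpath p <->
  (forall e, gat p 0%N = Some e -> org e = gorg p) /\
  (forall n e e', gat p n = Some e -> gat p n.+1 = Some e' -> ter e = org e').
Proof.
case: p => [x s|f] /=; last first.
  split=> [f_chain|[_ f_chain] n]; last exact: f_chain.
  by split=> [e [<-]|n e e' [<-] [<-]].
elim: s x => [|a s IHs] x /=.
  by split=> // _; split=> // n e e'; rewrite onth0n.
split=> [[<- /IHs[s0 sS]]|[s0 sS]].
  split=> [e [<-] //|[|n] e e' /=]; first by move=> [<-] /s0.
  exact: sS.
split; first exact: s0.
by apply/IHs; split=> [e se|n]; [rewrite (sS 0%N a e)|apply: (sS n.+1)].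
Qed.

Lemma gat_fin p n : ~~ infinite_gpath p -> (gat p n = None) <-> (glen p <= n)%N.
Proof.
case: p => // x s _ /=; split=> [sn|/onth_default //].
by rewrite -onthNE sn.
Qed.

Lemma gat_prefix p n : gat p n = None -> gat p n.+1 = None.
Proof.
case: p => // x s; rewrite /gat => sn; apply: onth_default.
by apply: leqW; rewrite -onthNE sn.
Qed.

Lemma gat_cat p q n : ~~ infinite_gpath p ->
  gat (gcat p q) n = if (n < glen p)%N then gat p n else gat q (n - glen p)%N.
Proof.
case: p q => [x s|//] [y t|f] _ /=; first by rewrite onth_cat.
elim: s n => [|a s IHs] [|n] //=.
exact: IHs.
Qed.

Lemma gorg_cat p q : is_gpath p -> gter p = Some (gorg q) ->
  gorg (gcat p q) = gorg p.
Proof.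
by case: p q => [x [|e s]|//] [y t|f] //= => [_ [->]|[-> _]].
Qed.

Lemma infinite_cat p q : ~~ infinite_gpath p ->
  infinite_gpath (gcat p q) = infinite_gpath q.
Proof. by case: p q => [x s|//] []. Qed.

Lemma gter_cat p q : ~~ infinite_gpath p -> gter p = Some (gorg q) ->
  gter (gcat p q) = gter q.
Proof.
by case: p q => [x s|//] [y t|f] //= _ [<-]; rewrite map_cat last_cat.
Qed.

Lemma gter_fin p x : gter p = Some x -> ~~ infinite_gpath p.
Proof. by case: p. Qed.

Lemma fin_gter p : ~~ infinite_gpath p -> exists x, gter p = Some x.
Proof. by case: p => [x s|f] //= _; eexists. Qed.

Lemma glen_cat p q : ~~ infinite_gpath p -> ~~ infinite_gpath q ->
  glen (gcat p q) = (glen p + glen q)%N.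
Proof. by case: p q => [x s|//] [y t|//] _ _ /=; rewrite size_cat. Qed.

Lemma zero_cat p q : ~~ infinite_gpath p ->
  zero_length (gcat p q) = zero_length p && zero_length q.
Proof. by case: p q => [x [|e s]|//] [y [|e' t]|f]. Qed.

Lemma zero_length_at p : zero_length p <-> gat p 0%N = None.
Proof. by case: p => [x []|f]. Qed.

Lemma zero_length_glen p : ~~ infinite_gpath p -> zero_length p = (glen p == 0%N).
Proof. by case: p => [x []|f]. Qed.

Lemma zero_length_fin p : zero_length p -> ~~ infinite_gpath p.
Proof. by case: p. Qed.

Lemma gter_zero p : zero_length p -> gter p = Some (gorg p).
Proof. by case: p => [x []|]. Qed.

Lemma gcat0 p q : ~~ infinite_gpath p -> zero_length q -> gcat p q = p.
Proof. by case: p q => [x s|//] [y []|f]//; rewrite /= cats0. Qed.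

Lemma gcat_id p q : ~~ infinite_gpath p -> gcat p q = p -> zero_length q.
Proof.
case: p q => [x s|//] [y t|f] //= _ [] /(congr1 size).
by rewrite size_cat -[RHS]addn0 => /eqP; rewrite eqn_add2l => /nilP ->.
Qed.

Lemma gter_gat p n e : gat p n = Some e -> glen p = n.+1 ->
  gter p = Some (ter e).
Proof.
case: p => [x s|f] //= s_n s_size.
case/lastP: s s_n s_size => [|s a]; first by rewrite onth0n.
rewrite size_rcons -cats1 onth_cat => + [sn]; rewrite sn ltnn subnn /= => -[->].
by rewrite map_cat last_cat.
Qed.

Lemma is_gpath_cat p q : ~~ infinite_gpath p -> is_gpath p -> is_gpath q ->
  gter p = Some (gorg q) -> is_gpath (gcat p q).
Proof.
move=> p_fin p_path /is_gpathP[q0 qS] pq; apply/is_gpathP.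
rewrite gorg_cat //; have /is_gpathP[p0 pS] := p_path; split=> [e|n e e'].
  rewrite gat_cat //; case: ltnP => [_ /p0 //|]; rewrite leqn0 => /eqP plen0.
  rewrite plen0 => /q0 ->; case: p p_fin plen0 pq {p0 pS p_path} => //= x s _.
  by move=> /size0nil -> [].
rewrite !gat_cat //; case: (ltnP n.+1) => [np|].
  by rewrite (ltn_trans _ np) //; apply: pS.
rewrite leq_eqVlt ltnS => /orP[/eqP np|np].
  rewrite -np leqnn subnn => pn /q0 ->.
  by have := gter_gat pn np; rewrite pq => -[].
by rewrite ltnNge np /= subSn //; apply: qS.
Qed.

Lemma gcatA p q r : ~~ infinite_gpath p -> ~~ infinite_gpath q ->
  gcat (gcat p q) r = gcat p (gcat q r).
Proof.
case: p q r => [x s|//] [y t|//] [z u|f] _ _ /=; first by rewrite catA.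
congr Inf; apply/funext => n; rewrite nth_cat size_cat; case: ltnP => ns.
  exact: set_nth_default.
by rewrite subnDA [RHS]nth_default.
Qed.

Lemma gcatI p q r : ~~ infinite_gpath p -> gorg q = gorg r ->
  gcat p q = gcat p r -> q = r.
Proof.
move=> p_fin qr pqr; apply: gpath_ext => // n.
have := congr1 (gat ^~ (glen p + n)%N) pqr.
by rewrite /= !gat_cat // -ltn_subRL subnn ltn0 addKn.
Qed.

Lemma gextP p q : is_gpath p -> ~~ infinite_gpath p -> is_gpath q ->
  gext p q <->
  gorg p = gorg q /\ forall n e, gat p n = Some e -> gat q n = Some e.
Proof.
move=> p_path p_fin q_path; split=> [[r [r_path pr ->]]|[pq_org pq]].
  rewrite gorg_cat //; split=> // n e pn; rewrite gat_cat //.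
  by case: ltnP => // /(gat_fin n p_fin); rewrite pn.
have [x px] := fin_gter p_fin; have /is_gpathP[q0 qS] := q_path.
(* The edge before index [glen p] belongs to [p], unless [p] has length zero; then only the common
   origin ties [q] to [p]. *)
have qp_org e : gat q (glen p) = Some e -> org e = x.
  case p_len: (glen p) => [|n].
    move=> /q0 ->; case: (p) p_len px pq_org => //= y s /size0nil -> [<-] //.
  case pn: (gat p n) => [e'|]; last first.
    by move: pn => /(gat_fin n p_fin); rewrite p_len ltnn.
  by move=> /(qS _ e') <-; [have := gter_gat pn p_len; rewrite px => -[]|apply: pq].
have [|e|r [r_org r_at]] := @gpath_of_partial x (fun n => gat q (glen p + n)%N).
- by move=> n; rewrite addnS; apply: gat_prefix.
- by rewrite addn0; apply: qp_org.
have pr : gter p = Some (gorg r) by rewrite r_org.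
exists r; split=> //.
  apply/is_gpathP; rewrite r_org; split=> [e|n e e']; rewrite !r_at ?addn0 ?addnS.
    exact: qp_org.
  exact: qS.
apply: gpath_ext => [|n]; first by rewrite gorg_cat.
rewrite gat_cat //; case: ltnP => np; last by rewrite r_at subnKC.
case pn: (gat p n) => [e|]; first exact: pq.
by have := (gat_fin n p_fin).1 pn; rewrite leqNgt np.
Qed.

Lemma gext_refl p : is_gpath p -> ~~ infinite_gpath p -> gext p p.
Proof. by move=> p_path p_fin; apply/gextP. Qed.

Lemma gext_gpath p q : is_gpath p -> gext p q -> is_gpath q.
Proof.
by move=> p_path [r [r_path pr ->]]; apply: is_gpath_cat => //; apply: gter_fin pr.
Qed.

Lemma gext_org p q : is_gpath p -> gext p q -> gorg q = gorg p.
Proof. by move=> p_path [r [r_path pr ->]]; rewrite gorg_cat. Qed.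

Lemma gext_trans q p r : is_gpath p -> ~~ infinite_gpath p ->
  ~~ infinite_gpath q -> gext p q -> gext q r -> gext p r.
Proof.
move=> p_path p_fin q_fin pq qr; have q_path := gext_gpath p_path pq.
have r_path := gext_gpath q_path qr.
move: pq qr => /(gextP p_path p_fin q_path)[pq_org pq].
move=> /(gextP q_path q_fin r_path)[qr_org qr].
by apply/gextP => //; rewrite pq_org; split=> // n e /pq/qr.
Qed.

Lemma gext_total p q r : is_gpath p -> ~~ infinite_gpath p ->
  is_gpath q -> ~~ infinite_gpath q -> gext p r -> gext q r ->
  (glen p <= glen q)%N -> gext p q.
Proof.
move=> p_path p_fin q_path q_fin pr qr pq; have r_path := gext_gpath p_path pr.
move: pr qr => /(gextP p_path p_fin r_path)[pr_org pr].
move=> /(gextP q_path q_fin r_path)[qr_org qr].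
apply/gextP => //; split=> [|n e pn]; first by rewrite pr_org.
case qn: (gat q n) => [e'|].
  by have := qr _ _ qn; rewrite (pr _ _ pn).
have := (gat_fin n q_fin).1 qn => /(leq_trans pq) /(gat_fin n p_fin).
by rewrite pn.
Qed.

Lemma gext_glen p q : is_gpath p -> ~~ infinite_gpath p ->
  ~~ infinite_gpath q -> gext p q -> (glen p <= glen q)%N.
Proof.
move=> p_path p_fin q_fin [r [_ _ q_eq]]; move: q_fin; rewrite q_eq.
by rewrite infinite_cat // => r_fin; rewrite glen_cat // leq_addr.
Qed.

Lemma gext_glen_eq p q : is_gpath p -> ~~ infinite_gpath p ->
  ~~ infinite_gpath q -> gext p q -> glen p = glen q -> p = q.
Proof.
move=> p_path p_fin q_fin [r [_ pr q_eq]]; move: q_fin; rewrite q_eq.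
rewrite infinite_cat // => r_fin; rewrite glen_cat // -[X in X = _]addn0.
by move=> /addnI/esym/eqP; rewrite -zero_length_glen // => /gcat0 ->.
Qed.

Lemma gext_fin_eq p q r : is_gpath p -> ~~ infinite_gpath p ->
  is_gpath q -> ~~ infinite_gpath q -> gext p r -> gext q r ->
  glen p = glen q -> p = q.
Proof.
move=> p_path p_fin q_path q_fin pr qr pq; apply: gext_glen_eq => //.
by apply: gext_total pr qr _; rewrite ?pq.
Qed.

(** For the compactness proof: an edge appended to a supremum of prefixes would have to lie below
    that supremum again. *)
Lemma gext_cat_zero p r : is_gpath p -> ~~ infinite_gpath p -> is_gpath r ->
  ~~ infinite_gpath r -> gter p = Some (gorg r) -> gext (gcat p r) p ->
  zero_length r.
Proof.
move=> p_path p_fin r_path r_fin pr /gext_glen.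
rewrite infinite_cat // glen_cat // -[X in (_ <= X)%N]addn0 leq_add2l leqn0.
by rewrite zero_length_glen //; apply=> //; apply: is_gpath_cat.
Qed.

(** Members of a directed set are pairwise comparable, so all members that reach a given index have
    the same edge there. The last clause holds because a finite prefix of the union is controlled by
    its last edge, which a single member supplies. *)
Lemma gpath_union (P : set (gpath G)) : P !=set0 ->
  (forall p, P p -> is_gpath p /\ ~~ infinite_gpath p) ->
  (forall p q, P p -> P q -> exists2 r, gext p r & gext q r) ->
  exists u, [/\ is_gpath u, forall p, P p -> gext p u &
    forall q, is_gpath q -> ~~ infinite_gpath q -> gext q u ->
      exists2 p, P p & gext q p].
Proof.
move=> [p0 Pp0] P_path P_dir.
have P_comp p q : P p -> P q -> (glen p <= glen q)%N -> gext p q.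
  move=> Pp Pq pq; have [r pr qr] := P_dir p q Pp Pq.
  have [p_path p_fin] := P_path p Pp; have [q_path q_fin] := P_path q Pq.
  by apply: gext_total pr qr pq.
have P_at p q n e : P p -> P q -> gat p n = Some e -> (n < glen q)%N ->
    gat q n = Some e.
  move=> Pp Pq pn nq.
  have [p_path p_fin] := P_path p Pp; have [q_path q_fin] := P_path q Pq.
  have [pq|/ltnW qp] := leqP (glen p) (glen q).
    by have /(P_comp p q Pp Pq)/gextP[//|//|//|_] := pq; apply.
  have /(P_comp q p Pq Pp)/gextP[//|//|//|_ qp_at] := qp.
  case qn: (gat q n) => [e'|]; first by rewrite -pn -(qp_at _ _ qn).
  by have := (gat_fin n q_fin).1 qn; rewrite leqNgt nq.
have P_org p : P p -> gorg p = gorg p0.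
  move=> Pp; have [r pr p0r] := P_dir p p0 Pp Pp0.
  have [p_path p_fin] := P_path p Pp; have [p0_path p0_fin] := P_path p0 Pp0.
  by rewrite -(gext_org p_path pr) (gext_org p0_path p0r).
(* [g n] is the edge at index [n] shared by all members that reach it, and [None] if no member
   does. *)
have g_ex n : exists o, forall e, o = Some e <-> exists2 p, P p & gat p n = Some e.
  have [[e [p Pp pn]]|no] := pselect (exists e, exists2 p, P p & gat p n = Some e).
    exists (Some e) => e'; split=> [[<-]|[q Pq qn]]; first by exists p.
    have [q_path q_fin] := P_path q Pq.
    rewrite -qn; apply/esym; apply: P_at Pp Pq pn _; rewrite ltnNge; apply/negP.
    by move=> /(gat_fin n q_fin); rewrite qn.
  by exists None => e; split=> // pe; case: no; exists e.
have {g_ex}[g gP] := choice g_ex.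
have [n gn|e /gP[p Pp p_e]|u [u_org u_at]] := @gpath_of_partial (gorg p0) g.
- case gS: (g n.+1) => [e|//]; have /gP[p Pp pS] := gS.
  case pn: (gat p n) => [e'|]; last by rewrite (gat_prefix pn) in pS.
  have : g n = Some e' by apply/gP; exists p.
  by rewrite gn.
- by have [/is_gpathP[-> // _] _] := P_path p Pp; apply: P_org.
have u_path : is_gpath u.
  apply/is_gpathP; rewrite u_org; split=> [e|n e e']; rewrite !u_at.
    by move=> /gP[p Pp p_e]; have [/is_gpathP[-> // _] _] := P_path p Pp; apply: P_org.
  move=> /gP[p Pp pn] /gP[q Pq qn]; have [/is_gpathP[_ qS] q_fin] := P_path q Pq.
  apply: qS (qn); apply: P_at Pp Pq pn _; rewrite ltnNge; apply/negP.
  by move=> /leqW/(gat_fin n.+1 q_fin); rewrite qn.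
exists u; split=> // [p Pp|q q_path q_fin qu].
  have [p_path p_fin] := P_path p Pp; apply/gextP => //; rewrite u_org P_org //.
  by split=> // n e pn; rewrite u_at; apply/gP; exists p.
have /gextP[//|//|//|q_org qu_at] := qu.
(* A member that contributes the edge at the last index of [q] is at least as long as [q]. *)
have [p Pp qp] : exists2 p, P p & (glen q <= glen p)%N.
  case q_len: (glen q) => [|n]; first by exists p0.
  case qn: (gat q n) => [e|]; last first.
    by move: qn => /(gat_fin n q_fin); rewrite q_len ltnn.
  have := qu_at _ _ qn; rewrite u_at => /gP[p Pp pn]; exists p => //.
  rewrite ltnNge; apply/negP => /(gat_fin n (P_path p Pp).2).
  by rewrite pn.
exists p => //; have [p_path p_fin] := P_path p Pp.
apply: gext_total qu _ qp => //.
apply/gextP => //; rewrite u_org P_org //; split=> // n e pn.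
by rewrite u_at; apply/gP; exists p.
Qed.

(* If [p] is finite, [a n] is [p] followed by the [n]-th of infinitely many edges. *)
Lemma gpath_approx p : is_gpath p ->
  infinite_gpath p \/ ends_in (infinite_emitters G) p ->
  exists a : nat -> gpath G,
    (forall n, [/\ is_gpath (a n), ~~ infinite_gpath (a n),
      ~~ zero_length (a n) & gorg (a n) = gorg p]) /\
    forall q, is_gpath q -> ~~ infinite_gpath q ->
      exists N, forall n, (N <= n)%N ->
        [/\ gext q p -> gext q (a n),
            ~ gext q p -> forall r, gext (a n) r -> ~ gext q r
          & ~ gext (a n) q].
Proof.
case: p => [x s|f] p_path p_end; last first.
  (* One edge more than [n]: no [a n] has length zero, and [a n] is strictly longer than every [q]
     with [glen q <= n]. *)
  pose a n := Fin (org (f 0%N)) (mkseq f n.+1).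
  have a_at n k : (k < n.+1)%N -> gat (a n) k = Some (f k).
    by move=> kn; rewrite [LHS](onthE (mkseq f n.+1)) (nth_map (f 0%N)) ?size_mkseq ?nth_mkseq.
  have a_None n k : (n < k)%N -> gat (a n) k = None.
    by move=> nk; apply: onth_default; rewrite size_mkseq.
  have a_path n : is_gpath (a n).
    apply/is_gpathP; split=> [e|k e e']; first by rewrite a_at // => -[<-].
    have [kn|/a_None-> //] := leqP k.+1 n.
    by rewrite !a_at ?(leqW kn) // => -[<-] [<-].
  have a_ext n : gext (a n) (Inf f).
    apply/gextP => //; split=> // k e; have [kn|/a_None -> //] := leqP k n.
    by rewrite a_at.
  exists a; split=> [n|q q_path q_fin]; first by split.
  exists (glen q) => n qn; have {}qn : (glen q < glen (a n))%N by rewrite /= size_map size_iota.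
  have a_total r : gext q r -> gext (a n) r -> gext q (a n).
    by move=> qr ar; apply: gext_total qr ar (ltnW qn).
  split=> [qp|qp r ar qr|/(gext_glen (a_path n))].
  - exact: a_total qp (a_ext n).
  - by apply: qp; apply: gext_trans (a_ext n) => //; apply: a_total ar.
  - by rewrite leqNgt qn => /(_ erefl q_fin).
have [y py /infinite_set_seq[h h_inj h_org]] : ends_in (infinite_emitters G) (Fin x s) by case: p_end.
set p := Fin x s in p_path py *.
pose a n := gcat p (Fin y [:: h n]).
have h_path n : is_gpath (Fin y [:: h n]) by split=> //; apply: h_org.
have a_path n : is_gpath (a n) by apply: is_gpath_cat.
have p_ext n : gext p (a n) by exists (Fin y [:: h n]).
have a_at n : gat (a n) (glen p) = Some (h n) by rewrite gat_cat // ltnn subnn.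
have a_fin n : ~~ infinite_gpath (a n) by rewrite infinite_cat.
have a_nz n : ~~ zero_length (a n) by rewrite zero_cat //= andbF.
have a_org n : gorg (a n) = gorg p by rewrite gorg_cat.
exists a; split=> [n|q q_path q_fin]; first by split.
(* [q] has at most one edge at index [glen p], and [h] is injective, so at most one [h n] can
   coincide with it. *)
have [N N_ne] : exists N, forall n, (N <= n)%N -> gat q (glen p) <> Some (h n).
  have [[k qk]|no] := pselect (exists k, gat q (glen p) = Some (h k)).
    by exists k.+1 => n kn; rewrite qk => -[/h_inj kn']; rewrite kn' ltnn in kn.
  by exists 0%N => n _ qn; apply: no; exists n.
exists N => n /N_ne qn; split=> [qp|qp r ar qr|].
- exact: gext_trans (p_ext n).
- have r_path := gext_gpath (a_path n) ar.
  have pr : gext p r by apply: gext_trans ar.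
  have [le_qp|lt_pq] := leqP (glen q) (glen p); first exact/qp/(gext_total _ _ _ _ qr pr).
  case q_at: (gat q (glen p)) => [e|]; last first.
    by have := (gat_fin _ q_fin).1 q_at; rewrite leqNgt lt_pq.
  have /gextP[//|//|//|_ /(_ _ _ q_at) r_at] := qr.
  have /gextP[//|//|//|_ /(_ _ _ (a_at n))] := ar.
  by rewrite r_at -q_at.
- by move=> /gextP[//|//|//|_ /(_ _ _ (a_at n))].
Qed.

End GeneralPaths.

(** Rests on the decidable equality of the index type, through which [tagged_as] computes. *)
Lemma Tagged_inj (I : eqType) (T : I -> Type) (i : I) (a b : T i) :
  Tagged T a = Tagged T b -> a = b.
Proof. by move=> /(congr1 (tagged_as (Tagged T a))); rewrite !tagged_asE. Qed.

(** * Path elements *)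

Section Elements.
Variables (E F : bool -> digraph).
Variables (v : forall i, vert (E i)) (w : forall i, vert (F i)).

Local Notation elt := (elt E F).
Local Notation eorg := (elt_org v w).
Local Notation eter := (elt_ter v w).

Lemma Vprod_inj i (x x' : vert (E i)) (y y' : vert (F i)) :
  Vprod x y = Vprod x' y' -> x = x' /\ y = y'.
Proof.
by case=> /(@Tagged_inj _ (fun i => vert (E i)))-> /(@Tagged_inj _ (fun i => vert (F i)))->.
Qed.

Lemma of_D_inj : injective (of_D v w).
Proof. by case=> i [] j //= [->]. Qed.

(** [is_fin_elt] and [is_inf_elt] are taken apart into a path condition, finiteness, length zero and
    maximality, so that finite and infinite elements can be treated together. *)
Definition evalid t : elt t -> Prop :=
  match t return elt t -> Prop with
  | None => fun p => is_gpath p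
  | Some i => fun pq => is_gpath pq.1 /\ is_gpath pq.2
  end.

Definition efin t : elt t -> bool :=
  match t return elt t -> bool with
  | None => fun p => ~~ infinite_gpath p
  | Some i => fun pq => ~~ infinite_gpath pq.1 && ~~ infinite_gpath pq.2
  end.

Definition ezero t : elt t -> bool :=
  match t return elt t -> bool with
  | None => fun p => zero_length p
  | Some i => fun pq => zero_length pq.1 && zero_length pq.2
  end.

(** Length zero is allowed here, so that a vertex in some L_i x M_i can be treated as a maximal
    element of length zero. *)
Definition emax t : elt t -> Prop :=
  match t return elt t -> Prop with
  | None => fun p => infinite_gpath p \/ @ends_in D (range U) p
  | Some i => fun pq =>
      (infinite_gpath pq.1 \/ ends_in (infinite_emitters (E i)) pq.1) /\
      (infinite_gpath pq.2 \/ ends_in (infinite_emitters (F i)) pq.2)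
  end.

Definition vmax (o : overt E F) : Prop :=
  match o with
  | Va _ => False
  | Vprod i y z => infinite_emitters (E i) y /\ infinite_emitters (F i) z
  end.

Definition ejoin t : elt t -> elt t -> Prop :=
  match t return elt t -> elt t -> Prop with
  | None => fun p r => gter p = Some (gorg r)
  | Some i => fun pq rs =>
      gter pq.1 = Some (gorg rs.1) /\ gter pq.2 = Some (gorg rs.2)
  end.

(** Within one type nothing is lost by passing to vertices of Omega: [of_D] is injective, and so is
    [Vprod] at a fixed index. *)
Lemma ejoinP t (m r : elt t) : eter m = Some (eorg r) <-> ejoin m r.
Proof.
case: t m r => [i [p q] [r s]|p r] /=; last first.
  by case: (gter p) => [x|] //=; split=> [[/of_D_inj ->]|[->]].
case: (gter p) (gter q) => [x|] [y|] //=; try by split=> // -[].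
by split=> [/Some_inj/Vprod_inj[-> ->]|[[->] [->]]].
Qed.

Lemma is_fin_eltE t (m : elt t) :
  is_fin_elt m <-> [/\ evalid m, efin m & ~~ ezero m].
Proof.
case: t m => [i [p q]|p] //=; split=> [[? ? ? ? ?]|[[? ?] /andP[? ?] ?]] //.
by split=> //; apply/andP.
Qed.

Lemma is_inf_eltE t (m : elt t) :
  is_inf_elt m <-> [/\ evalid m, ~~ ezero m & emax m].
Proof.
case: t m => [i [p q]|p] //=.
by split=> [[? ? ? ? ?]|[[? ?] ? [? ?]]].
Qed.

Lemma eter_fin t (m : elt t) o : eter m = Some o -> efin m.
Proof.
case: t m => [i [p q]|p] /=; last by case: p.
by case: p q => [x s|f] [y u|g].
Qed.

Lemma fin_eter t (m : elt t) : efin m -> exists o, eter m = Some o.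
Proof.
case: t m => [i [[x s|f] [y u|g]]|[x s|f]] //= _; by eexists.
Qed.

Lemma ecatA t (m m' r : elt t) : efin m -> efin m' ->
  elt_cat (elt_cat m m') r = elt_cat m (elt_cat m' r).
Proof.
case: t m m' r => [i [p q] [p' q'] [r s]|p p' r] /=; last exact: gcatA.
by move=> /andP[p_fin q_fin] /andP[p'_fin q'_fin]; rewrite !gcatA.
Qed.

Lemma eorg_cat t (m r : elt t) : evalid m -> eter m = Some (eorg r) ->
  eorg (elt_cat m r) = eorg m.
Proof.
move=> m_valid /ejoinP; case: t m r m_valid => [i [p q] [r s]|p r] /=.
  by move=> [p_path q_path] [pr qs]; rewrite !gorg_cat.
by move=> p_path pr; rewrite gorg_cat.
Qed.

Lemma eter_cat t (m r : elt t) : eter m = Some (eorg r) ->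
  eter (elt_cat m r) = eter r.
Proof.
move=> mr; have := eter_fin mr; move: mr => /ejoinP.
case: t m r => [i [p q] [r s]|p r] /=.
  by move=> [pr qs] /andP[p_fin q_fin]; rewrite !gter_cat.
by move=> pr p_fin; rewrite gter_cat.
Qed.

Lemma evalid_cat t (m r : elt t) : evalid m -> evalid r ->
  eter m = Some (eorg r) -> evalid (elt_cat m r).
Proof.
move=> + + mr; have := eter_fin mr; move: mr => /ejoinP.
case: t m r => [i [p q] [r s]|p r] /=; last by move=> *; apply: is_gpath_cat.
move=> [pr qs] /andP[p_fin q_fin] [p_path q_path] [r_path s_path].
by split; apply: is_gpath_cat.
Qed.

Lemma ezero_cat t (m r : elt t) : efin m ->
  ezero (elt_cat m r) = ezero m && ezero r.
Proof.
case: t m r => [i [p q] [r s]|p r] /=; last exact: zero_cat.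
by move=> /andP[p_fin q_fin]; rewrite !zero_cat // andbACA.
Qed.

Lemma emax_cat t (m r : elt t) : eter m = Some (eorg r) ->
  emax (elt_cat m r) <-> emax r.
Proof.
move=> mr; have := eter_fin mr; move: mr => /ejoinP.
case: t m r => [i [p q] [r s]|p r] /=; last first.
  by move=> pr p_fin; rewrite /ends_in infinite_cat // gter_cat.
move=> [pr qs] /andP[p_fin q_fin].
by rewrite /ends_in !infinite_cat // !gter_cat.
Qed.

Lemma ecat0 t (m r : elt t) : efin m -> ezero r -> elt_cat m r = m.
Proof.
case: t m r => [i [p q] [r s]|p r] /=; last exact: gcat0.
by move=> /andP[p_fin q_fin] /andP[r0 s0]; rewrite !gcat0.
Qed.

Lemma ecat_id t (m r : elt t) : efin m -> elt_cat m r = m -> ezero r.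
Proof.
case: t m r => [i [p q] [r s]|p r] /=; last exact: gcat_id.
by move=> /andP[p_fin q_fin] [/gcat_id -> // /gcat_id ->].
Qed.

Lemma ecatI t (m r r' : elt t) : eter m = Some (eorg r) ->
  eter m = Some (eorg r') -> elt_cat m r = elt_cat m r' -> r = r'.
Proof.
move=> mr; have := eter_fin mr; move: mr => /ejoinP + + /ejoinP.
case: t m r r' => [i [p q] [r s] [r' s']|p r r'] /=.
  move=> [pr qs] /andP[p_fin q_fin] [pr' qs'] [pr_eq qs_eq]; congr pair.
    by apply: gcatI pr_eq => //; move: pr'; rewrite pr => -[].
  by apply: gcatI qs_eq => //; move: qs'; rewrite qs => -[].
by move=> pr p_fin pr'; apply: gcatI => //; move: pr'; rewrite pr => -[].
Qed.

Lemma elt_len_cat t (m r : elt t) : efin m -> efin r ->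
  elt_len (elt_cat m r) = elt_len m + elt_len r.
Proof.
case: t m r => [i [p q] [r s]|p r] /=.
  move=> /andP[p_fin q_fin] /andP[r_fin s_fin].
  by rewrite !glen_cat // !PoszD.
by move=> p_fin r_fin; rewrite glen_cat // PoszD.
Qed.

Lemma elt_len_ge0 t (m : elt t) : 0 <= (elt_len m).1 /\ 0 <= (elt_len m).2.
Proof. by case: t m. Qed.

Lemma elt_len0 t (m : elt t) : efin m -> (elt_len m).1 + (elt_len m).2 = 0 ->
  ezero m.
Proof.
case: t m => [i [p q]|p] /=.
  move=> /andP[p_fin q_fin]; rewrite -PoszD => -[] /eqP.
  by rewrite addn_eq0 !zero_length_glen.
by move=> p_fin; rewrite -PoszD => -[] /eqP; rewrite addn_eq0 zero_length_glen // => /andP[].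
Qed.

Lemma elt_extP t (m m' : elt t) : elt_ext m m' <->
  exists r, [/\ evalid r, eter m = Some (eorg r) & m' = elt_cat m r].
Proof.
case: t m m' => [i [p q] [p' q']|p p'] /=; last first.
  by split=> -[r [r_path /(@ejoinP None p r) pr ->]]; exists r.
split=> [[[r [? ? ->]] [s [? ? ->]]]|[[r s] [[? ?] /(@ejoinP (Some i) (p, q) (r, s))[? ?] [-> ->]]]].
  by exists (r, s); split=> //; apply/(@ejoinP (Some i) (p, q) (r, s)).
by split; [exists r|exists s].
Qed.

Lemma elt_ext_refl t (m : elt t) : evalid m -> efin m -> elt_ext m m.
Proof.
case: t m => [i [p q]|p] /=; last exact: gext_refl.
by move=> [? ?] /andP[? ?]; split; apply: gext_refl.
Qed.

Lemma elt_ext_trans t (m m' m'' : elt t) : evalid m -> efin m -> efin m' ->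
  elt_ext m m' -> elt_ext m' m'' -> elt_ext m m''.
Proof.
case: t m m' m'' => [i [p q] [p' q'] [p'' q'']|p p' p''] /=; last exact: gext_trans.
move=> [? ?] /andP[? ?] /andP[? ?] [? ?] [? ?].
by split; [apply: (@gext_trans _ p')|apply: (@gext_trans _ q')].
Qed.

Lemma elt_ext_org t (m m' : elt t) : evalid m -> elt_ext m m' ->
  eorg m' = eorg m.
Proof. by move=> m_valid /elt_extP[r [_ mr ->]]; apply: eorg_cat. Qed.

Lemma elt_ext_nz t (m m' : elt t) : efin m -> elt_ext m m' -> ~~ ezero m ->
  ~~ ezero m'.
Proof. by move=> m_fin /elt_extP[r [_ mr ->]] m_nz; rewrite ezero_cat // (negbTE m_nz). Qed.

(** In each coordinate two prefixes of one path are comparable and the longer one is the join. For a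
    product element the join may take its coordinates from different arguments and then differs from
    both. *)
Lemma elt_ext_lub t (m m' x : elt t) : evalid m -> efin m -> evalid m' ->
  efin m' -> elt_ext m x -> elt_ext m' x ->
  exists l, [/\ evalid l, efin l, elt_ext m l, elt_ext m' l &
    forall y, elt_ext m y -> elt_ext m' y -> elt_ext l y].
Proof.
have glub G (p p' q : gpath G) : is_gpath p -> ~~ infinite_gpath p ->
    is_gpath p' -> ~~ infinite_gpath p' -> gext p q -> gext p' q ->
    exists l, [/\ is_gpath l, ~~ infinite_gpath l, gext p l, gext p' l &
      forall r, gext p r -> gext p' r -> gext l r].
  move=> p_path p_fin p'_path p'_fin pq p'q.
  have [pp'|/ltnW p'p] := leqP (glen p) (glen p').
    by exists p'; split=> //; [apply: gext_total pq p'q pp'|apply: gext_refl].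
  by exists p; split=> //; [apply: gext_refl|apply: gext_total p'q pq p'p].
case: t m m' x => [i [p q] [p' q'] [x y]|p p' x] /=; last exact: glub.
move=> [p_ q_] /andP[pf qf] [p'_ q'_] /andP[p'f q'f] [px qy] [p'x q'y].
have [l [? ? ? ? l_least]] := glub _ _ _ _ p_ pf p'_ p'f px p'x.
have [l' [? ? ? ? l'_least]] := glub _ _ _ _ q_ qf q'_ q'f qy q'y.
exists (l, l'); split=> //=; first exact/andP.
by move=> [r s] /= [? ?] [? ?]; split; [apply: l_least|apply: l'_least].
Qed.

Lemma elt_ext_len t (m m' x : elt t) : evalid m -> efin m -> evalid m' ->
  efin m' -> elt_ext m x -> elt_ext m' x -> elt_len m = elt_len m' -> m = m'.
Proof.
case: t m m' x => [i [p q] [p' q'] [x y]|p p' x] /=.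
  move=> [p_ q_] /andP[pf qf] [p'_ q'_] /andP[p'f q'f] [px qy] [p'x q'y] [pp' qq'].
  by rewrite (gext_fin_eq p_ pf p'_ p'f px p'x) // (gext_fin_eq q_ qf q'_ q'f qy q'y).
move=> p_ pf p'_ p'f px p'x [pp'].
exact: (gext_fin_eq p_ pf p'_ p'f px p'x).
Qed.

Lemma elt_ext_antisym t (m m' : elt t) : evalid m -> efin m -> efin m' ->
  elt_ext m m' -> elt_ext m' m -> m = m'.
Proof.
have ganti G (p q : gpath G) : is_gpath p -> ~~ infinite_gpath p ->
    ~~ infinite_gpath q -> gext p q -> gext q p -> p = q.
  move=> p_path p_fin q_fin pq qp; have q_path := gext_gpath p_path pq.
  apply: gext_glen_eq => //; apply/eqP; rewrite eqn_leq.
  by rewrite (gext_glen p_path) // (gext_glen q_path).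
case: t m m' => [i [p q] [p' q']|p p'] /=; last exact: ganti.
move=> [p_ q_] /andP[pf qf] /andP[p'f q'f] [pp' qq'] [p'p q'q].
by rewrite (ganti _ p p') // (ganti _ q q').
Qed.

Lemma elt_union t (Q : set (elt t)) : Q !=set0 ->
  (forall a, Q a -> evalid a /\ efin a) ->
  (forall a b, Q a -> Q b -> exists2 c, Q c & elt_ext a c /\ elt_ext b c) ->
  exists u, [/\ evalid u, forall a, Q a -> elt_ext a u &
    forall c, evalid c -> efin c -> elt_ext c u -> exists2 a, Q a & elt_ext c a].
Proof.
case: t Q => [i|] Q [a0 Qa0] Q_val Q_dir; last first.
  have [|||u [u_path u_ub u_lub]] := @gpath_union D Q; first by exists a0.
  - by move=> p /Q_val.
  - by move=> p q Qp Qq; have [r _ [pr qr]] := Q_dir p q Qp Qq; exists r.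
  by exists u.
have [|p [[q1 q2] Qq <-]|_ _ [[p1 p2] Qp <-] [[q1 q2] Qq <-]|u [u_path u_ub u_lub]] :=
    @gpath_union (E i) (fst @` Q).
- by exists a0.1, a0.
- by have [[? ?] /andP[? ?]] := Q_val _ Qq.
- by have [r _ [[pr _] [qr _]]] := Q_dir _ _ Qp Qq; exists r.1.
have [|p [[q1 q2] Qq <-]|_ _ [[p1 p2] Qp <-] [[q1 q2] Qq <-]|u' [u'_path u'_ub u'_lub]] :=
    @gpath_union (F i) (snd @` Q).
- by exists a0.2, a0.
- by have [[? ?] /andP[? ?]] := Q_val _ Qq.
- by have [r _ [[_ pr] [_ qr]]] := Q_dir _ _ Qp Qq; exists r.2.
exists (u, u'); split=> // [[p q] Qpq|[p q] /= [p_path q_path] /andP[p_fin q_fin] [pu qu]].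
  by split; [apply: u_ub|apply: u'_ub]; exists (p, q).
have [_ [a Qa <-] pa] := u_lub p p_path p_fin pu.
have [_ [b Qb <-] qb] := u'_lub q q_path q_fin qu.
(* The two coordinates are reached by possibly different members; directedness provides one member
   above both. *)
have [c Qc [ac bc]] := Q_dir a b Qa Qb; exists c => //.
have [_ /andP[a1_fin a2_fin]] := Q_val a Qa; have [_ /andP[b1_fin b2_fin]] := Q_val b Qb.
by split; [apply: gext_trans ac.1|apply: gext_trans bc.2].
Qed.

(** A finite element of type D is excluded because vertices of D emit finitely many edges of D. Such
    an element ends at some u_i, and the path has to be varied inside the product instead. *)
Lemma elt_approx t (m : elt t) : evalid m -> emax m ->
  (t = None -> ~~ efin m) ->
  exists a : nat -> elt t,
    (forall n, [/\ evalid (a n), efin (a n), ~~ ezero (a n) & eorg (a n) = eorg m]) /\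
    forall c, evalid c -> efin c -> exists N, forall n, (N <= n)%N ->
      [/\ elt_ext c m -> elt_ext c (a n),
          ~ elt_ext c m -> forall r, elt_ext (a n) r -> ~ elt_ext c r
        & ~ elt_ext (a n) c].
Proof.
case: t m => [i [p q]|p] /=; last first.
  move=> p_path _ /(_ erefl); rewrite negbK => p_inf.
  have [a [a_val a_lim]] := gpath_approx p_path (or_introl p_inf).
  exists a; split=> [n|c c_path c_fin]; last exact: a_lim.
  by have [? ? ? a_org] := a_val n; split=> //; rewrite a_org.
move=> [p_path q_path] [p_max q_max] _.
have [a [a_val a_lim]] := gpath_approx p_path p_max.
have [b [b_val b_lim]] := gpath_approx q_path q_max.
exists (fun n => (a n, b n)); split=> [n|[c d] /= [c_path d_path] /andP[c_fin d_fin]].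
  have [? ? /negbTE a_nz a_org] := a_val n; have [? ? ? b_org] := b_val n.
  by split=> //=; [apply/andP|rewrite a_nz|rewrite a_org b_org].
have [N1 lim1] := a_lim c c_path c_fin; have [N2 lim2] := b_lim d d_path d_fin.
exists (maxn N1 N2) => n; rewrite geq_max => /andP[/lim1[c_in c_out c_big] /lim2[d_in d_out d_big]].
split=> [[cp dq]|cd [r1 r2] [ar br] [cr dr]|[ac _] //].
  by split; [apply: c_in|apply: d_in].
have [cp|/c_out/(_ _ ar)//] := pselect (gext c p).
have [dq|/d_out/(_ _ br)//] := pselect (gext d q).
by apply: cd.
Qed.

(** For type D this uses that u_i is (v_i, w_i) with v_i in L_i and w_i in M_i. Maximality of a
    finite element thus depends on its terminus alone. *)
Lemma emax_fin t (m : elt t) o :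
  (forall i, infinite_emitters (E i) (v i)) ->
  (forall i, infinite_emitters (F i) (w i)) ->
  eter m = Some o -> emax m <-> vmax o.
Proof.
move=> v_inf w_inf; case: t m => [i [[x s|f] [y u|g]]|[x s|f]] //= [<-] /=.
  split=> [[[//|[_ [<-] ?]] [//|[_ [<-] ?]]] //|[? ?]].
  by split; right; eexists.
rewrite /ends_in /=; case: (last _ _) => j /=.
  by split=> // _; right; exists (U j) => //; exists j.
by split=> // -[//|[_ [<-] [k]]].
Qed.

End Elements.

Lemma onth_last (T : Type) (a : T) s : onth (a :: s) (size s) = Some (last a s).
Proof. by elim: s a => [|b s IHs] a //=; apply: IHs. Qed.

Lemma onth_lastE (T : Type) (a b : T) s n : onth (a :: s) n = Some b ->
  onth (a :: s) n.+1 = None -> n = size s /\ b = last a s.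
Proof.
move=> sn sSn; have ns : n = size s.
  apply/eqP; rewrite eqn_leq -ltnS -[X in _ && X]ltnS.
  by rewrite -[X in X && _](onthTE (a :: s)) -[X in _ && X](onthNE (a :: s)) sn sSn.
by split=> //; move: sn; rewrite ns onth_last => -[].
Qed.

(** * Concatenation and extension of paths in Omega *)

Section OmegaPaths.
Variables (E F : bool -> digraph).
Variables (v : forall i, vert (E i)) (w : forall i, vert (F i)).

Local Notation opath := (opath E F).
Local Notation elt := (elt E F).
Local Notation pelt := (pelt E F).
Local Notation eorg := (elt_org v w).
Local Notation eter := (elt_ter v w).
Local Notation porg := (porg v w).
Local Notation pter := (pter v w).
Local Notation pcons := (pcons v w).
Local Notation pcat := (pcat v w).

Hypothesis v_inf : forall i, infinite_emitters (E i) (v i).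
Hypothesis w_inf : forall i, infinite_emitters (F i) (w i).

Implicit Types (m : pelt).

Section Strings.
Implicit Types (x y z mu nu : opath).

(** The common core of finite and infinite paths. Elements that have a successor are finite
    automatically, as composability gives them a terminus; a finite path adds a terminus of the
    whole, an infinite path adds [pmax]. *)
Definition gval x : Prop := composable v w x /\
  forall n m, elt_at x n = Some m -> evalid (tagged m) /\ ~~ ezero (tagged m).

Definition pmax x : Prop :=
  match x with
  | Str o [::] => vmax o
  | Str _ (m :: s) => emax (tagged (last m s))
  | IStr _ => True
  end.

Lemma opath_ext x y : porg x = porg y -> elt_at x =1 elt_at y -> x = y.
Proof.
case: x y => [o s|f] [o' t|g] xy_org xy.
- by rewrite (eq_from_onth xy); congr Str.
- by have := xy (size s); rewrite /= onth_default.
- by have := xy (size t); rewrite /= onth_default.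
- by congr IStr; apply/funext => n; have [] := xy n.
Qed.

Lemma elt_at_prefix x n : elt_at x n = None -> elt_at x n.+1 = None.
Proof.
case: x => // o s; rewrite /elt_at => sn; apply: onth_default.
by apply: leqW; rewrite -onthNE sn.
Qed.

Lemma elt_at_lt x n k m : elt_at x n = Some m -> (k <= n)%N ->
  exists m', elt_at x k = Some m'.
Proof.
move=> xn /subnKC kn; case xk: (elt_at x k) => [m'|]; first by exists m'.
have : elt_at x (k + (n - k)) = None.
  by elim: (n - k)%N => [|j IHj]; rewrite ?addn0 // addnS; apply: elt_at_prefix.
by rewrite kn xn.
Qed.

Lemma gval_at_fin x n m m' : gval x -> elt_at x n = Some m ->
  elt_at x n.+1 = Some m' -> efin (tagged m).
Proof. by move=> [[_ xS] _] /xS/[apply] -[/eter_fin]. Qed.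

Lemma is_fpathE x : is_fpath v w x <-> gval x /\ exists o, pter x = Some o.
Proof.
case: x => [o s|f]; last by split=> [[_ []]|[_ [o]]].
split=> [[comp s_fin]|[[comp s_val] s_ter]].
  split; first by split=> // n m /s_fin/is_fin_eltE[].
  case: s s_fin {comp} => [|m s] s_fin /=; first by exists o.
  by apply: fin_eter; have /is_fin_eltE[] := s_fin (size s) _ (onth_last m s).
split=> // n m sn; apply/is_fin_eltE; have [m_val m_nz] := s_val n m sn.
split=> //; case sSn: (elt_at (Str o s) n.+1) => [m'|].
  exact: gval_at_fin (conj comp s_val) sn sSn.
case: s sn sSn s_ter {comp s_val} => [|m0 s] sn sSn; first by rewrite onth0n in sn.
by have [_ ->] := onth_lastE sn sSn; move=> [o' /= /eter_fin].
Qed.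

Lemma is_ipathE x : is_ipath v w x <-> gval x /\ pmax x.
Proof.
case: x => [o s|f]; last first.
  split=> [[comp f_fin]|[f_val _]].
    by split=> //; split=> // n m [<-]; have /is_fin_eltE[] := f_fin n.
  split=> [|n]; first by case: f_val.
  have [f_n f_nz] := f_val.2 n _ erefl.
  by apply/is_fin_eltE; split=> //; apply: (@gval_at_fin (IStr f) n _ (f n.+1)).
case: s => [|m0 s].
  have nil_val : (composable v w (Str o [::])) <-> gval (Str o [::]).
    by split=> [?|[]] //; split=> // n m; rewrite /= onth0n.
  by case: o nil_val => [i|i y z] nil_val; split=> -[/nil_val].
have -> : is_ipath v w (Str o (m0 :: s)) <->
    composable v w (Str o (m0 :: s)) /\ forall n m, onth (m0 :: s) n = Some m ->
    if n.+1 == (size s).+1 then is_inf_elt (tagged m) else is_fin_elt (tagged m).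
  by case: o.
split=> [[comp s_elt]|[s_val s_max]].
  split; last first.
    by have := s_elt _ _ (onth_last m0 s); rewrite eqxx => /is_inf_eltE[].
  split=> // n m /s_elt; case: eqP => _; first by move=> /is_inf_eltE[].
  by move=> /is_fin_eltE[].
split=> [|n m sn]; first by case: s_val.
have [m_val m_nz] := s_val.2 n m sn.
case sSn: (onth (m0 :: s) n.+1) => [m'|].
  case: eqP => [[ns]|_]; first by rewrite ns onth_default in sSn.
  by apply/is_fin_eltE; split=> //; apply: (@gval_at_fin (Str o (m0 :: s)) n m m').
have [-> m_last] := onth_lastE sn sSn; rewrite eqxx.
by apply/is_inf_eltE; split=> //; rewrite m_last.
Qed.

(** * Prepending an element, with merging *)

(** Used as a number, this is the index shift caused by prepending: a merge keeps the positions of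
    the later elements, otherwise they move by one. *)
Definition absorb m x : bool :=
  if elt_at x 0%N is Some m' then tag m == tag m' else false.

Definition phead m x : pelt :=
  if elt_at x 0%N is Some m' then head m (merge m m') else m.

Lemma pcons_at0 m x : elt_at (pcons m x) 0%N = Some (phead m x).
Proof.
by case: x => [o [|m' s]|f]; rewrite /phead /= /merge //; case: eqP.
Qed.

Lemma pcons_atS m x n : elt_at (pcons m x) n.+1 = elt_at x (n + absorb m x)%N.
Proof.
case: x => [o [|m' s]|f]; rewrite /absorb /= /merge.
- by rewrite addn0 !onth0n.
- by case: eqP => _ /=; rewrite ?addn1 ?addn0.
- case: eqP => _ /=; first by rewrite nth_nil subn1 addn1.
  by case: n => [|n] /=; rewrite ?nth_nil // addn0 subn2.
Qed.

(** In the merging case both elements are presented over a single index [t], so that [elt_cat a b]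
    can be written without a cast. *)
Variant pcons_spec m x : bool -> pelt -> Type :=
  | PconsApart of (forall m', elt_at x 0%N = Some m' -> tag m <> tag m') :
      pcons_spec m x false m
  | PconsMerge t (a b : elt t) of m = Tagged elt a
      & elt_at x 0%N = Some (Tagged elt b) :
      pcons_spec m x true (Tagged elt (elt_cat a b)).

Lemma pconsP m x : pcons_spec m x (absorb m x) (phead m x).
Proof.
rewrite /absorb /phead; case x0: (elt_at x 0%N) => [m'|]; last first.
  by apply: PconsApart => m'; rewrite x0.
rewrite /merge; case: m m' x0 => [t a] [t' b] /= x0.
case: eqP => tt'; last by apply: PconsApart => m'; rewrite x0 => -[<-].
by case: t' / tt' b x0 => b x0; rewrite tagged_asE; apply: PconsMerge.
Qed.

Lemma tag_phead m x : tag (phead m x) = tag m.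
Proof. by case: pconsP => // t a b ->. Qed.

Definition joinable m x := [/\ evalid (tagged m), ~~ ezero (tagged m) &
  eter (tagged m) = Some (porg x)].

Lemma porg_at0 x m : gval x -> elt_at x 0%N = Some m -> porg x = eorg (tagged m).
Proof. by move=> [[+ _] _]; apply. Qed.

Lemma eorg_phead m x : gval x -> joinable m x ->
  eorg (tagged (phead m x)) = eorg (tagged m).
Proof.
move=> x_val [m_val _ mx]; case: pconsP => // t a b m_eq x0.
rewrite m_eq /= in m_val mx *; apply: eorg_cat => //.
by rewrite mx (porg_at0 x_val x0).
Qed.

Lemma porg_pcons m x : gval x -> joinable m x ->
  porg (pcons m x) = eorg (tagged m).
Proof.
case: x => [o [|m' s]|f] // f_val mf; rewrite -(eorg_phead f_val mf) /=.
by have /= [->] := pcons_at0 m (IStr f).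
Qed.

Lemma gval_pcons m x : gval x -> joinable m x -> gval (pcons m x).
Proof.
move=> x_val mx; have [m_val m_nz m_ter] := mx.
have x0_join t (a b : elt t) : m = Tagged elt a ->
    elt_at x 0%N = Some (Tagged elt b) -> eter a = Some (eorg b).
  by move=> m_eq x0; move: m_ter; rewrite m_eq (porg_at0 x_val x0).
split; first split=> [m0|[|n] m0 m1].
- rewrite pcons_at0 => -[<-]; rewrite porg_pcons //.
  by apply/esym/eorg_phead.
- rewrite pcons_at0 pcons_atS => -[<-].
  case: pconsP => [apart x1|t a b m_eq x0 x1].
    by rewrite m_ter (porg_at0 x_val x1); split=> //; apply: apart.
  have [bt t_ne] := x_val.1.2 _ _ _ x0 x1.
  by split=> //=; rewrite eter_cat ?bt //; apply: x0_join.
- by rewrite !pcons_atS addSn; apply: x_val.1.2.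
move=> [|n] m0; last by rewrite pcons_atS; apply: x_val.2.
rewrite pcons_at0 => -[<-]; case: pconsP => // t a b m_eq x0.
have ab := x0_join _ _ _ m_eq x0; have [b_val b_nz] := x_val.2 _ _ x0.
rewrite m_eq /= in m_val m_nz.
split=> /=; first exact: evalid_cat ab.
by rewrite ezero_cat ?(negbTE m_nz) //; apply: eter_fin ab.
Qed.

Lemma pter_pcons m x : gval x -> joinable m x -> pter (pcons m x) = pter x.
Proof.
move=> x_val [_ _ mx]; case: x x_val mx => [o [|m' s]|f] // x_val mx.
rewrite /pcons /merge; case: eqP => // tt'.
case: m m' tt' x_val mx => [t a] [t' b] /= tt'; case: t' / tt' b => b x_val mx.
rewrite tagged_asE; case: s x_val => //= x_val.
by rewrite eter_cat //= mx; congr Some; apply: (porg_at0 x_val erefl).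
Qed.

Lemma pmax_pcons m x : gval x -> joinable m x -> pmax (pcons m x) <-> pmax x.
Proof.
move=> x_val [_ _ mx]; case: x x_val mx => [o [|m' s]|f] // x_val mx.
  exact: emax_fin mx.
rewrite /pcons /merge; case: eqP => // tt'.
case: m m' tt' x_val mx => [t a] [t' b] /= tt'; case: t' / tt' b => b x_val mx.
rewrite tagged_asE; case: s x_val => //= x_val.
apply: (emax_cat (v := v) (w := w)); rewrite mx; congr Some.
exact: (porg_at0 x_val erefl).
Qed.

(** Merging a nonzero element strictly lengthens [m], so the head of the result tells whether a
    merge took place; then tails, or remainders, can be compared. *)
Lemma pconsI m x y : gval x -> gval y -> joinable m x -> joinable m y ->
  pcons m x = pcons m y -> x = y.
Proof.
move=> x_val y_val mx my xy.
have [_ _ m_ter] := mx; have m_fin := eter_fin m_ter.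
have xy_org : porg x = porg y by have [_ _] := my; rewrite m_ter => -[].
have head_eq : phead m x = phead m y.
  by apply/Some_inj; rewrite -!pcons_at0 xy.
have atS n : elt_at x (n + absorb m x) = elt_at y (n + absorb m y).
  by rewrite -!pcons_atS xy.
have nz z t (a b : elt t) : gval z -> m = Tagged elt a ->
    elt_at z 0%N = Some (Tagged elt b) -> m <> Tagged elt (elt_cat a b).
  move=> z_val m_eq /z_val.2[_ /negP b_nz]; rewrite m_eq => /(@Tagged_inj _ elt) ab; apply: b_nz.
  by apply: (@ecat_id _ _ _ a); rewrite // -[efin a]/(efin (tagged (Tagged elt a))) -m_eq.
apply: opath_ext => // n.
case: (pconsP m x) head_eq atS => [_|t a b m_eq x0].
  case: (pconsP m y) => [_ _ /(_ n)|t a b m_eq y0 ab]; first by rewrite !addn0.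
  by case: (nz _ _ _ _ y_val m_eq y0).
case: (pconsP m y) => [_ ab|t' a' b' m_eq' y0 ab].
  by case: (nz _ _ _ _ x_val m_eq x0).
case: n => [|n]; last by move=> /(_ n); rewrite !addn1.
have tt' : t' = t by move: m_eq; rewrite m_eq' => /(congr1 tag).
case: t / tt' a b m_eq x0 ab => a b m_eq x0 /(@Tagged_inj _ elt) ab _.
have aa' : a = a' by apply: (@Tagged_inj _ elt); rewrite -m_eq.
rewrite x0 y0; congr (Some (Tagged _ _)); rewrite -aa' in ab.
rewrite m_eq /= in m_ter; apply: (ecatI (v := v) (w := w)) ab; first by rewrite m_ter (porg_at0 x_val x0).
by rewrite m_ter xy_org (porg_at0 y_val y0).
Qed.

Lemma is_fpath_cons o m s : is_fpath v w (Str o (m :: s)) <->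
  exists o', [/\ evalid (tagged m) /\ ~~ ezero (tagged m), o = eorg (tagged m),
    eter (tagged m) = Some o', is_fpath v w (Str o' s) &
    forall m', onth s 0%N = Some m' -> tag m <> tag m'].
Proof.
split=> [[[s0 sS] s_fin]|[o' [m_val -> mo' [[s0 sS] s_fin] apart]]].
  have /is_fin_eltE[m_val m_fin m_nz] := s_fin 0%N m erefl.
  have [o' mo'] := fin_eter v w m_fin; exists o'; split=> //.
  - exact: s0.
  - split; last by move=> n m'; apply: (s_fin n.+1).
    split=> [m' /= s'0|n]; last exact: (sS n.+1).
    by have [] := sS 0%N m m' erefl s'0; rewrite mo' => -[].
  - by move=> m' s'0; have [] := sS 0%N m m' erefl s'0.
split; last first.
  case=> [|n] m' /=; last exact: s_fin.
  by move=> [<-]; apply/is_fin_eltE; split; [case: m_val|apply: eter_fin mo'|case: m_val].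
split=> [m' [<-] //|[|n] m' m'' /=]; last exact: sS.
move=> [<-] s'0; split; last exact: apart.
by rewrite mo' -(s0 _ s'0).
Qed.

Lemma is_fpath_nil o : is_fpath v w (Str o [::]).
Proof. by split; [split=> // n m m'|move=> n m]; rewrite /= onth0n. Qed.

Lemma fpath_ind (P : opath -> Prop) :
  (forall o, P (Str o [::])) ->
  (forall o m s, evalid (tagged m) -> ~~ ezero (tagged m) ->
     eter (tagged m) = Some o -> is_fpath v w (Str o s) ->
     (forall m', onth s 0%N = Some m' -> tag m <> tag m') ->
     P (Str o s) -> P (Str (eorg (tagged m)) (m :: s))) ->
  forall mu, is_fpath v w mu -> P mu.
Proof.
move=> P0 PS [o s|f]; last by case.
elim: s o => [|m s IHs] o // /is_fpath_cons[o' [[m_val m_nz] -> mo' s_path apart]].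
by apply: PS mo' _ _ _ => //; apply: IHs.
Qed.

Lemma pter_cons o m s : eter (tagged m) = Some o ->
  pter (Str (eorg (tagged m)) (m :: s)) = pter (Str o s).
Proof. by case: s. Qed.

Lemma gval_pcat mu z : is_fpath v w mu -> gval z -> pter mu = Some (porg z) ->
  [/\ gval (pcat mu z), porg (pcat mu z) = porg mu, pter (pcat mu z) = pter z &
      pmax (pcat mu z) <-> pmax z].
Proof.
move=> mu_path z_val; elim/fpath_ind: mu / mu_path => [o [->] //|o m s].
move=> m_val m_nz mo s_path _ IHs; rewrite (pter_cons _ mo) => /IHs.
move=> [sz_val sz_org sz_ter sz_max].
have m_join : joinable m (pcat (Str o s) z) by split; rewrite // sz_org.
split.
- exact: gval_pcons m_join.
- exact: porg_pcons m_join.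
- by rewrite -sz_ter; apply: pter_pcons.
- by rewrite -sz_max; apply: pmax_pcons.
Qed.

Lemma pcatI mu y z : is_fpath v w mu -> gval y -> gval z ->
  pter mu = Some (porg y) -> pter mu = Some (porg z) ->
  pcat mu y = pcat mu z -> y = z.
Proof.
move=> mu_path y_val z_val; elim/fpath_ind: mu / mu_path => [//|o m s].
move=> m_val m_nz mo s_path _ IHs; rewrite (pter_cons _ mo) => sy sz.
have [sy_val sy_org _ _] := gval_pcat s_path y_val sy.
have [sz_val sz_org _ _] := gval_pcat s_path z_val sz.
move=> /pconsI yz; apply: IHs => //.
by apply: yz => //; split; rewrite // ?sy_org ?sz_org.
Qed.

(** The two halves have the same type, so prepending the second of them merges them again. This is
    what makes [pcat] associative across a merge. *)
Lemma pcons_cat t (a b : elt t) z : gval z -> evalid a -> ~~ ezero a ->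
  eter a = Some (eorg b) -> joinable (Tagged elt b) z ->
  pcons (Tagged elt (elt_cat a b)) z = pcons (Tagged elt a) (pcons (Tagged elt b) z).
Proof.
move=> z_val a_val a_nz ab bz; have [b_val b_nz b_ter] := bz.
have a_fin := eter_fin ab; have b_fin := eter_fin b_ter.
have abz : joinable (Tagged elt (elt_cat a b)) z.
  by split=> /=; rewrite ?ezero_cat ?(negbTE a_nz) ?(eter_cat ab) //; apply: evalid_cat ab.
have bz_val := gval_pcons z_val bz.
have abz' : joinable (Tagged elt a) (pcons (Tagged elt b) z).
  by split=> //; rewrite porg_pcons.
apply: opath_ext => [|n].
  by rewrite !porg_pcons //=; apply: eorg_cat ab.
have bz0 := pcons_at0 (Tagged elt b) z.
case: n => [|n]; last first.
  rewrite !pcons_atS; have -> : absorb (Tagged elt a) (pcons (Tagged elt b) z).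
    by rewrite /absorb bz0 tag_phead eqxx.
  by rewrite addn1 pcons_atS.
rewrite !pcons_at0 /phead bz0 /merge tag_phead eqxx /=.
rewrite /phead; case: (elt_at z 0%N) => [[t' c]|] /=; last by rewrite tagged_asE.
rewrite /merge /=; case: eqP => tt' /=; last by rewrite tagged_asE.
by case: t' / tt' c => c; rewrite !tagged_asE ecatA.
Qed.

Lemma pcat_pcons m y z : is_fpath v w y -> gval z -> joinable m y ->
  pter y = Some (porg z) -> pcat (pcons m y) z = pcons m (pcat y z).
Proof.
case: y => [o [|m' s]|f]; [by []| |by case].
move=> s_path z_val [m_val m_nz m_ter] s_ter.
rewrite /pcons /merge; case: eqP => // tt'.
have /is_fpath_cons[o' [[m'_val m'_nz] o_eq m'o' s'_path _]] := s_path.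
case: m m' tt' m'_val m'_nz o_eq m'o' m_val m_nz m_ter s_path s_ter => [t a] [t' b] /= tt'.
case: t' / tt' b => b b_val b_nz o_eq bo' a_val a_nz a_ter s_path s_ter.
rewrite tagged_asE /=.
have s'_ter : pter (Str o' s) = Some (porg z) by rewrite -s_ter; case: (s) => //=.
have [sz_val sz_org _ _] := gval_pcat s'_path z_val s'_ter.
apply: pcons_cat => //; first by rewrite a_ter o_eq.
by split=> //; rewrite sz_org.
Qed.

Lemma is_fpath_pcat mu nu : is_fpath v w mu -> is_fpath v w nu ->
  pter mu = Some (porg nu) -> is_fpath v w (pcat mu nu).
Proof.
move=> mu_path /is_fpathE[nu_val nu_ter] mn; apply/is_fpathE.
by have [? _ -> _] := gval_pcat mu_path nu_val mn.
Qed.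

Lemma pcatA mu nu z : is_fpath v w mu -> is_fpath v w nu -> gval z ->
  pter mu = Some (porg nu) -> pter nu = Some (porg z) ->
  pcat (pcat mu nu) z = pcat mu (pcat nu z).
Proof.
move=> mu_path nu_path z_val + nz; have /is_fpathE[nu_val _] := nu_path.
elim/fpath_ind: mu / mu_path => [//|o m s].
move=> m_val m_nz mo s_path _ IHs; rewrite (pter_cons _ mo) => sn.
have [sn_val sn_org sn_ter _] := gval_pcat s_path nu_val sn.
rewrite -[pcat (Str _ (m :: s)) _]/(pcons m (pcat (Str o s) nu)) pcat_pcons ?sn_ter //.
- by rewrite IHs.
- exact: is_fpath_pcat.
- by split; rewrite // sn_org.
Qed.

Lemma pcat_nil mu o : is_fpath v w mu -> pter mu = Some o -> pcat mu (Str o [::]) = mu.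
Proof.
move=> mu_path; elim/fpath_ind: mu / mu_path => [o' [->] //|o' m s].
move=> m_val m_nz mo' s_path apart IHs; rewrite (pter_cons _ mo') => /IHs /= ->.
case: s apart {s_path IHs} => // m' s /(_ m' erefl) mm' /=.
by rewrite /merge; case: eqP.
Qed.

Lemma plen_pcons m y : is_fpath v w y -> joinable m y ->
  plen (pcons m y) = elt_len (tagged m) + plen y.
Proof.
case: y => [o [|m' s]|f]; [| |by case].
  by move=> _ _; rewrite /= big_seq1 big_nil addr0.
move=> s_path m_join; rewrite /pcons /merge; case: eqP => tt'; last by rewrite /= big_cons.
have [_ _ m_ter] := m_join; have m_fin := eter_fin m_ter.
have /is_fpath_cons[o' [_ _ /eter_fin m'_fin _ _]] := s_path.
case: m m' tt' m_fin m'_fin {m_join m_ter s_path} => [t a] [t' b] /= tt'.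
case: t' / tt' b => b a_fin b_fin.
by rewrite tagged_asE !big_cons elt_len_cat // addrA.
Qed.

Lemma plen_pcat mu nu : is_fpath v w mu -> is_fpath v w nu ->
  pter mu = Some (porg nu) -> plen (pcat mu nu) = plen mu + plen nu.
Proof.
move=> mu_path nu_path; have /is_fpathE[nu_val _] := nu_path.
elim/fpath_ind: mu / mu_path => [o _|o m s]; first by rewrite /plen big_nil add0r.
move=> m_val m_nz mo s_path _ IHs; rewrite (pter_cons _ mo) => sn.
have [sn_val sn_org sn_ter _] := gval_pcat s_path nu_val sn.
rewrite -[pcat (Str _ (m :: s)) _]/(pcons m (pcat (Str o s) nu)) plen_pcons.
- by rewrite IHs //= big_cons addrA.
- exact: is_fpath_pcat.
- by split; rewrite // sn_org.
Qed.

(** * Extension, factorization, joins and lengths *)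

(** The condition that defines [Z mu], freed from [ipath] so that finite paths can be compared with
    each other as well. *)
Definition pext mu x : Prop := porg x = porg mu /\
  forall n m, elt_at mu n = Some m ->
    exists2 m', elt_at x n = Some m' &
      if elt_at mu n.+1 is Some _ then m' = m else pelt_ext m m'.

Lemma pelt_extP t (a : elt t) m' : pelt_ext (Tagged elt a) m' <->
  exists2 b, m' = Tagged elt b & elt_ext a b.
Proof.
case: m' => t' b; rewrite /pelt_ext /=; split=> [[tt']|[c m'_eq ac]].
  by case: t' / tt' b => b; rewrite tagged_asE; exists b.
have tt' : t = t' by move: m'_eq => /(congr1 tag).
by case: t' / tt' b m'_eq => b /(@Tagged_inj _ elt) ->; rewrite tagged_asE.
Qed.

Lemma pelt_ext_tag m m' : pelt_ext m m' -> tag m = tag m'.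
Proof. by case. Qed.

Lemma pelt_ext_refl m : evalid (tagged m) -> efin (tagged m) -> pelt_ext m m.
Proof.
by case: m => t a a_val a_fin; apply/pelt_extP; exists a => //; apply: elt_ext_refl.
Qed.

Lemma pext_tag mu x n m m' : pext mu x -> elt_at mu n = Some m ->
  elt_at x n = Some m' -> tag m' = tag m.
Proof.
move=> [_ mux] /mux[m'' -> +] [<-].
by case: elt_at => [? ->|/pelt_ext_tag ->].
Qed.

Lemma pext_no_absorb m m' o s x : onth s 0%N = Some m' -> tag m <> tag m' ->
  pext (Str o s) x -> absorb m x = false.
Proof.
move=> s0 mm' s_ext; have [m'' x0 _] := s_ext.2 _ _ s0.
by rewrite /absorb x0 (pext_tag s_ext s0 x0); apply/eqP.
Qed.

Lemma pext_pcat mu z : is_fpath v w mu -> gval z -> pter mu = Some (porg z) ->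
  pext mu (pcat mu z).
Proof.
move=> mu_path z_val; elim/fpath_ind: mu / mu_path => [o [->]|o m s].
  by split=> // n m; rewrite /= onth0n.
move=> m_val m_nz mo s_path apart IHs; rewrite (pter_cons _ mo) => /[dup] sz /IHs s_ext.
have [sz_val sz_org _ _] := gval_pcat s_path z_val sz.
have m_join : joinable m (pcat (Str o s) z) by split; rewrite // sz_org.
rewrite -[pcat (Str _ (m :: s)) _]/(pcons m (pcat (Str o s) z)).
split; first by rewrite porg_pcons.
have no_absorb m' (s0 : onth s 0%N = Some m') := pext_no_absorb s0 (apart _ s0) s_ext.
move=> [|n] m'; last first.
  move=> sn; have [m'' s0] := elt_at_lt (x := Str o s) sn (leq0n n).
  by rewrite pcons_atS (no_absorb _ s0) addn0; apply: s_ext.2.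
move=> [<-]; exists (phead m (pcat (Str o s) z)); first exact: pcons_at0.
rewrite -[elt_at _ 1%N]/(onth s 0%N); case s0: (onth s 0%N) => [m''|].
  by have := no_absorb _ s0; case: pconsP.
case: pconsP => [_|t a b m_eq sz0].
  by apply: pelt_ext_refl => //; apply: eter_fin mo.
rewrite m_eq; apply/pelt_extP; exists (elt_cat a b) => //.
apply/(elt_extP v w); exists b; split=> //; first by have [] := sz_val.2 _ _ sz0.
by have [_ _] := m_join; rewrite m_eq /= (porg_at0 sz_val sz0) => ->.
Qed.

(** Prepending is inverted in two ways: by dropping the first element if nothing was merged, and
    after a merge by putting the remainder in its place, as [phead_set] does. The argument [o]
    supplies the new origin of a finite string. *)
Definition pshift o x : opath :=
  match x with Str _ s => Str o (behead s) | IStr f => IStr (fun n => f n.+1) end.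

Lemma elt_at_pshift o x n : elt_at (pshift o x) n = elt_at x n.+1.
Proof. by case: x => [o' [|m s]|f] //=; rewrite onth0n. Qed.

Lemma pshiftP x m o : gval x -> elt_at x 0%N = Some m ->
  eter (tagged m) = Some o ->
  [/\ gval (pshift o x), porg (pshift o x) = o & x = pcons m (pshift o x)].
Proof.
move=> x_val x0 mo; have [m_val m_nz] := x_val.2 _ _ x0.
have z_org : porg (pshift o x) = o.
  case: x x_val x0 => // f f_val [f0]; have := f_val.1.2 0%N _ _ erefl erefl.
  by rewrite f0 mo /= => -[[->]].
have z_val : gval (pshift o x).
  split; last by move=> n m'; rewrite elt_at_pshift; apply: x_val.2.
  split=> [m'|n m' m'']; rewrite !elt_at_pshift; last exact: x_val.1.2.
  by move=> x1; have [] := x_val.1.2 _ _ _ x0 x1; rewrite mo z_org => -[].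
have mz : joinable m (pshift o x) by split; rewrite // z_org.
have mz0 : absorb m (pshift o x) = false /\ phead m (pshift o x) = m.
  case: pconsP => // t a b m_eq; rewrite elt_at_pshift => x1.
  by have [_] := x_val.1.2 _ _ _ x0 x1; rewrite m_eq.
split=> //; apply: opath_ext => [|[|n]].
- by rewrite porg_pcons // (porg_at0 x_val x0).
- by rewrite pcons_at0 mz0.2.
- by rewrite pcons_atS mz0.1 addn0 elt_at_pshift.
Qed.

Definition phead_set m x : opath :=
  match x with
  | Str _ s => Str (eorg (tagged m)) (m :: behead s)
  | IStr f => IStr (fun n => if n is n'.+1 then f n else m)
  end.

Lemma elt_at_phead_set0 m x : elt_at (phead_set m x) 0%N = Some m.
Proof. by case: x. Qed.

Lemma elt_at_phead_setS m x n : elt_at (phead_set m x) n.+1 = elt_at x n.+1.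
Proof. by case: x => [o' [|m' s]|f] //=; rewrite onth0n. Qed.

Lemma phead_setP t (a r : elt t) x : gval x ->
  elt_at x 0%N = Some (Tagged elt (elt_cat a r)) ->
  evalid a -> ~~ ezero a -> evalid r -> ~~ ezero r -> eter a = Some (eorg r) ->
  [/\ gval (phead_set (Tagged elt r) x),
      porg (phead_set (Tagged elt r) x) = eorg r &
      x = pcons (Tagged elt a) (phead_set (Tagged elt r) x)].
Proof.
move=> x_val x0 a_val a_nz r_val r_nz ar; set z := phead_set _ x.
have z_org : porg z = eorg r by rewrite /z; case: (x).
have z0 : elt_at z 0%N = Some (Tagged elt r) by apply: elt_at_phead_set0.
have z_val : gval z.
  split; last first.
    by case=> [|n] m; [rewrite z0 => -[<-]|rewrite elt_at_phead_setS; apply: x_val.2].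
  split=> [m|[|n] m m']; rewrite ?z0 ?elt_at_phead_setS.
  - by move=> [<-].
  - by move=> [<-] x1; have := x_val.1.2 _ _ _ x0 x1; rewrite /= eter_cat.
  - exact: x_val.1.2.
have az : joinable (Tagged elt a) z by split; rewrite // z_org.
split=> //; apply: opath_ext => [|[|n]].
- by rewrite porg_pcons // (porg_at0 x_val x0) /= (eorg_cat a_val ar).
- by rewrite pcons_at0 x0 /phead z0 /merge eqxx /= tagged_asE.
- by rewrite pcons_atS /absorb z0 eqxx addn1 elt_at_phead_setS.
Qed.

(** Only the last element of [mu] can be properly extended in [x]; all earlier ones are peeled off
    unchanged. *)
Lemma pext_factor mu x : is_fpath v w mu -> gval x -> pext mu x ->
  exists z, [/\ gval z, pter mu = Some (porg z) & x = pcat mu z].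
Proof.
move=> mu_path; elim/fpath_ind: mu / mu_path x => [o x|o m s].
  by move=> x_val [x_org _]; exists x; rewrite x_org.
move=> m_val m_nz mo s_path apart IHs x x_val [x_org mx].
have [m' x0] := mx 0%N m erefl; rewrite -[elt_at _ 1%N]/(onth s 0%N).
rewrite (pter_cons _ mo); case: s {x_org} s_path apart IHs mx => [|m2 s] s_path apart IHs mx.
  case: m m_val m_nz mo {apart mx IHs} => t a a_val a_nz ao.
  move=> /pelt_extP[b m'_eq /(elt_extP v w)[r [r_val ar b_eq]]].
  have o_eq : o = eorg r by move: ao; rewrite /= ar => -[].
  (* A remainder of length zero is not a path element; in that case [z] begins with the next element
     of [x]. *)
  rewrite {}m'_eq {}b_eq in x0; case: (boolP (ezero r)) => [r0|r_nz].
    rewrite ecat0 // in x0; last exact: eter_fin ar.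
    by have [z_val z_org z_eq] := pshiftP x_val x0 ao; exists (pshift o x); rewrite z_org.
  have [z_val z_org z_eq] := phead_setP x_val x0 a_val a_nz r_val r_nz ar.
  by exists (phead_set (Tagged elt r) x); rewrite z_org o_eq.
move=> m'_eq; rewrite {}m'_eq in x0.
have [x1_val x1_org x_eq] := pshiftP x_val x0 mo.
have s_ext : pext (Str o (m2 :: s)) (pshift o x).
  split=> [|n m3 sn]; first exact: x1_org.
  by rewrite elt_at_pshift; apply: (mx n.+1 m3).
have [z [z_val sz x1_eq]] := IHs _ x1_val s_ext.
by exists z; split=> //; rewrite x_eq x1_eq.
Qed.

Definition psize mu : nat := match mu with Str _ s => size s | IStr _ => 0%N end.

Lemma elt_at_None mu n : is_fpath v w mu -> elt_at mu n = None <-> (psize mu <= n)%N.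
Proof.
case: mu => [o s _|f []//] /=; split=> [sn|/onth_default //].
by rewrite -onthNE sn.
Qed.

Lemma elt_at_Some mu n : is_fpath v w mu -> (n < psize mu)%N ->
  exists m, elt_at mu n = Some m.
Proof.
move=> mu_path nmu; case mun: (elt_at mu n) => [m|]; first by exists m.
by move: mun => /(elt_at_None n mu_path); rewrite leqNgt nmu.
Qed.

Lemma elt_at_psize mu n m : is_fpath v w mu -> elt_at mu n = Some m ->
  (n < psize mu)%N.
Proof.
move=> mu_path mun; rewrite ltnNge; apply/negP => /(elt_at_None n mu_path).
by rewrite mun.
Qed.

Lemma pext_at mu x n : is_fpath v w mu -> pext mu x -> (n.+1 < psize mu)%N ->
  elt_at x n = elt_at mu n.
Proof.
move=> mu_path [_ mux] nmu; have [m' mun1] := elt_at_Some mu_path nmu.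
have [m mun] := elt_at_lt mun1 (leqnSn n).
by have [m'' -> ] := mux n m mun; rewrite mun1 mun => ->.
Qed.

Lemma is_fpath_fin mu n m : is_fpath v w mu -> elt_at mu n = Some m ->
  [/\ evalid (tagged m), efin (tagged m) & ~~ ezero (tagged m)].
Proof. by case: mu => [o s [_ s_fin] /s_fin/is_fin_eltE|f []]. Qed.

Lemma pext_refl mu : is_fpath v w mu -> pext mu mu.
Proof.
move=> mu_path; split=> // n m mun; exists m => //; case: elt_at => //.
by have [? ? _] := is_fpath_fin mu_path mun; apply: pelt_ext_refl.
Qed.

Lemma pext_trans nu mu x : is_fpath v w mu -> is_fpath v w nu -> gval x ->
  pext mu nu -> pext nu x -> pext mu x.
Proof.
move=> mu_path nu_path x_val mn nx.
have [nu_val _] := (is_fpathE nu).1 nu_path.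
have [r [r_val mr nu_eq]] := pext_factor mu_path nu_val mn.
have [z [z_val nz x_eq]] := pext_factor nu_path x_val nx.
have [_ _ nu_ter _] := gval_pcat mu_path r_val mr.
have r_path : is_fpath v w r.
  by apply/is_fpathE; rewrite -nu_ter -nu_eq; split=> //; exists (porg z).
have rz : pter r = Some (porg z) by rewrite -nu_ter -nu_eq.
have [rz_val rz_org _ _] := gval_pcat r_path z_val rz.
rewrite x_eq nu_eq pcatA //; apply: pext_pcat => //.
by rewrite rz_org.
Qed.

(** All elements of [mu] sit at positions that are not the last one of [nu]. There [x] agrees with
    [nu] exactly, so what [mu] knows of [x] holds for [nu]. *)
Lemma pext_short mu nu x : is_fpath v w mu -> is_fpath v w nu ->
  pext mu x -> pext nu x -> (psize mu < psize nu)%N -> pext mu nu.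
Proof.
move=> mu_path nu_path mx nx mn; split=> [|n m mun]; first by rewrite -mx.1 nx.1.
have nmu := elt_at_psize mu_path mun.
have := mx.2 n m mun; rewrite (pext_at nu_path nx) //.
exact: leq_ltn_trans nmu mn.
Qed.

Lemma pcat_at_last mu z k m : is_fpath v w mu -> gval z ->
  pter mu = Some (porg z) -> psize mu = k.+1 -> elt_at mu k = Some m ->
  elt_at (pcat mu z) k = Some (phead m z).
Proof.
move=> mu_path z_val; elim/fpath_ind: mu / mu_path k => [//|o m0 s].
move=> m0_val m0_nz m0o s_path apart IHs k; rewrite (pter_cons _ m0o).
case: s s_path apart IHs => [|m1 s] s_path apart IHs.
  by move=> _ [<-] [<-]; apply: pcons_at0.
move=> sz [k_eq]; rewrite -[pcat _ z]/(pcons m0 (pcat (Str o (m1 :: s)) z)).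
case: k k_eq => [//|k] k_eq sk.
have s_ext := pext_pcat s_path z_val sz.
rewrite pcons_atS (pext_no_absorb (m' := m1) _ _ s_ext) ?addn0 //.
  by apply: IHs => //; rewrite /= k_eq.
exact: apart.
Qed.

Definition plast_set x m : opath :=
  if x is Str o s then Str o (rcons (take (size s).-1 s) m) else x.

(** Serves for joins of paths with equally many elements and for limits of ultrafilters; in the
    second use [l] may be infinite. *)
Lemma plast_setP mu k t (a l : elt t) : is_fpath v w mu -> psize mu = k.+1 ->
  elt_at mu k = Some (Tagged elt a) -> evalid l -> elt_ext a l ->
  let x := plast_set mu (Tagged elt l) in
  [/\ gval x, porg x = porg mu, pter x = eter l & pmax x <-> emax l] /\
  [/\ forall n, (n < k)%N -> elt_at x n = elt_at mu n,
      elt_at x k = Some (Tagged elt l) &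
      forall n, (k < n)%N -> elt_at x n = None].
Proof.
case: mu => [o s|f []//] mu_path /= s_size muk l_val al.
have [a_val a_fin a_nz] := is_fpath_fin mu_path muk; rewrite /= in a_val a_fin a_nz.
rewrite s_size /=; set x := Str o _.
have take_size : size (take k s) = k by rewrite size_takel // s_size.
have x_lt n : (n < k)%N -> elt_at x n = elt_at (Str o s) n.
  move=> nk; rewrite /x /elt_at -cats1 onth_cat take_size nk.
  by rewrite -[in RHS](cat_take_drop k s) onth_cat take_size nk.
have x_k : elt_at x k = Some (Tagged elt l).
  by rewrite /x /elt_at -cats1 onth_cat take_size ltnn subnn.
have x_gt n : (k < n)%N -> elt_at x n = None.
  by move=> nk; apply: onth_default; rewrite size_rcons take_size.
have s_gval := (is_fpathE _).1 mu_path.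
have x_gval : gval x.
  split; last first.
    move=> n m; have [nk|/x_gt ->|->] // := ltngtP n k.
      by rewrite x_lt //; apply: s_gval.1.2.
    by rewrite x_k => -[<-]; split=> //; apply: elt_ext_nz al a_nz.
  split=> [m|n m m'].
    have [k0|k0] := posnP k; last by rewrite x_lt //; apply: s_gval.1.1.1.
    rewrite -k0 x_k => -[<-] /=; rewrite (elt_ext_org _ _ a_val al).
    by move: muk; rewrite k0; apply: s_gval.1.1.1.
  have [nk|kn] := leqP k n; first by rewrite (x_gt n.+1).
  rewrite x_lt //; have [n1k|k_le] := ltnP n.+1 k.
    by rewrite x_lt //; apply: s_gval.1.1.2.
  have nk : n.+1 = k by apply/eqP; rewrite eqn_leq kn k_le.
  rewrite nk x_k => sn [<-] /=; rewrite (elt_ext_org _ _ a_val al).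
  by apply: (s_gval.1.1.2 n m (Tagged elt a)); rewrite // nk.
split; split=> //; first by rewrite /x; case: (take k s) => //= m0 s0; rewrite last_rcons.
by rewrite /x; case: (take k s) => //= m0 s0; rewrite last_rcons.
Qed.

(** Different numbers of elements make the paths comparable. With equally many, the paths can differ
    only in the last element, and there the join is taken coordinatewise. *)
Lemma pext_lub mu nu x : is_fpath v w mu -> is_fpath v w nu -> gval x ->
  pext mu x -> pext nu x ->
  exists lam, [/\ is_fpath v w lam, pext mu lam, pext nu lam &
    forall y, pext mu y -> pext nu y -> pext lam y].
Proof.
move=> mu_path nu_path x_val mx nx.
have [mn|nm|mn_size] := ltngtP (psize mu) (psize nu).
- by exists nu; split=> //; [apply: (pext_short mu_path nu_path mx nx mn)|apply: pext_refl].
- by exists mu; split=> //; [apply: pext_refl|apply: (pext_short nu_path mu_path nx mx nm)].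
have [mu0|] := posnP (psize mu).
  have nu_ext : pext mu nu.
    split=> [|n m /(elt_at_psize mu_path)]; first by rewrite -mx.1 nx.1.
    by rewrite mu0.
  by exists nu; split=> //; apply: pext_refl.
case k_eq: (psize mu) => [//|k] _; rewrite k_eq in mn_size.
have [a muk] : exists m, elt_at mu k = Some m by apply: elt_at_Some; rewrite ?k_eq.
have [b nuk] : exists m, elt_at nu k = Some m by apply: elt_at_Some; rewrite -?mn_size.
have muk1 : elt_at mu k.+1 = None by apply/elt_at_None; rewrite ?k_eq.
have nuk1 : elt_at nu k.+1 = None by apply/elt_at_None; rewrite -?mn_size.
have [c xk ac] := mx.2 k a muk; have [c' + bc] := nx.2 k b nuk.
rewrite xk muk1 nuk1 in ac bc * => -[c'_eq]; rewrite -{}c'_eq in bc.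
have [a_val a_fin a_nz] := is_fpath_fin mu_path muk.
have [b_val b_fin b_nz] := is_fpath_fin nu_path nuk.
case: a a_val a_fin a_nz ac muk => t a /= a_val a_fin a_nz /pelt_extP[d c_eq ad] muk.
case: b b_val b_fin b_nz bc nuk => t' b /= b_val b_fin b_nz /pelt_extP[d' c_eq' bd] nuk.
have tt' : t' = t by move: c_eq'; rewrite c_eq => /(congr1 tag).
case: t / tt' a a_val a_fin a_nz d c_eq ad muk => a a_val a_fin a_nz d c_eq ad muk.
rewrite c_eq in c_eq' xk; have /(@Tagged_inj _ elt) d_eq := c_eq'; rewrite -{}d_eq {c_eq'} in bd.
have [l [l_val l_fin al bl l_least]] := elt_ext_lub a_val a_fin b_val b_fin ad bd.
have [] := plast_setP mu_path k_eq muk l_val al; set lam := plast_set mu _.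
move=> [lam_val lam_org lam_ter _] [lam_lt lam_k lam_gt].
have lam_path : is_fpath v w lam.
  by apply/is_fpathE; split=> //; rewrite lam_ter; apply: fin_eter.
exists lam; split=> //.
- split=> // n m sn; have [nk|kn|nk] := ltngtP n k.
  + rewrite lam_lt //; exists m => //.
    have [m' ->] // : exists m', elt_at mu n.+1 = Some m'.
    exact: (elt_at_lt muk nk).
  + by have := elt_at_psize mu_path sn; rewrite k_eq ltnS leqNgt kn.
  + rewrite nk in sn *; rewrite muk1 lam_k; exists (Tagged elt l) => //.
    by move: sn; rewrite muk => -[<-]; apply/pelt_extP; exists l.
- split=> [|n m nun]; first by rewrite lam_org -nx.1 mx.1.
  have nk : (n <= k)%N by have := elt_at_psize nu_path nun; rewrite -mn_size.
  move: nk; rewrite leq_eqVlt => /orP[/eqP nk|nk].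
    rewrite nk in nun *; rewrite nuk1 lam_k; exists (Tagged elt l) => //.
    by move: nun; rewrite nuk => -[<-]; apply/pelt_extP; exists l.
  rewrite lam_lt // -(pext_at mu_path mx) ?k_eq //.
  exact: nx.2.
- move=> y my ny; split=> [|n m]; first by rewrite lam_org my.1.
  have [nk|/lam_gt -> //|->] := ltngtP n k.
    rewrite lam_lt // => sn; exists m; first by rewrite (pext_at mu_path my) // k_eq.
    have [/eqP n1k|n1k] := boolP (n.+1 == k); first by rewrite n1k lam_k.
    rewrite lam_lt; last by rewrite ltn_neqAle n1k.
    by have [m' ->] := elt_at_lt muk nk.
  rewrite lam_k lam_gt // => -[<-].
  have [c1 yk] := my.2 k _ muk; have [c2] := ny.2 k _ nuk.
  rewrite yk muk1 nuk1 => -[<-] /pelt_extP[b1 c1_eq bb1] /pelt_extP[b2 c1_eq' bb2].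
  exists c1 => //; apply/pelt_extP; exists b1 => //; apply: l_least => //.
  by move: c1_eq'; rewrite c1_eq => /(@Tagged_inj _ elt) ->.
Qed.

Lemma plen0 rho : is_fpath v w rho -> plen rho = 0 -> rho = Str (porg rho) [::].
Proof.
case: rho => [o [|m s]|f []] // s_path /=; rewrite big_cons => len0.
have [_ m_fin] := is_fpath_fin (n := 0%N) s_path erefl; case/negP.
have tail_ge0 : 0 <= (\sum_(m' <- s) elt_len (tagged m')).1 /\
    0 <= (\sum_(m' <- s) elt_len (tagged m')).2 :> int.
  elim/big_ind: _ => [//|a b [a1 a2] [b1 b2]|m' _]; last exact: elt_len_ge0.
  by rewrite !addr_ge0.
have [m1 m2] := elt_len_ge0 (tagged m).
apply: elt_len0 => //; move: len0 tail_ge0 m1 m2.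
case: (\sum_(_ <- _) _) (elt_len _) => [a1 a2] [b1 b2] [/= ab1 ab2] [a1_ge a2_ge] b1_ge b2_ge.
have /andP[/eqP-> _] : (b1 == 0) && (a1 == 0) by rewrite -paddr_eq0 // ab1.
by have /andP[/eqP-> _] : (b2 == 0) && (a2 == 0) by rewrite -paddr_eq0 // ab2.
Qed.

Lemma pext_plen_short mu nu x : is_fpath v w mu -> is_fpath v w nu ->
  pext mu x -> pext nu x -> (psize mu < psize nu)%N -> plen mu <> plen nu.
Proof.
move=> mu_path nu_path mx nx mn_size mn_len.
have mn := pext_short mu_path nu_path mx nx mn_size.
have [nu_val [o nu_ter]] := (is_fpathE nu).1 nu_path.
have [r [r_val mr nu_eq]] := pext_factor mu_path nu_val mn.
have [_ _ r_ter _] := gval_pcat mu_path r_val mr.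
have r_path : is_fpath v w r.
  by apply/is_fpathE; split=> //; exists o; rewrite -r_ter -nu_eq.
move: mn_len; rewrite nu_eq plen_pcat // -[LHS]addr0 => /addrI/esym/(plen0 r_path) r0.
by move: mn_size; rewrite nu_eq r0 pcat_nil // ltnn.
Qed.

(** The path with fewer elements would be a proper prefix of the other and hence shorter. With
    equally many elements the difference is confined to the last ones, and a finite prefix of one
    element is fixed by its lengths in both coordinates. *)
Lemma pext_plen_eq mu nu x : is_fpath v w mu -> is_fpath v w nu ->
  pext mu x -> pext nu x -> plen mu = plen nu -> mu = nu.
Proof.
move=> mu_path nu_path mx nx mn_len.
have [mn|nm|mn_size] := ltngtP (psize mu) (psize nu).
- by case: (pext_plen_short mu_path nu_path mx nx mn).
- by case: (pext_plen_short nu_path mu_path nx mx nm).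
have mn_org : porg mu = porg nu by rewrite -mx.1 nx.1.
case: mu mu_path mx mn_len mn_size mn_org => [o s|f []//].
case: nu nu_path nx => [o' s'|f []//].
case/lastP: s => [|s a]; case/lastP: s' => [|s' b]; rewrite /psize ?size_rcons //.
  by move=> _ _ _ _ _ _ /= ->.
move=> nu_path nx mu_path mx mn_len [mn_size] /= mn_org.
have ss' : s = s'.
  apply: eq_from_onth_le => n; rewrite -mn_size maxnn => ns.
  have := pext_at mu_path mx (n := n); have := pext_at nu_path nx (n := n).
  rewrite /psize !size_rcons !ltnS -mn_size => /(_ ns) -> /(_ ns).
  by rewrite /elt_at -!cats1 !onth_cat -mn_size ns.
move: mn_len; rewrite /= -!cats1 !big_cat !big_seq1 /= ss' => /addrI ab_len.
have at_last u c : elt_at (Str u (rcons s c)) (size s) = Some c /\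
    elt_at (Str u (rcons s c)) (size s).+1 = None.
  split; last by apply: onth_default; rewrite size_rcons.
  by rewrite /elt_at -cats1 onth_cat ltnn subnn.
rewrite -ss' in nu_path nx.
have [mu_s mu_s1] := at_last o a; have [nu_s nu_s1] := at_last o' b.
have [c xs ac] := mx.2 _ _ mu_s; have [c' + bc] := nx.2 _ _ nu_s.
rewrite xs mu_s1 nu_s1 in ac bc * => -[c'_eq]; rewrite -{}c'_eq in bc.
have [a_val a_fin a_nz] := is_fpath_fin mu_path mu_s.
have [b_val b_fin b_nz] := is_fpath_fin nu_path nu_s.
suff -> : a = b by rewrite mn_org.
have tab : tag a = tag b by rewrite (pelt_ext_tag ac) (pelt_ext_tag bc).
case: a b tab ac bc a_val a_fin b_val b_fin ab_len {mu_path nu_path mx nx a_nz b_nz at_last mu_s mu_s1 nu_s nu_s1}.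
move=> t a [t' b] /= tt'; case: t' / tt' b => b /pelt_extP[d ->] ad.
move=> /pelt_extP[d' /(@Tagged_inj _ elt) <-] bd a_val a_fin b_val b_fin ab_len.
by rewrite (elt_ext_len a_val a_fin b_val b_fin ad bd ab_len).
Qed.

End Strings.

(** * Infinite paths and cylinders *)

Local Notation ipath := (ipath v w).
Local Notation fpath := (is_fpath v w).

Implicit Types (kappa lam mu nu rho : opath) (x y z : ipath).

Lemma ipath_inj x y : x = y :> opath -> x = y.
Proof.
case: x y => [x x_path] [y y_path] /= xy; case: y / xy y_path => y_path.
by rewrite (Prop_irrelevance x_path y_path).
Qed.

Lemma ipath_gval x : gval x.
Proof. by have /is_ipathE[] := ipathP x. Qed.

Lemma ipath_pmax x : pmax x.
Proof. by have /is_ipathE[] := ipathP x. Qed.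

Lemma fpath_gval mu : fpath mu -> gval mu.
Proof. by move=> /is_fpathE[]. Qed.

Hint Resolve ipath_gval fpath_gval : core.

(** Left multiplication made total: the value [z] is a default where [pcat mu z] is not an infinite
    path, and [lmulE] states when the value is the intended one. *)
Definition lmul mu z : ipath :=
  if pselect (is_ipath v w (pcat mu z)) is left mz_path then IPath mz_path else z.

Lemma lmulE mu z : fpath mu -> pter mu = Some (porg z) ->
  lmul mu z = pcat mu z :> opath.
Proof.
move=> mu_path mz; rewrite /lmul; case: pselect => //= -[].
have [mz_val _ _ mz_max] := gval_pcat mu_path (ipath_gval z) mz.
by apply/is_ipathE; split=> //; apply/mz_max/ipath_pmax.
Qed.

Lemma porg_lmul mu z : fpath mu -> pter mu = Some (porg z) ->
  porg (lmul mu z) = porg mu.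
Proof.
by move=> mu_path mz; rewrite lmulE //; have [] := gval_pcat mu_path (ipath_gval z) mz.
Qed.

Lemma porg_pcat mu nu : fpath mu -> fpath nu -> pter mu = Some (porg nu) ->
  porg (pcat mu nu) = porg mu.
Proof. by move=> mu_path /fpath_gval nu_val /(gval_pcat mu_path nu_val)[]. Qed.

Lemma pter_pcat mu nu : fpath mu -> fpath nu -> pter mu = Some (porg nu) ->
  pter (pcat mu nu) = pter nu.
Proof. by move=> mu_path /fpath_gval nu_val /(gval_pcat mu_path nu_val)[]. Qed.

Lemma lmulI mu y z : fpath mu -> pter mu = Some (porg y) ->
  pter mu = Some (porg z) -> lmul mu y = lmul mu z -> y = z.
Proof.
move=> mu_path my mz /(congr1 (@ipval _ _ _ _)); rewrite !lmulE // => yz.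
by apply: ipath_inj; apply: pcatI yz.
Qed.

Lemma lmulA mu nu z : fpath mu -> fpath nu -> pter mu = Some (porg nu) ->
  pter nu = Some (porg z) -> lmul (pcat mu nu) z = lmul mu (lmul nu z).
Proof.
move=> mu_path nu_path mn nz; have mn_path := is_fpath_pcat mu_path nu_path mn.
by apply: ipath_inj; rewrite lmulE ?pter_pcat // [RHS]lmulE ?porg_lmul // lmulE // pcatA.
Qed.

Lemma ZP mu x : fpath mu -> Z mu x <->
  exists2 z : ipath, pter mu = Some (porg z) & x = lmul mu z.
Proof.
move=> mu_path; split=> [mux|[z mz ->]]; last first.
  by rewrite /Z /= lmulE //; apply: pext_pcat.
have [z [z_val mz x_eq]] := pext_factor mu_path (ipath_gval x) mux.
have z_path : is_ipath v w z.
  apply/is_ipathE; split=> //; have [_ _ _ [mz_max _]] := gval_pcat mu_path z_val mz.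
  by apply: mz_max; rewrite -x_eq; apply: ipath_pmax.
by exists (IPath z_path) => //; apply: ipath_inj; rewrite lmulE.
Qed.

Lemma Z_lmul_self mu z : fpath mu -> pter mu = Some (porg z) -> Z mu (lmul mu z).
Proof. by move=> mu_path mz; apply/ZP => //; exists z. Qed.

Lemma Z_pcat_sub mu rho : fpath mu -> fpath rho -> pter mu = Some (porg rho) ->
  Z (pcat mu rho) `<=` (Z mu : set ipath).
Proof.
move=> mu_path rho_path mr x /ZP[|z]; first exact: is_fpath_pcat.
rewrite pter_pcat // => rz ->; apply/ZP => //; exists (lmul rho z).
  by rewrite porg_lmul.
exact: lmulA.
Qed.

Lemma Z_lmul mu kappa z : fpath mu -> fpath kappa ->
  pter mu = Some (porg kappa) -> pter mu = Some (porg z) ->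
  Z (pcat mu kappa) (lmul mu z) <-> Z kappa z.
Proof.
move=> mu_path k_path mk mz; have mk_path := is_fpath_pcat mu_path k_path mk.
split=> /ZP => [/(_ mk_path)|/(_ k_path)] [y].
  rewrite pter_pcat // => ky; rewrite lmulA // => /lmulI -> //.
    exact: Z_lmul_self.
  by rewrite porg_lmul.
move=> ky ->; rewrite -lmulA //; apply: Z_lmul_self => //.
by rewrite pter_pcat.
Qed.

Lemma Z_porg mu x : Z mu x -> porg x = porg mu.
Proof. by case. Qed.

Lemma Z_nil x : Z (Str (porg x) [::]) x.
Proof. by split=> // n m; rewrite /= onth0n. Qed.

Lemma Z_nilE o x : Z (Str o [::]) x <-> porg x = o.
Proof. by split=> [[]|<-] //; apply: Z_nil. Qed.

Lemma pext_pcatE mu nu : fpath mu -> fpath nu -> pext mu nu ->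
  exists rho, [/\ fpath rho, pter mu = Some (porg rho) & nu = pcat mu rho].
Proof.
move=> mu_path nu_path mn.
have [rho [rho_val mr nu_eq]] := pext_factor mu_path (fpath_gval nu_path) mn.
exists rho; split=> //; apply/is_fpathE; split=> //.
have [_ _ <- _] := gval_pcat mu_path rho_val mr; rewrite -nu_eq.
by have /is_fpathE[] := nu_path.
Qed.

(** The join of [mu] and [nu], written as a continuation of each. Together with [Z_pcat_sub] it
    shows that two cylinders that meet intersect in a cylinder. *)
Lemma Z_common mu nu x : fpath mu -> fpath nu -> Z mu x -> Z nu x ->
  exists rho sigma, [/\ fpath rho /\ fpath sigma, pter mu = Some (porg rho),
    pter nu = Some (porg sigma), pcat mu rho = pcat nu sigma &
    forall y, Z mu y -> Z nu y -> Z (pcat mu rho) y].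
Proof.
move=> mu_path nu_path mx nx.
have [lam [lam_path ml nl lE]] := pext_lub mu_path nu_path (ipath_gval x) mx nx.
have [rho [rho_path mr lam_mr]] := pext_pcatE mu_path lam_path ml.
have [sigma [sigma_path ns lam_ns]] := pext_pcatE nu_path lam_path nl.
by exists rho, sigma; rewrite -lam_mr -lam_ns; split=> // y; apply: lE.
Qed.

Lemma Z_plen_eq mu nu x : fpath mu -> fpath nu -> Z mu x -> Z nu x ->
  plen mu = plen nu -> mu = nu.
Proof. by move=> mu_path nu_path; apply: pext_plen_eq. Qed.

(** * Single edges and the ways to leave a vertex *)

Inductive edge_path : opath -> Prop :=
  | edge_path_D d : edge_path (D_edge_path v w d)
  | edge_path_E i (e : edge (E i)) (z : vert (F i)) : edge_path (E_edge_path e z)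
  | edge_path_F i (y : vert (E i)) (f : edge (F i)) : edge_path (F_edge_path y f).

Lemma is_fpath_elt t (a : elt t) : is_fin_elt a ->
  fpath (Str (eorg a) [:: Tagged elt a]).
Proof.
move=> a_fin; split; last by move=> n m /onth1P[_ <-].
split=> [m /onth1P[_ <-] //|n m m' _ /=].
by rewrite onth0n.
Qed.

Lemma edge_path_fpath c : edge_path c -> fpath c.
Proof.
case=> [d|i e z|i y f].
- exact: (@is_fpath_elt None (Fin (G := D) (D_org d) [:: d])).
- exact: (@is_fpath_elt (Some i) (Fin (org e) [:: e], Fin z [::])).
- exact: (@is_fpath_elt (Some i) (Fin y [::], Fin (org f) [:: f])).
Qed.

Lemma edge_path_plen c : edge_path c -> 0 < (plen c).1 + (plen c).2.
Proof. by case=> [d|i e z|i y f]; rewrite /= big_seq1. Qed.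

Lemma Z_elt t (a : elt t) x : is_fin_elt a ->
  Z (Str (eorg a) [:: Tagged elt a]) x <->
  exists2 b, elt_at x 0%N = Some (Tagged elt b) & elt_ext a b.
Proof.
move=> /is_fin_eltE[a_val a_fin a_nz]; split=> [[_ /(_ 0%N _ erefl)]|[b x0 ab]].
  by move=> [m x0 /pelt_extP[b m_eq ab]]; exists b; rewrite -?m_eq.
split; last by move=> n m /onth1P[-> <-]; exists (Tagged elt b) => //; apply/pelt_extP; exists b.
by rewrite (porg_at0 (ipath_gval x) x0) /=; apply: elt_ext_org ab.
Qed.

Lemma gext_edge (G : digraph) (e : edge G) (p : gpath G) : is_gpath p ->
  gext (Fin (org e) [:: e]) p <-> gat p 0%N = Some e.
Proof.
move=> p_path; split=> [/gextP[] // _ /(_ 0%N e erefl) //|p0].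
apply/gextP => //; split; last by move=> n e' /onth1P[-> <-].
by have /is_gpathP[/(_ _ p0)] := p_path.
Qed.

Lemma gext_vertex (G : digraph) (y : vert G) (p : gpath G) : is_gpath p ->
  gext (Fin y [::]) p <-> gorg p = y.
Proof.
move=> p_path; split=> [/gextP[]//|<-].
by apply/gextP => //; split=> // n e; rewrite /= onth0n.
Qed.

Lemma Z_D d x : Z (D_edge_path v w d) x <->
  exists2 b : elt None, elt_at x 0%N = Some (Tagged elt b) & gat b 0%N = Some d.
Proof.
rewrite -[D_edge_path v w d]/(Str (eorg (t := None) (Fin (G := D) (D_org d) [:: d])) _).
rewrite Z_elt //; split=> -[b x0 db]; exists b => //;
  have [b_val _] := (ipath_gval x).2 _ _ x0; exact/(@gext_edge D).
Qed.

Lemma Z_E i (e : edge (E i)) (z : vert (F i)) x : Z (E_edge_path e z) x <->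
  exists2 b : elt (Some i), elt_at x 0%N = Some (Tagged elt b) &
    gat b.1 0%N = Some e /\ gorg b.2 = z.
Proof.
rewrite -[E_edge_path e z]/(Str (eorg (t := Some i) (Fin (org e) [:: e], Fin z [::])) _).
rewrite Z_elt //; split=> -[b x0 db]; exists b => //;
  have [[b1_path b2_path] _] := (ipath_gval x).2 _ _ x0.
  by case: db => /gext_edge -> // /gext_vertex ->.
by case: db => ? ?; split; [apply/gext_edge|apply/gext_vertex].
Qed.

Lemma Z_F i (y : vert (E i)) (f : edge (F i)) x : Z (F_edge_path y f) x <->
  exists2 b : elt (Some i), elt_at x 0%N = Some (Tagged elt b) &
    gorg b.1 = y /\ gat b.2 0%N = Some f.
Proof.
rewrite -[F_edge_path y f]/(Str (eorg (t := Some i) (Fin y [::], Fin (org f) [:: f])) _).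
rewrite Z_elt //; split=> -[b x0 db]; exists b => //;
  have [[b1_path b2_path] _] := (ipath_gval x).2 _ _ x0.
  by case: db => /gext_vertex -> // /gext_edge ->.
by case: db => ? ?; split; [apply/gext_vertex|apply/gext_edge].
Qed.

(** The edges of the two coordinates of a product element commute, so the first edge may be taken
    from [E] whenever that coordinate has positive length, and from [F] otherwise. *)
Lemma edge_path_head kappa : fpath kappa ->
  kappa = Str (porg kappa) [::] \/
  exists c rho, [/\ edge_path c, fpath rho, pter c = Some (porg rho) &
    kappa = pcat c rho].
Proof.
case: kappa => [o [|[t a] s]|f []] // s_path; [by left|right].
have [a_val a_fin a_nz] := is_fpath_fin (n := 0%N) s_path erefl.
have /is_fpath_cons[o' [_ /= o_eq _ _ _]] := s_path.
suff [c c_edge cs] : exists2 c, edge_path c & pext c (Str o (Tagged elt a :: s)).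
  have [rho [rho_path cr s_eq]] := pext_pcatE (edge_path_fpath c_edge) s_path cs.
  by exists c, rho; split.
have elt_pext (b : elt t) : evalid b -> elt_ext b a ->
    pext (Str (eorg b) [:: Tagged elt b]) (Str o (Tagged elt a :: s)).
  move=> b_val ba; split; first by rewrite /= o_eq; apply: elt_ext_org ba.
  by move=> n m /onth1P[-> <-]; exists (Tagged elt a) => //; apply/pelt_extP; exists a.
case: t a o_eq a_val a_fin a_nz s_path elt_pext => [i [p q]|p] /=; last first.
  case: p => [y [|d p]|//] // _ d_path _ _ _ ext; exists (D_edge_path v w d).
    exact: edge_path_D.
  by apply: (ext (Fin (G := D) (D_org d) [:: d])) => //; apply/(@gext_edge D).
move=> _ [p_path q_path] /andP[p_fin q_fin] pq_nz _ ext.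
case: p p_path p_fin pq_nz ext => [y [|e p]|//] /= p_path _ pq_nz ext.
  case: q q_path q_fin pq_nz ext => [z [|f q]|//] //= q_path _ _ ext.
  exists (F_edge_path y f); first exact: edge_path_F.
  apply: (ext (Fin y [::], Fin (org f) [:: f])) => //.
  by split; [apply/gext_vertex|apply/gext_edge].
exists (E_edge_path e (gorg q)); first exact: edge_path_E.
apply: (ext (Fin (org e) [:: e], Fin (gorg q) [::])) => //.
by split; [apply/gext_edge|apply/gext_vertex].
Qed.

(** Induction on the sum of the two coordinates of the length. The string structure is too coarse
    for this, as one path element can have many edges. *)
Lemma fpath_edge_ind (P : opath -> Prop) :
  (forall o, P (Str o [::])) ->
  (forall c rho, edge_path c -> fpath rho -> pter c = Some (porg rho) ->
     P rho -> P (pcat c rho)) ->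
  forall kappa, fpath kappa -> P kappa.
Proof.
move=> P0 PS kappa.
have [n] : exists n : nat, (plen kappa).1 + (plen kappa).2 < n%:Z.
  by exists `|((plen kappa).1 + (plen kappa).2)%R|.+1; lia.
elim: n kappa => [|n IHn] kappa.
  case: kappa => [o s|f //]; suff : 0 <= (plen (Str o s)).1 + (plen (Str o s)).2 by lia.
  rewrite /=; elim/big_ind: _ => [//|a b /=|m _]; first by lia.
  by have := elt_len_ge0 (tagged m); lia.
move=> k_len k_path; case: (edge_path_head k_path) => [-> //|[c [rho]]].
move=> [c_edge rho_path cr k_eq]; rewrite k_eq; apply: PS => //.
apply: IHn (rho_path); move: k_len.
rewrite k_eq plen_pcat //; last exact: edge_path_fpath.
by have := edge_path_plen c_edge; case: (plen c) (plen rho) => [a b] [a' b'] /=; lia.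
Qed.

(** This and the next four lemmas list which first edges exclude each other. An edge of [E] and an
    edge of [F] do not: both may begin the same product element. *)
Lemma Z_DD d d' x : Z (D_edge_path v w d) x -> Z (D_edge_path v w d') x -> d = d'.
Proof.
move=> /Z_D[b x0 d_b] /Z_D[b']; rewrite x0 => /Some_inj/(@Tagged_inj _ elt) <-.
by rewrite d_b => -[].
Qed.

Lemma Z_EE i (e e' : edge (E i)) (z z' : vert (F i)) x :
  Z (E_edge_path e z) x -> Z (E_edge_path e' z') x -> e = e'.
Proof.
move=> /Z_E[b x0 [e_b _]] /Z_E[b']; rewrite x0 => /Some_inj/(@Tagged_inj _ elt) <-.
by rewrite e_b => -[[]].
Qed.

Lemma Z_FF i (f f' : edge (F i)) (y y' : vert (E i)) x :
  Z (F_edge_path y f) x -> Z (F_edge_path y' f') x -> f = f'.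
Proof.
move=> /Z_F[b x0 [_ f_b]] /Z_F[b']; rewrite x0 => /Some_inj/(@Tagged_inj _ elt) <-.
by rewrite f_b => -[_ []].
Qed.

Lemma Z_DE d i (e : edge (E i)) (z : vert (F i)) x :
  Z (D_edge_path v w d) x -> ~ Z (E_edge_path e z) x.
Proof. by move=> /Z_D[b x0 _] /Z_E[b']; rewrite x0. Qed.

Lemma Z_DF d i (f : edge (F i)) (y : vert (E i)) x :
  Z (D_edge_path v w d) x -> ~ Z (F_edge_path y f) x.
Proof. by move=> /Z_D[b x0 _] /Z_F[b']; rewrite x0. Qed.

Lemma Vprod_tag i j (y : vert (E i)) (z : vert (F i)) (y' : vert (E j)) (z' : vert (F j)) :
  Vprod y z = Vprod y' z' -> i = j.
Proof. by case. Qed.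

Lemma of_D_vprod j i (y : vert (E i)) (z : vert (F i)) :
  of_D v w (U j) = Vprod y z ->
  infinite_emitters (E i) y /\ infinite_emitters (F i) z.
Proof.
move=> u_eq; have ji := Vprod_tag u_eq; case: i / ji y z u_eq => y z.
by move=> /Vprod_inj[<- <-].
Qed.

(* If the first coordinate of [x] ends at [y], or [x] enters [D] at once (so
   that [y = v_i]), then [y] is in [L_i]; similarly for [z]. *)
Lemma vertex_exit x i (y : vert (E i)) (z : vert (F i)) : porg x = Vprod y z ->
  (infinite_emitters (E i) y \/
    exists e, org e = y /\ Z (E_edge_path e z) x) /\
  (infinite_emitters (F i) z \/
    exists f, org f = z /\ Z (F_edge_path y f) x).
Proof.
move=> x_org; have x_val := ipath_gval x; have x_max := ipath_pmax x.
case x0: (elt_at x 0%N) => [[t a]|]; last first.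
  case: (ipval x) x_org x_max x0 => [o [|m s]|f] //= -> [? ?] _.
  by split; left.
have := porg_at0 x_val x0; rewrite x_org.
case: t a x0 => [j [p q]|[[j|j] s|f]] /= x0; last first.
- case: (D_org (f 0%N)) => j // /esym/of_D_vprod[? ?].
  by split; left.
- by [].
- by move=> /esym/of_D_vprod[? ?]; split; left.
move=> /[dup] /Vprod_tag ij; case: j / ij p q x0 => p q x0 /Vprod_inj[p_org q_org].
have [[p_path q_path] _] := x_val.2 _ _ x0; rewrite /= in p_path q_path.
(* A coordinate of length zero ends where it begins. The next element, if any, cannot be of a
   product type, as the index would have to be [i] again; so it starts in D at some u_j and the
   vertex is (v_j, w_j). Without a next element, maximality of the path applies. *)
have zero_inf : (zero_length p -> infinite_emitters (E i) y) /\
    (zero_length q -> infinite_emitters (F i) z).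
  case x1: (elt_at x 1%N) => [[t b]|].
    have [+ /=] := x_val.1.2 _ _ _ x0 x1; case: t b x1 => [j [p' q']|d] x1 /= pq_ter.
      case: (gter p) pq_ter => [a|] //; case: (gter q) => [b|] //=.
      by move=> /Some_inj/Vprod_tag ij; rewrite [in X in X <> _]ij.
    move=> _; have D_inf a b : Some (Vprod a b) = Some (of_D v w (gorg d)) ->
        infinite_emitters (E i) a /\ infinite_emitters (F i) b.
      by case: (gorg d) => j /Some_inj // /esym/of_D_vprod.
    move: pq_ter; case p_ter: (gter p) => [a|] //; case q_ter: (gter q) => [b|] //=.
    move=> /D_inf[a_inf b_inf]; split=> /gter_zero.
      by rewrite p_ter -p_org => -[<-].
    by rewrite q_ter -q_org => -[<-].
  case: (ipval x) x_max x0 x1 => [o [|m s]|f] //= + [m_eq].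
  case: s => [|m' s] //; rewrite /= m_eq /= => -[p_max q_max] _.
  split=> [p0|q0].
    case: p_max => [|[a]]; first by have := zero_length_fin p0; case: (p).
    by rewrite gter_zero // -p_org => -[<-].
  case: q_max => [|[a]]; first by have := zero_length_fin q0; case: (q).
  by rewrite gter_zero // -q_org => -[<-].
split.
  case p0: (gat p 0%N) => [e|]; last by left; apply: zero_inf.1; apply/zero_length_at.
  right; exists e; have /is_gpathP[/(_ _ p0) ->] := p_path.
  by split=> //; apply/Z_E; exists (p, q).
case q0: (gat q 0%N) => [f|]; last by left; apply: zero_inf.2; apply/zero_length_at.
right; exists f; have /is_gpathP[/(_ _ q0) ->] := q_path.
by split=> //; apply/Z_F; exists (p, q).
Qed.

Lemma vertex_exit_D x i : porg x = Va E F i ->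
  exists2 d, D_org d = A i & Z (D_edge_path v w d) x.
Proof.
move=> x_org; have x_val := ipath_gval x; have x_max := ipath_pmax x.
case x0: (elt_at x 0%N) => [[t a]|]; last first.
  by case: (ipval x) x_org x_max x0 => [o [|m s]|f] //= ->.
have := porg_at0 x_val x0; rewrite x_org.
case: t a x0 => [j [p q] //|p] /= x0 p_org.
have [p_path p_nz] := x_val.2 _ _ x0.
case p0: (gat p 0%N) => [d|]; last by case/negP: p_nz; apply/zero_length_at.
exists d; last by apply/Z_D; exists p.
have /is_gpathP[/(_ _ p0) + _] := p_path; rewrite /= => ->.
by apply: (@of_D_inj _ _ v w); rewrite -p_org.
Qed.

(** * The topology on infinite paths *)

Lemma ipath_base_open B : @ipath_base E F v w B -> open B.
Proof.
move=> B_base; exists [set B]; last by rewrite bigcup_set1.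
move=> _ ->; exists [fset B]%fset; last by rewrite set_fset1 bigcap_set1.
by move=> C /fset1P ->; apply/mem_set.
Qed.

(** Used with [Phi] the family of all sets for which the desired statement holds; unions and finite
    intersections of base sets are dealt with here once and for all. *)
Lemma ipath_base_filter x (Phi : set_system ipath) : Filter Phi ->
  (forall B, @ipath_base E F v w B -> B x -> Phi B) ->
  forall A, open A -> A x -> Phi A.
Proof.
move=> Phi_filter base_Phi A [A' A'_base <-] [B A'B Bx].
have [D D_base B_eq] := A'_base B A'B.
suff : Phi B by apply: filterS => y By; exists B.
rewrite -[B]B_eq in Bx *; apply: filter_bigI => C CD.
by apply: base_Phi; [apply: set_mem (D_base C CD)|apply: Bx].
Qed.

Lemma Z_open mu : fpath mu -> open (Z mu : set ipath).
Proof. by move=> mu_path; apply/ipath_base_open/base_Z. Qed.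

(* [VBC] is [Z mu] minus the sets [Z (mu c)] for [c] in this set. *)
Definition removed (o : overt E F) i (y : vert (E i)) (z : vert (F i)) B C : set opath :=
  [set D_edge_path v w d | d in [set d | exists2 j, o = of_D v w (U j) &
     d = alpha j \/ d = epsilon j]] `|`
  ([set E_edge_path e z | e in B] `|` [set F_edge_path y f | f in C]).

Lemma VBCP mu i (y : vert (E i)) (z : vert (F i)) B C o x : pter mu = Some o ->
  VBC mu y z B C x <->
  Z mu x /\ forall c, removed o y z B C c -> ~ Z (pcat mu c) x.
Proof.
move=> mu_ter; split=> [[[mux noD] noBC]|[mux no]].
  split=> // c [[d [j oj dj] <-]|[[e Be <-]|[f Cf <-]]] Zc.
  - apply: noD; exists j; first by rewrite /= mu_ter oj.
    by case: dj Zc => -> ?; [left|right].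
  - by apply: noBC; left; exists e.
  - by apply: noBC; right; exists f.
split; first split=> // -[j]; rewrite /= ?mu_ter.
  move=> [oj] [Zc|Zc].
    by apply: no Zc; left; exists (alpha j) => //; exists j; [|left].
  by apply: no Zc; left; exists (epsilon j) => //; exists j; [|right].
move=> [[e Be Zc]|[f Cf Zc]].
  by apply: no Zc; right; left; exists e.
by apply: no Zc; right; right; exists f.
Qed.

Lemma removed_edge i (y : vert (E i)) (z : vert (F i)) B C c :
  B `<=` [set e | org e = y] -> C `<=` [set f | org f = z] ->
  removed (Vprod y z) y z B C c -> edge_path c /\ porg c = Vprod y z.
Proof.
move=> By Cz [[d [j uj dj] <-]|[[e /By <-] <-|[f /Cz <-] <-]].
- split; first exact: edge_path_D.
  by rewrite uj; case: dj => ->.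
- by split; first exact: edge_path_E.
- by split; first exact: edge_path_F.
Qed.

Lemma finite_removed o i (y : vert (E i)) (z : vert (F i)) B C :
  finite_set B -> finite_set C -> finite_set (removed o y z B C).
Proof.
move=> B_fin C_fin; rewrite !finite_setU; split; last by split; apply: finite_image.
apply: finite_image; apply: (@sub_finite_set _ _ (range alpha `|` range epsilon)).
  by move=> d [j _ [->|->]]; [left|right]; exists j.
by rewrite finite_setU; split; apply: finite_image; apply: finite_finset.
Qed.

Lemma VBC_lmul mu kappa i (y : vert (E i)) (z : vert (F i)) B C x :
  fpath mu -> fpath kappa -> pter mu = Some (porg kappa) ->
  pter kappa = Some (Vprod y z) -> pter mu = Some (porg x) ->
  B `<=` [set e | org e = y] -> C `<=` [set f | org f = z] ->
  VBC (pcat mu kappa) y z B C (lmul mu x) <-> VBC kappa y z B C x.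
Proof.
move=> mu_path k_path mk k_ter mx By Cz.
rewrite !(VBCP _ _ _ _ (o := Vprod y z)) ?pter_pcat // Z_lmul //.
have removedZ c : removed (Vprod y z) y z B C c ->
    Z (pcat (pcat mu kappa) c) (lmul mu x) <-> Z (pcat kappa c) x.
  move=> /removed_edge[//|//|/edge_path_fpath c_path c_org].
  have kc : pter kappa = Some (porg c) by rewrite c_org.
  rewrite pcatA //; last exact: fpath_gval.
  rewrite Z_lmul //; first exact: is_fpath_pcat.
  by rewrite porg_pcat.
by split=> -[kx no]; split=> // c /[dup] /removedZ cZ /no; rewrite cZ.
Qed.

Lemma lmul_base mu z B : fpath mu -> pter mu = Some (porg z) ->
  @ipath_base E F v w B -> B z ->
  exists2 B', @ipath_base E F v w B' &
    forall x, pter mu = Some (porg x) -> B' (lmul mu x) <-> B x.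
Proof.
move=> mu_path mz; case=> [kappa k_path|kappa i a b P Q k_path k_ter adm] Bz.
  have mk : pter mu = Some (porg kappa) by rewrite -(Z_porg Bz).
  exists (Z (pcat mu kappa)); first by apply/base_Z/is_fpath_pcat.
  by move=> x mx; apply: Z_lmul.
have mk : pter mu = Some (porg kappa) by case: Bz => -[/Z_porg <-].
exists (VBC (pcat mu kappa) a b P Q).
  by apply: base_V; rewrite ?pter_pcat //; apply: is_fpath_pcat.
by move=> x mx; case: adm => _ _ [? ?] _ _; apply: VBC_lmul.
Qed.

Lemma ipath_nbhs_filter x (Phi : set_system ipath) : Filter Phi ->
  (forall B, @ipath_base E F v w B -> B x -> Phi B) ->
  forall A, nbhs x A -> Phi A.
Proof.
move=> Phi_filter base_Phi A; rewrite nbhsE => -[O [O_open Ox] OA].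
exact: filterS OA (ipath_base_filter Phi_filter base_Phi O_open Ox).
Qed.

Lemma nbhs_Z mu x : fpath mu -> Z mu x -> nbhs x (Z mu).
Proof. by move=> mu_path mux; apply: open_nbhs_nbhs; split=> //; apply: Z_open. Qed.

(** Left multiplication is open. The sets with good image form a filter because left multiplication
    is injective, and on base sets [lmul_base] applies. *)
Lemma nbhs_lmul mu z A : fpath mu -> pter mu = Some (porg z) -> nbhs z A ->
  nbhs (lmul mu z)
    [set y | exists x, [/\ A x, pter mu = Some (porg x) & y = lmul mu x]].
Proof.
move=> mu_path mz; pose img A := [set y | exists x,
  [/\ A x, pter mu = Some (porg x) & y = lmul mu x]].
have img_filter : Filter [set A | nbhs (lmul mu z) (img A)].
  split=> [|P Q|P Q PQ] /=.
  - apply: filterS (nbhs_Z mu_path (Z_lmul_self mu_path mz)).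
    by move=> y /ZP[//|x mx ->]; exists x.
  - move=> zP zQ; apply: filterS (filterI zP zQ) => _ [[x [Px mx ->]] [x' [Qx' mx' xx']]].
    by exists x; split=> //; split=> //; rewrite (lmulI mu_path mx mx' xx').
  - by apply: filterS => _ [x [Px mx ->]]; exists x; split=> //; apply: PQ.
move=> zA; apply: (ipath_nbhs_filter img_filter _ zA) => B B_base Bz.
have [B' B'_base B'E] := lmul_base mu_path mz B_base Bz.
have B'z : B' (lmul mu z) by apply/B'E.
apply: filterS (filterI (open_nbhs_nbhs (conj (ipath_base_open B'_base) B'z))
  (nbhs_Z mu_path (Z_lmul_self mu_path mz))) => y [B'y /ZP[//|x mx y_eq]].
by exists x; split=> //; apply/B'E; rewrite -?y_eq.
Qed.

Lemma VBC_nil i (y : vert (E i)) (z : vert (F i)) B C x : porg x = Vprod y z ->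
  (forall c, removed (Vprod y z) y z B C c -> ~ Z c x) ->
  VBC (Str (Vprod y z) [::]) y z B C x.
Proof.
move=> x_org no; apply/VBCP; first by [].
by split; first exact/Z_nilE.
Qed.

Lemma nbhs_VBC mu i (y : vert (E i)) (z : vert (F i)) B C x : fpath mu ->
  pter mu = Some (Vprod y z) -> admissible y z B C -> VBC mu y z B C x ->
  nbhs x (VBC mu y z B C).
Proof.
move=> mu_path mu_ter adm Vx; apply: open_nbhs_nbhs; split=> //.
exact/ipath_base_open/base_V.
Qed.

(** If [x] leaves the vertex by an edge of D, or by another edge of the kind of [c], the cylinder of
    that edge misses [Z c]. Otherwise either [c] is alpha_i or epsilon_i, which V(mu) removes
    anyway, or the vertex emits infinitely many edges of the kind of [c], so that removing the
    single edge is admissible. *)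
Lemma nbhs_edge_compl c x : edge_path c -> ~ Z c x -> nbhs x (~` Z c).
Proof.
move=> c_edge cx; have [c_org|c_org] := pselect (porg x = porg c); last first.
  apply: filterS (nbhs_Z (is_fpath_nil _) (Z_nil x)) => y /Z_nilE y_org /Z_porg.
  by rewrite y_org.
have by_edge c' : edge_path c' -> Z c' x -> (forall y, Z c' y -> ~ Z c y) ->
    nbhs x (~` Z c).
  by move=> /edge_path_fpath/nbhs_Z c'_nbhs /c'_nbhs + cc'; apply: filterS.
have by_VBC i (y : vert (E i)) (z : vert (F i)) B C :
    porg x = Vprod y z -> admissible y z B C ->
    (forall c', removed (Vprod y z) y z B C c' -> ~ Z c' x) ->
    removed (Vprod y z) y z B C c -> nbhs x (~` Z c).
  move=> x_org adm no c_removed.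
  have := nbhs_VBC (is_fpath_nil _) erefl adm (VBC_nil x_org no).
  by apply: filterS => x' /(VBCP _ _ _ _ (o := Vprod y z))[//|_]; apply.
have admissible0 i (y : vert (E i)) (z : vert (F i)) : admissible y z set0 set0.
  by split=> //; split.
have [[d dx]|noD] := pselect (exists d, Z (D_edge_path v w d) x).
  apply: by_edge (edge_path_D d) (dx) _ => y dy.
  case: c_edge cx {c_org by_VBC} => [d'|i e z|i a f] cx.
  - by move=> /(Z_DD dy) d_eq; case: cx; rewrite -d_eq.
  - exact: Z_DE dy.
  - exact: Z_DF dy.
case: c_edge cx c_org by_edge by_VBC => [d|i e z|i y f] cx c_org by_edge by_VBC.
- case d_org: (D_org d) => [i|i]; last first.
    by have [|d' _ d'x] := vertex_exit_D (x := x) (i := i); [rewrite c_org /= d_org|case: noD; exists d'].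
  apply: (by_VBC i (v i) (w i) set0 set0) => //; first by rewrite c_org /= d_org.
    by move=> c' [[d' _ <-] d'x|[[e []]|[f []]]]; case: noD; exists d'.
  by left; exists d => //; exists i => //; case: (d) d_org => // j [->]; [left|right].
- have [[e' e'x]|noE] := pselect (exists e', Z (E_edge_path e' z) x).
    apply: by_edge (edge_path_E e' z) (e'x) _ => y e'y ey.
    by case: cx; rewrite (Z_EE ey e'y).
  have [[e_inf|[e' [_ e'x]]] _] := vertex_exit c_org; last by case: noE; exists e'.
  apply: (by_VBC i (org e) z [set e] set0) => //; last by right; left; exists e.
    by split=> //; split=> // _ ->.
  move=> c' [[d _ <-] dx|[[e' -> <-] //|[f []]]].
  by case: noD; exists d.
- have [[f' f'x]|noF] := pselect (exists f', Z (F_edge_path y f') x).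
    apply: by_edge (edge_path_F y f') (f'x) _ => x' f'x' fx'.
    by case: cx; rewrite (Z_FF fx' f'x').
  have [_ [f_inf|[f' [_ f'x]]]] := vertex_exit c_org; last by case: noF; exists f'.
  apply: (by_VBC i y (org f) set0 [set f]) => //; last by right; right; exists f.
    by split=> //; split=> // _ ->.
  move=> c' [[d _ <-] dx|[[e []]|[f' -> <-] //]].
  by case: noD; exists d.
Qed.

(** Either [x] already misses the first edge of [kappa], or that edge is cancelled and the
    neighbourhood found for the rest is carried back, left multiplication being open. *)
Lemma nbhs_Z_compl kappa x : fpath kappa -> ~ Z kappa x -> nbhs x (~` Z kappa).
Proof.
move=> k_path; elim/fpath_edge_ind: kappa / k_path x => [o x x_org|c rho c_edge rho_path cr IH x].
  apply: filterS (nbhs_Z (is_fpath_nil _) (Z_nil x)) => y /Z_nilE y_org /Z_nilE yo.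
  by apply: x_org; apply/Z_nilE; rewrite -yo.
have c_path := edge_path_fpath c_edge.
have [cx|ncx _] := pselect (Z c x); last first.
  by apply: filterS (nbhs_edge_compl c_edge ncx) => y ncy /(Z_pcat_sub c_path rho_path cr).
have /ZP[//|z cz ->] := cx.
move=> rz; have {}rz : ~ Z rho z by move=> rz'; apply: rz; apply/Z_lmul.
apply: filterS (nbhs_lmul c_path cz (IH _ rz)) => _ [y [ry cy ->]].
by move=> /(Z_lmul c_path rho_path cr cy); apply: ry.
Qed.

(** Left multiplication is continuous. By [Z_common] the preimage of a cylinder is empty or a
    cylinder Z(rho); since Z(rho) is closed, preimages of complements are neighbourhoods as well,
    which settles V(mu;B,C). *)
Lemma lmul_nbhs mu z A : fpath mu -> pter mu = Some (porg z) ->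
  nbhs (lmul mu z) A -> nbhs z [set x : ipath | pter mu = Some (porg x) -> A (lmul mu x)].
Proof.
move=> mu_path mz Anbhs.
have Z_pull kappa : fpath kappa -> Z kappa (lmul mu z) ->
    nbhs z [set x : ipath | pter mu = Some (porg x) -> Z kappa (lmul mu x)].
  move=> k_path kz; have mz' := Z_lmul_self mu_path mz.
  have [rho [sigma [[rho_path sigma_path] mr ks rs_eq rsE]]] := Z_common mu_path k_path mz' kz.
  apply: filterS (nbhs_Z rho_path (x := z) _) => [x rx mx|].
    by apply: (Z_pcat_sub k_path sigma_path ks); rewrite -rs_eq; apply/Z_lmul.
  exact/(Z_lmul mu_path rho_path mr mz)/rsE.
have Zc_pull kappa : fpath kappa -> ~ Z kappa (lmul mu z) ->
    nbhs z [set x : ipath | pter mu = Some (porg x) -> ~ Z kappa (lmul mu x)].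
  move=> k_path nkz.
  have [[x [mx kx]]|no] := pselect (exists x : ipath, pter mu = Some (porg x) /\ Z kappa (lmul mu x)); last first.
    by apply: filterS filterT => x _ mx kx; apply: no; exists x.
  have mx' := Z_lmul_self mu_path mx.
  have [rho [sigma [[rho_path sigma_path] mr ks rs_eq rsE]]] := Z_common mu_path k_path mx' kx.
  apply: filterS (nbhs_Z_compl rho_path (x := z) _) => [y ry my ky|rz].
    apply: ry; apply/(Z_lmul mu_path rho_path mr my)/rsE => //.
    exact: Z_lmul_self.
  apply: nkz; apply: (Z_pcat_sub k_path sigma_path ks); rewrite -rs_eq.
  exact/(Z_lmul mu_path rho_path mr mz).
pose Phi := [set A | nbhs z [set x : ipath | pter mu = Some (porg x) -> A (lmul mu x)]].
have Phi_filter : Filter Phi.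
  split=> [|P Q zP zQ|P Q PQ].
  - by rewrite /Phi /=; apply: filterS filterT.
  - apply: (@filterS _ (nbhs z) _ _ _ _ (@filterI _ (nbhs z) _ _ _ zP zQ)).
    by move=> x [Px Qx] mx; split; [apply: Px|apply: Qx].
  - by rewrite /Phi /=; apply: filterS => x Px mx; apply/PQ/Px.
apply: (ipath_nbhs_filter Phi_filter _ Anbhs).
move=> B [kappa k_path kz|kappa i a b P Q k_path k_ter [P_fin Q_fin [Pa Qb] _ _] Vz] /=.
  exact: Z_pull.
move/(VBCP _ _ _ _ (o := Vprod a b)) : Vz => /(_ k_ter)[kz no].
have : nbhs z (\bigcap_(c in removed (Vprod a b) a b P Q)
    [set x : ipath | pter mu = Some (porg x) -> ~ Z (pcat kappa c) (lmul mu x)]).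
  apply: filter_bigcap_finite; first exact: finite_removed.
  move=> c c_rem; apply: Zc_pull; last exact: no.
  have [/edge_path_fpath c_path c_org] := removed_edge Pa Qb c_rem.
  by apply: is_fpath_pcat => //; rewrite c_org.
apply: filterS2 (Z_pull _ k_path kz) => x kx no_x mx.
by apply/(VBCP _ _ _ _ (o := Vprod a b)) => //; split; [apply: kx|move=> c /no_x; apply].
Qed.

Lemma pext_pcat_self mu rho : fpath mu -> fpath rho -> pter mu = Some (porg rho) ->
  pext mu (pcat mu rho).
Proof. by move=> mu_path /fpath_gval rho_val; apply: pext_pcat. Qed.

Lemma pext_Z mu nu : fpath mu -> fpath nu -> pext mu nu -> Z nu `<=` (Z mu : set ipath).
Proof.
move=> mu_path nu_path mn x nx.
exact: (pext_trans mu_path nu_path (ipath_gval x) mn nx).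
Qed.

Lemma pext_psize mu nu : fpath mu -> fpath nu -> pext mu nu -> (psize mu <= psize nu)%N.
Proof.
move=> mu_path nu_path [_ mn]; case k_eq: (psize mu) => [//|k].
have [|m muk] := elt_at_Some mu_path (n := k); first by rewrite k_eq.
by have [m' /(elt_at_psize nu_path)] := mn k m muk.
Qed.

(** * Limits of ultrafilters *)

Section UltraFilter.
Variables (Phi : set_system ipath) (Phi_ultra : UltraFilter Phi).

Definition germ mu := fpath mu /\ Phi (Z mu).

Lemma germ_prefix mu nu : fpath mu -> germ nu -> pext mu nu -> germ mu.
Proof. by move=> mu_path [nu_path nu_Phi] mn; split=> //; apply: filterS nu_Phi; apply: pext_Z. Qed.

Lemma germ_common mu nu : germ mu -> germ nu ->
  exists lam, [/\ germ lam, pext mu lam & pext nu lam].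
Proof.
move=> [mu_path mu_Phi] [nu_path nu_Phi].
have [x [mx nx]] := filter_ex (filterI mu_Phi nu_Phi).
have [rho [sigma [[rho_path sigma_path] mr ns rs_eq rsE]]] := Z_common mu_path nu_path mx nx.
exists (pcat mu rho); split.
- split; first exact: is_fpath_pcat.
  by apply: filterS (filterI mu_Phi nu_Phi) => y [my ny]; apply: rsE.
- exact: pext_pcat_self.
- by rewrite rs_eq; apply: pext_pcat_self.
Qed.

Lemma ultra_finite_cover (T : Type) (S : set T) (A : T -> set ipath) B :
  finite_set S -> Phi B -> B `<=` \bigcup_(c in S) A c ->
  exists2 c, S c & Phi (A c).
Proof.
move=> S_fin B_Phi BA; apply: contrapT => no.
have : Phi (\bigcap_(c in S) ~` A c).
  apply: filter_bigcap_finite => // c Sc.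
  by have [Ac|//] := in_ultra_setVsetC (A c) Phi_ultra; case: no; exists c.
move=> /(filterI B_Phi)/filter_ex[x [/BA[c Sc Acx] /(_ c Sc)]]; exact.
Qed.

(** Where finitely many edges account for all continuations, the ultrafilter selects one of them.
    This is why the limit is maximal: germs cannot stop at a finite emitter or at a_i. *)
Lemma germ_pcat (S : set opath) mu : finite_set S -> germ mu ->
  (forall c, S c -> edge_path c /\ pter mu = Some (porg c)) ->
  (forall x, pter mu = Some (porg x) -> exists2 c, S c & Z c x) ->
  exists2 c, S c & germ (pcat mu c).
Proof.
move=> S_fin [mu_path mu_Phi] S_edge S_cover.
have [|c Sc c_Phi] := @ultra_finite_cover _ S (fun c => Z (pcat mu c)) _ S_fin mu_Phi.
  move=> x /ZP[//|z mz ->]; have [c Sc cz] := S_cover z mz; exists c => //.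
  by have [/edge_path_fpath c_path mc] := S_edge c Sc; apply/Z_lmul.
exists c => //; split=> //; have [/edge_path_fpath c_path mc] := S_edge c Sc.
exact: is_fpath_pcat.
Qed.

Lemma germ_E mu i (y : vert (E i)) (z : vert (F i)) : germ mu ->
  pter mu = Some (Vprod y z) -> ~ infinite_emitters (E i) y ->
  exists2 e, org e = y & germ (pcat mu (E_edge_path e z)).
Proof.
move=> mu_germ mu_ter /contrapT y_fin.
have [||||c [e ey <-] c_germ] := @germ_pcat [set E_edge_path e z | e in [set e | org e = y]] mu.
- exact: finite_image.
- exact: mu_germ.
- by move=> _ [e /= ey <-]; split; [apply: edge_path_E|rewrite mu_ter -ey].
- move=> x; rewrite mu_ter => -[/esym x_org].
  have [[//|[e [ey ex]]] _] := vertex_exit x_org.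
  by exists (E_edge_path e z) => //; exists e.
- by exists e.
Qed.

Lemma germ_F mu i (y : vert (E i)) (z : vert (F i)) : germ mu ->
  pter mu = Some (Vprod y z) -> ~ infinite_emitters (F i) z ->
  exists2 f, org f = z & germ (pcat mu (F_edge_path y f)).
Proof.
move=> mu_germ mu_ter /contrapT z_fin.
have [||||c [f fz <-] c_germ] := @germ_pcat [set F_edge_path y f | f in [set f | org f = z]] mu.
- exact: finite_image.
- exact: mu_germ.
- by move=> _ [f /= fz <-]; split; [apply: edge_path_F|rewrite mu_ter -fz].
- move=> x; rewrite mu_ter => -[/esym x_org].
  have [_ [//|[f [fz fx]]]] := vertex_exit x_org.
  by exists (F_edge_path y f) => //; exists f.
- by exists f.
Qed.

Lemma finite_D_org a : finite_set [set d | D_org d = a].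
Proof.
apply: (@sub_finite_set _ _ (range alpha `|` range beta `|` range gamma `|`
  range delta `|` range epsilon)).
  by case=> j _; do ?[by left; exists j|by right; exists j|left].
by rewrite !finite_setU; do !split; apply: finite_image; apply: finite_finset.
Qed.

Lemma germ_D mu i : germ mu -> pter mu = Some (Va E F i) ->
  exists2 d, D_org d = A i & germ (pcat mu (D_edge_path v w d)).
Proof.
move=> mu_germ mu_ter.
have [||||c [d di <-] c_germ] := @germ_pcat [set D_edge_path v w d | d in [set d | D_org d = A i]] mu.
- exact/finite_image/finite_D_org.
- exact: mu_germ.
- by move=> _ [d /= di <-]; split; [apply: edge_path_D|rewrite mu_ter /= di].
- move=> x; rewrite mu_ter => -[/esym /vertex_exit_D[d di dx]].
  by exists (D_edge_path v w d) => //; exists d.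
- by exists d.
Qed.

(** Cylinders suffice as tests: if a removed cylinder is not in [Phi], its complement is, and only
    finitely many cylinders are removed. *)
Lemma ultra_cvg x : (forall mu, fpath mu -> Z mu x <-> Phi (Z mu)) -> Phi --> x.
Proof.
move=> xE; apply: ipath_nbhs_filter.
move=> B [mu mu_path mux|mu i y z P Q mu_path mu_ter [P_fin Q_fin [Py Qz] _ _] Vx].
  exact/xE.
have := Vx; move=> /(VBCP _ _ _ _ (o := Vprod y z))[//|/(xE _ mu_path) mu_Phi no].
have : Phi (\bigcap_(c in removed (Vprod y z) y z P Q) ~` Z (pcat mu c)).
  apply: filter_bigcap_finite; first exact: finite_removed.
  move=> c c_rem; have [/edge_path_fpath c_path c_org] := removed_edge Py Qz c_rem.
  have [|//] := in_ultra_setVsetC (Z (pcat mu c)) Phi_ultra.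
  by move=> /xE cx; case: (no c c_rem); apply: cx; apply: is_fpath_pcat; rewrite // c_org.
by apply: filterS2 mu_Phi => x' mx' nx'; apply/(VBCP _ _ _ _ (o := Vprod y z)).
Qed.

Lemma germ_unbounded : (forall n, exists2 mu, germ mu & (n < psize mu)%N) ->
  exists x, forall mu, fpath mu -> Z mu x <-> Phi (Z mu).
Proof.
move=> long.
(* The bound [n.+1 < psize mu] puts index [n] before the last one, so the element there can no
   longer grow and does not depend on the germ. *)
have /choice[f fP] n : exists m, exists mu,
    [/\ germ mu, (n.+1 < psize mu)%N & elt_at mu n = Some m].
  have [mu mu_germ n_mu] := long n.+1.
  have [m mun] := elt_at_Some mu_germ.1 (ltnW n_mu).
  by exists m, mu.
have f_at mu n : germ mu -> (n.+1 < psize mu)%N -> elt_at mu n = Some (f n).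
  move=> mu_germ n_mu; have [nu [nu_germ n_nu <-]] := fP n.
  have [lam [_ ml nl]] := germ_common mu_germ nu_germ.
  by rewrite -(pext_at mu_germ.1 ml) // (pext_at nu_germ.1 nl).
have germ_org mu nu : germ mu -> germ nu -> porg mu = porg nu.
  move=> mu_germ nu_germ; have [lam [_ ml nl]] := germ_common mu_germ nu_germ.
  by rewrite -ml.1 nl.1.
have f_org mu : germ mu -> eorg (tagged (f 0%N)) = porg mu.
  move=> mu_germ; have [nu [nu_germ n_nu nu0]] := fP 0%N.
  by rewrite (germ_org _ _ mu_germ nu_germ) (porg_at0 (fpath_gval nu_germ.1) nu0).
have f_gval : gval (IStr f).
  split; first split=> [m [<-] //|n _ _ [<-] [<-]].
    have [mu mu_germ n_mu] := long n.+2.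
    have mun := f_at mu n mu_germ (ltnW n_mu); have mun1 := f_at mu n.+1 mu_germ n_mu.
    exact: (fpath_gval mu_germ.1).1.2 mun mun1.
  move=> n _ [<-]; have [mu [mu_germ n_mu mun]] := fP n.
  exact: (fpath_gval mu_germ.1).2 mun.
have f_path : is_ipath v w (IStr f) by apply/is_ipathE.
exists (IPath f_path) => mu mu_path; split=> [mux|mu_Phi].
  have [nu nu_germ mn] := long (psize mu).+1.
  suff mu_nu : pext mu nu by have [] := germ_prefix mu_path nu_germ mu_nu.
  split=> [|n m mun]; first by rewrite -(f_org nu nu_germ) -(mux.1).
  have nmu := elt_at_psize mu_path mun.
  have := mux.2 n m mun; rewrite -[elt_at _ n]/(Some (f n)) -(f_at nu) //.
  exact: leq_ltn_trans nmu (ltnW mn).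
have mu_germ : germ mu by [].
split=> [|n m mun]; first exact: f_org.
have [nu nu_germ n_nu] := long n.+1.
have [lam [_ ml nl]] := germ_common mu_germ nu_germ.
have [m' lamn] := ml.2 n m mun; move: lamn.
rewrite (pext_at nu_germ.1 nl n_nu) (f_at nu) // => -[<-].
by exists (f n).
Qed.

Lemma germ_porg mu nu : germ mu -> germ nu -> porg mu = porg nu.
Proof.
move=> mu_germ nu_germ; have [lam [_ ml nl]] := germ_common mu_germ nu_germ.
by rewrite -ml.1 nl.1.
Qed.

Lemma germ_trivial o : germ (Str o [::]) ->
  (forall mu, germ mu -> psize mu = 0%N) ->
  exists x, forall mu, fpath mu -> Z mu x <-> Phi (Z mu).
Proof.
move=> o_germ short.
have o_max : vmax o.
  case: o o_germ => [i|i y z] o_germ.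
    have [d _ /short] := germ_D o_germ erefl.
    by rewrite /psize.
  by split; apply: contrapT; [move=> /(germ_E o_germ erefl)[e _ /short]
    |move=> /(germ_F o_germ erefl)[f _ /short]].
have o_path : is_ipath v w (Str o [::]).
  by apply/is_ipathE; split=> //; apply/fpath_gval/is_fpath_nil.
exists (IPath o_path) => mu mu_path; split=> [mux|mu_Phi].
  case: mu mu_path mux => [o' [|m s]|f []//] s_path sx.
    by have /= <- := sx.1; exact: o_germ.2.
  by have [] := sx.2 0%N m erefl.
have mu_germ : germ mu by [].
split=> [|n m /(elt_at_psize mu_path)]; first exact: germ_porg o_germ mu_germ.
by rewrite short.
Qed.

Lemma pter_last mu k m : psize mu = k.+1 -> elt_at mu k = Some m ->
  pter mu = eter (tagged m).
Proof.
case: mu => [o [|m0 s]|f] // [<-].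
by rewrite [elt_at _ _]onth_last => -[<-].
Qed.

(** Germs with the maximal number of elements differ only in the last one. These last elements form
    a directed set [Q], and the limit has their union [u] in the last place. *)
Lemma germ_maximal k mu : germ mu -> psize mu = k.+1 ->
  (forall nu, germ nu -> (psize nu <= k.+1)%N) ->
  exists x, forall mu, fpath mu -> Z mu x <-> Phi (Z mu).
Proof.
move=> mu_germ mu_size short.
have [mu_path mu_Phi] := mu_germ.
have [[t a0] muk] : exists m, elt_at mu k = Some m by apply: (elt_at_Some mu_path); rewrite mu_size.
pose Q := [set a : elt t | exists nu, [/\ germ nu, psize nu = k.+1 &
  elt_at nu k = Some (Tagged elt a)]].
have Q_mu : Q a0 by exists mu.
have Q_val a : Q a -> [/\ evalid a, efin a & ~~ ezero a].
  by move=> [nu [[nu_path _] _ /(is_fpath_fin nu_path)]].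
have germ_size nu lam : germ nu -> germ lam -> pext nu lam -> psize nu = k.+1 ->
    psize lam = k.+1.
  move=> nu_germ lam_germ /(pext_psize nu_germ.1 lam_germ.1) nl nu_size.
  by apply/eqP; rewrite eqn_leq short // -nu_size.
have Q_ext nu lam a : germ nu -> germ lam -> pext nu lam -> psize nu = k.+1 ->
    elt_at nu k = Some (Tagged elt a) -> exists2 c, elt_at lam k = Some (Tagged elt c) &
    Q c /\ elt_ext a c.
  move=> nu_germ lam_germ nl nu_size nuk; have [m lamk] := nl.2 k _ nuk.
  have -> : elt_at nu k.+1 = None by apply/(elt_at_None _ nu_germ.1); rewrite nu_size.
  move=> /pelt_extP[c m_eq ac]; rewrite m_eq in lamk.
  by exists c => //; split=> //; exists lam; split=> //; apply: germ_size nu_size.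
have Q_dir a b : Q a -> Q b -> exists2 c, Q c & elt_ext a c /\ elt_ext b c.
  move=> [nu [nu_germ nu_size nuk]] [nu' [nu'_germ nu'_size nu'k]].
  have [lam [lam_germ nl n'l]] := germ_common nu_germ nu'_germ.
  have [c lamk [Qc ac]] := Q_ext _ _ _ nu_germ lam_germ nl nu_size nuk.
  have [c' + [_ bc]] := Q_ext _ _ _ nu'_germ lam_germ n'l nu'_size nu'k.
  rewrite lamk => /Some_inj/(@Tagged_inj _ elt) cc'.
  by exists c => //; rewrite cc' in ac *.
have [|a /Q_val[]//|u [u_val u_ub u_lub]] := elt_union _ _ Q_dir; first by exists a0.
have u_nz : ~~ ezero u by have [_ a0_fin a0_nz] := Q_val _ Q_mu; apply: elt_ext_nz (u_ub _ Q_mu) a0_nz.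
have [[x_val x_org _ x_max] [x_lt x_k x_gt]] := plast_setP mu_path mu_size muk u_val (u_ub _ Q_mu).
(* The prolonged path is again a germ with [k.+1] elements, so its last element lies in [Q]. *)
have Q_edge nu c (a : elt t) : germ nu -> psize nu = k.+1 -> elt_at nu k = Some (Tagged elt a) ->
    edge_path c -> pter nu = Some (porg c) -> germ (pcat nu c) ->
    exists2 b, phead (Tagged elt a) c = Tagged elt b & Q b.
  move=> nu_germ nu_size nuk /edge_path_fpath c_path nc nc_germ.
  have nu_nc := pext_pcat_self nu_germ.1 c_path nc.
  have [b + [Qb _]] := Q_ext _ _ _ nu_germ nc_germ nu_nc nu_size nuk.
  by rewrite (pcat_at_last nu_germ.1 (fpath_gval c_path) nc nu_size nuk) => -[->]; exists b.
have u_max : emax u.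
  clear x_val x_org x_max x_lt x_k x_gt germ_size Q_dir Q_ext muk.
  have u_attained : efin u -> Q u.
    move=> u_fin; have [a Qa ua] := u_lub u u_val u_fin (elt_ext_refl u_val u_fin).
    have [a_val a_fin _] := Q_val a Qa.
    by rewrite (elt_ext_antisym u_val u_fin a_fin ua (u_ub a Qa)).
  have Q_germ a : Q a -> exists nu, [/\ germ nu, psize nu = k.+1 &
    elt_at nu k = Some (Tagged elt a)] by [].
  clearbody Q; clear Q_mu; case: t {a0} Q Q_val u u_val u_ub u_lub u_nz Q_edge u_attained Q_germ => [i|]; last first.
    move=> Q Q_val p p_path p_ub _ _ Q_edge p_attained Q_germ; rewrite /emax.
    have [/p_attained Qp|] := boolP (efin p); last by move=> /negPn; left.
    have [nu [nu_germ nu_size nuk]] := Q_germ _ Qp; have nu_ter := pter_last nu_size nuk.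
    have [_ p_fin _] := is_fpath_fin nu_germ.1 nuk; rewrite /= in p_fin.
    right; case p_ter: (gter p) => [[j|j]|]; first by exists (U j) => //; exists j.
      rewrite /= p_ter in nu_ter.
      have [d d_org d_germ] := germ_D nu_germ nu_ter.
      have [||q] := Q_edge nu (D_edge_path v w d) p nu_germ nu_size nuk _ _ d_germ.
      - exact: edge_path_D.
      - by rewrite nu_ter /= d_org.
      rewrite /phead /merge /= tagged_asE => /(@Tagged_inj _ elt) <- /p_ub.
      move=> /gext_cat_zero nz; suff : zero_length (Fin (G := D) (D_org d) [:: d]) by [].
      by apply: nz => //; rewrite p_ter /= d_org.
    by have [x] := fin_gter p_fin; rewrite p_ter.
  move=> Q Q_val [p q] [p_path q_path] u_ub u_lub _ Q_edge _ Q_germ.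
  rewrite /= in p_path q_path; split; rewrite /=.
    have [|/negPn] := boolP (~~ infinite_gpath p); last by left.
    move=> p_fin; right; have [y py] := fin_gter p_fin; exists y => //.
    apply: contrapT => y_fin.
    (* The second coordinate of [u] may be infinite, so [u] need not belong to [Q]. But [p] paired
       with a path of length zero is a finite prefix of [u], whence some member of [Q] has first
       coordinate [p]. *)
    have p0_ext : elt_ext ((p, Fin (gorg q) [::]) : elt (Some i)) (p, q).
      by split; [apply: gext_refl|apply/gext_vertex].
    have [|//|[p' q'] Qpq [pp' _]] := u_lub (p, Fin (gorg q) [::]) _ _ p0_ext; first by [].
      by apply/andP.
    have [[p'_path q'_path] /andP[/= p'_fin q'_fin] _] := Q_val _ Qpq.
    have [p'p _] := u_ub _ Qpq.
    have pp'_eq : p' = p.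
      apply: gext_glen_eq => //; apply/eqP; rewrite eqn_leq.
      by rewrite (gext_glen p'_path) // (gext_glen p_path).
    rewrite {}pp'_eq in Qpq {p'_path p'_fin pp' p'p}.
    have [z q'z] := fin_gter q'_fin.
    have [nu [nu_germ nu_size nuk]] := Q_germ _ Qpq; have nu_ter := pter_last nu_size nuk.
    rewrite /= py q'z in nu_ter; have [e ey e_germ] := germ_E nu_germ nu_ter y_fin.
    have [||b] := Q_edge nu (E_edge_path e z) (p, q') nu_germ nu_size nuk _ _ e_germ.
    - exact: edge_path_E.
    - by rewrite nu_ter -ey.
    (* [p] followed by [e] is now below the upper bound [p], which leaves no room for [e]. *)
    rewrite /phead /merge /= eqxx tagged_asE => /(@Tagged_inj _ elt) <- /u_ub[] /gext_cat_zero nz _.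
    suff : zero_length (Fin (org e) [:: e]) by [].
    by apply: nz => //; rewrite py ey.
  have [|/negPn] := boolP (~~ infinite_gpath q); last by left.
  move=> q_fin; right; have [z qz] := fin_gter q_fin; exists z => //.
  apply: contrapT => z_fin.
  have q0_ext : elt_ext ((Fin (gorg p) [::], q) : elt (Some i)) (p, q).
    by split; [apply/gext_vertex|apply: gext_refl].
  have [|//|[p' q'] Qpq [_ qq']] := u_lub (Fin (gorg p) [::], q) _ _ q0_ext; first by [].
  have [[p'_path q'_path] /andP[/= p'_fin q'_fin] _] := Q_val _ Qpq.
  have [_ q'q] := u_ub _ Qpq.
  have qq'_eq : q' = q.
    apply: gext_glen_eq => //; apply/eqP; rewrite eqn_leq.
    by rewrite (gext_glen q'_path) // (gext_glen q_path).
  rewrite {}qq'_eq in Qpq {q'_path q'_fin qq' q'q}.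
  have [y p'y] := fin_gter p'_fin.
  have [nu [nu_germ nu_size nuk]] := Q_germ _ Qpq; have nu_ter := pter_last nu_size nuk.
  rewrite /= p'y qz in nu_ter; have [f fz f_germ] := germ_F nu_germ nu_ter z_fin.
  have [||b] := Q_edge nu (F_edge_path y f) (p', q) nu_germ nu_size nuk _ _ f_germ.
  - exact: edge_path_F.
  - by rewrite nu_ter -fz.
  rewrite /phead /merge /= eqxx tagged_asE => /(@Tagged_inj _ elt) <- /u_ub[] _ /gext_cat_zero nz.
  suff : zero_length (Fin (org f) [:: f]) by [].
  by apply: nz => //; rewrite qz fz.
have x_path : is_ipath v w (plast_set mu (Tagged elt u)) by apply/is_ipathE; split=> //; apply/x_max.
have germ_x nu : germ nu -> Z nu (IPath x_path).
  move=> nu_germ; have [lam [lam_germ ml nl]] := germ_common mu_germ nu_germ.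
  apply: (pext_Z nu_germ.1 lam_germ.1 nl); have lam_size := germ_size _ _ mu_germ lam_germ ml mu_size.
  have [c lamk [Qc _]] := Q_ext _ _ _ mu_germ lam_germ ml mu_size muk.
  split=> [|n m lamn]; first by rewrite x_org ml.1.
  have := elt_at_psize lam_germ.1 lamn; rewrite lam_size ltnS leq_eqVlt => /orP[/eqP nk|nk].
    rewrite nk in lamn *; move: lamn; rewrite lamk => -[<-].
    exists (Tagged elt u); first exact: x_k.
    have -> : elt_at lam k.+1 = None by apply/(elt_at_None _ lam_germ.1); rewrite lam_size.
    by apply/pelt_extP; exists u => //; apply: u_ub.
  have [m' ->] : exists m', elt_at lam n.+1 = Some m' by apply: elt_at_Some lam_germ.1 _; rewrite lam_size.
  exists m => //; rewrite -[elt_at _ n]/(elt_at (plast_set mu (Tagged elt u)) n) x_lt //.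
  by rewrite -lamn (pext_at mu_path ml) // mu_size.
exists (IPath x_path) => nu nu_path; split=> [nux|nu_Phi]; last exact: germ_x.
suff [lam lam_germ nl] : exists2 lam, germ lam & pext nu lam.
  by have [] := germ_prefix nu_path lam_germ nl.
have nu_k : (psize nu <= k.+1)%N.
  rewrite leqNgt; apply/negP => /(elt_at_Some nu_path)[m nuk1].
  by have [m'] := nux.2 _ _ nuk1; rewrite -[elt_at _ _]/(elt_at (plast_set mu (Tagged elt u)) _) x_gt.
have x_at lam n : germ lam -> psize lam = k.+1 -> (n < k)%N -> elt_at lam n = elt_at (IPath x_path) n.
  by move=> lam_germ lam_size nk; rewrite (pext_at lam_germ.1 (germ_x _ lam_germ)) // lam_size.
have reduce lam : germ lam -> psize lam = k.+1 ->
    (forall m, elt_at nu k = Some m -> exists2 m', elt_at lam k = Some m' & pelt_ext m m') ->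
    pext nu lam.
  move=> lam_germ lam_size lam_k; split=> [|n m nun].
    by rewrite (germ_porg lam_germ mu_germ) -nux.1 -x_org.
  have := leq_trans (elt_at_psize nu_path nun) nu_k; rewrite ltnS leq_eqVlt => /orP[/eqP nk|nk].
    rewrite nk in nun *; have -> : elt_at nu k.+1 = None by apply/(elt_at_None _ nu_path).
    exact: lam_k.
  by rewrite (x_at lam) //; apply: nux.2.
case nuk: (elt_at nu k) => [[t' c]|]; last first.
  by exists mu => //; apply: reduce => // m; rewrite nuk.
have nuk1 : elt_at nu k.+1 = None by apply/(elt_at_None _ nu_path).
have [m] := nux.2 k _ nuk; rewrite nuk1 -[elt_at _ k]/(elt_at (plast_set mu (Tagged elt u)) k) x_k.
move=> [<-] /pelt_extP[u' /[dup] u_eq /(congr1 tag) /= tt'].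
case: t' / tt' c u' u_eq nuk => c u' /(@Tagged_inj _ elt) <- nuk cu.
have [c_val c_fin _] := is_fpath_fin nu_path nuk.
have [b [lam [lam_germ lam_size lamk]] cb] := u_lub c c_val c_fin cu.
exists lam => //; apply: reduce => // m'; rewrite nuk => -[<-].
by exists (Tagged elt b) => //; apply/pelt_extP; exists b.
Qed.

Lemma germ_limit o : Phi (Z (Str o [::])) ->
  exists2 x : ipath, porg x = o & Phi --> x.
Proof.
move=> o_Phi; have o_germ : germ (Str o [::]) by split=> //; apply: is_fpath_nil.
suff [x xE] : exists x, forall mu, fpath mu -> Z mu x <-> Phi (Z mu).
  exists x; last exact: ultra_cvg.
  by have /xE[_ /(_ o_Phi)/Z_nilE] := is_fpath_nil o.
pose long n := exists2 mu, germ mu & (n < psize mu)%N.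
have [/germ_unbounded//|] := pselect (forall n, long n).
move=> /existsNP[n0 n0P]; have ex_short : exists n, `[< ~ long n >] by exists n0; apply/asboolP.
(* The minimum is the largest number of elements that a germ can have. *)
have [[|k] /asboolP k_short k_min] := ex_minnP ex_short.
  apply: germ_trivial o_germ _ => mu mu_germ; apply/eqP; rewrite -leqn0 leqNgt.
  by apply/negP => mu0; apply: k_short; exists mu.
have short nu : germ nu -> (psize nu <= k.+1)%N.
  by move=> nu_germ; rewrite leqNgt; apply/negP => nuk; apply: k_short; exists nu.
have [mu mu_germ k_mu] : long k.
  by apply: contrapT => /asboolP/k_min; rewrite ltnn.
by apply: germ_maximal (mu_germ) _ (short); apply/eqP; rewrite eqn_leq short.
Qed.

End UltraFilter.

(** * Cylinders inside open sets *)

(* The sets [Z (nu n)] converge to [x]. *)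
Definition approximates (nu : nat -> opath) x : Prop :=
  (forall n, fpath (nu n)) /\
  forall kappa, fpath kappa -> exists N, forall n, (N <= n)%N ->
    (Z kappa x -> Z (nu n) `<=` (Z kappa : set ipath)) /\
    (~ Z kappa x -> forall y, Z (nu n) y -> ~ Z kappa y).

Lemma approx_lmul mu z (nu : nat -> opath) : fpath mu -> pter mu = Some (porg z) ->
  (forall n, porg (nu n) = porg z) -> approximates nu z ->
  approximates (fun n => pcat mu (nu n)) (lmul mu z).
Proof.
move=> mu_path mz nu_org [nu_path nu_lim].
have mn n : pter mu = Some (porg (nu n)) by rewrite nu_org.
split=> [n|kappa k_path]; first exact: is_fpath_pcat.
have [[x [mx kx]]|no] := pselect (exists x, Z mu x /\ Z kappa x); last first.
  exists 0%N => n _; split=> [kz|_ y /Z_pcat_sub my ky].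
    by case: no; exists (lmul mu z); split=> //; apply: Z_lmul_self.
  by apply: no; exists y; split=> //; apply: my.
have [rho [sigma [[rho_path sigma_path] mr ks rs_eq rsE]]] := Z_common mu_path k_path mx kx.
have kE y : pter mu = Some (porg y) -> Z kappa (lmul mu y) <-> Z rho y.
  move=> my; rewrite -(Z_lmul mu_path rho_path mr my); split=> [ky|].
    by apply: rsE => //; apply: Z_lmul_self.
  by rewrite rs_eq; apply: Z_pcat_sub.
have [N Nlim] := nu_lim rho rho_path; exists N => n /Nlim[rz_in rz_out].
split=> [/(kE _ mz)/rz_in nr|nkz] y.
  move=> /ZP[|x']; first exact: is_fpath_pcat.
  rewrite pter_pcat // => nx' ->; rewrite lmulA //; apply/kE; first by rewrite porg_lmul.
  by apply/nr/Z_lmul_self.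
move=> /ZP[|x']; first exact: is_fpath_pcat.
rewrite pter_pcat // => nx' ->; rewrite lmulA // => /kE; rewrite porg_lmul // => /(_ (mn n)).
by apply: rz_out; [rewrite -kE|apply: Z_lmul_self].
Qed.

(** Covers a path with the single element [m] and also a vertex, which is represented by an [m] of
    length zero; the last two hypotheses describe both situations at once. *)
Lemma approx_elt t (m : elt t) x : evalid m -> emax m ->
  (t = None -> ~~ efin m) -> porg x = eorg m ->
  (forall k b, elt_at x k = Some b -> k = 0%N /\ b = Tagged elt m) ->
  (elt_at x 0%N = None -> ezero m) ->
  exists2 nu : nat -> opath, approximates nu x & forall n, porg (nu n) = porg x.
Proof.
move=> m_val m_max m_inf x_org x_at x_zero.
have [a [a_val a_lim]] := elt_approx v w m_val m_max m_inf.
pose nu n := Str (eorg (a n)) [:: Tagged elt (a n)].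
have a_fin n : is_fin_elt (a n) by apply/is_fin_eltE; have [] := a_val n.
have nu_org n : porg (nu n) = porg x by rewrite x_org; have [] := a_val n.
have nuP n y : Z (nu n) y -> exists2 b, elt_at y 0%N = Some (Tagged elt b) & elt_ext (a n) b.
  by move=> /(Z_elt _ (a_fin n)).
exists nu => //; split=> [n|kappa k_path]; first exact: is_fpath_elt.
have [k0|k0] := posnP (psize kappa).
  exists 0%N => n _; have trivial y : porg y = porg x -> Z kappa x <-> Z kappa y.
    move=> yx; have noelt m' i : elt_at kappa i = Some m' -> False.
      by move=> /(elt_at_psize k_path); rewrite k0.
    by split=> -[k_org _]; split; rewrite -?k_org ?yx // => i m' /noelt.
  by split=> kx y /Z_porg; rewrite nu_org => /trivial kxy; rewrite -kxy.
have [[t' c] kc] := elt_at_Some k_path k0.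
have [c_val c_fin c_nz] := is_fpath_fin k_path kc; rewrite /= in c_val c_fin c_nz.
have [tt'|tt'] := pselect (t' = t); last first.
  exists 0%N => n _; split=> [kx|_] y /nuP[b y0 ab].
    have [m0 x0 _] := kx.2 _ _ kc; have := pext_tag kx kc x0.
    by have [_ ->] := x_at _ _ x0 => /esym.
  by move=> /pext_tag/(_ kc y0)/esym.
case: t / tt' m m_val m_max m_inf x_org x_at x_zero a a_val a_lim nu a_fin nu_org nuP.
move=> m m_val m_max m_inf x_org x_at x_zero a a_val a_lim nu a_fin nu_org nuP.
have [N Nlim] := a_lim c c_val c_fin; exists N => n /Nlim[c_in c_out c_big].
have [an_val an_fin _ _] := a_val n.
have short_ext y b : (forall i m', elt_at kappa i = Some m' -> i = 0%N) ->
    porg y = porg kappa -> elt_at y 0%N = Some (Tagged elt b) -> elt_ext c b -> Z kappa y.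
  move=> short y_org y0 cb; split=> // i m' ki; have i0 := short _ _ ki.
  rewrite i0 kc in ki *; move: ki => -[<-]; exists (Tagged elt b) => //.
  case k1: (elt_at kappa 1%N) => [m''|]; first by have := short _ _ k1.
  by apply/pelt_extP; exists b.
split=> [kx|nkx] y /[dup] /Z_porg y_org /nuP[b y0 ab].
  have [m0 x0] := kx.2 _ _ kc; have [_ m0_eq] := x_at _ _ x0.
  have short i m' : elt_at kappa i = Some m' -> i = 0%N.
    by move=> /kx.2[m'' /x_at[]].
  case k1: (elt_at kappa 1%N) => [m''|]; first by have := short _ _ k1.
  rewrite m0_eq => /pelt_extP[m1 /(@Tagged_inj _ elt) <-] /c_in ca.
  apply: (short_ext y b) => //; last exact: elt_ext_trans ca ab.
  by rewrite y_org nu_org kx.1.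
move=> ky; have [b'] := ky.2 _ _ kc; rewrite y0 => -[<-].
(* If [kappa] went on after [c], the first element of [y] would be [c] itself and would extend
   [a n], which is impossible for large [n]. *)
case k1: (elt_at kappa 1%N) => [m''|].
  by move=> /(@Tagged_inj _ elt) bc; rewrite bc in ab.
move=> /pelt_extP[b1 /(@Tagged_inj _ elt) <-] cb.
have [cm|/c_out/(_ _ ab)//] := pselect (elt_ext c m).
case x0: (elt_at x 0%N) => [m0|]; last first.
  have /(elt_ext_nz v w c_fin)/(_ c_nz) := cm.
  by rewrite x_zero.
have [_ m0_eq] := x_at _ _ x0; apply: nkx; apply: (short_ext x m) => //.
- move=> i m' ki; apply/eqP; rewrite -leqn0 leqNgt; apply/negP => i0.
  by have [m2] := elt_at_lt ki i0; rewrite k1.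
- by rewrite -(nu_org n) -y_org ky.1.
- by rewrite x0 m0_eq.
Qed.

Lemma approx_infinite f (f_path : is_ipath v w (IStr f)) :
  exists2 nu : nat -> opath, approximates nu (IPath f_path) & forall n, porg (nu n) = porg (IPath f_path).
Proof.
pose o := porg (IStr f); pose nu n := Str o (mkseq f n).
have nu_at n k : (k < n)%N -> elt_at (nu n) k = Some (f k).
  by move=> kn; rewrite [LHS](onthE (mkseq f n)) (nth_map (f 0%N)) ?size_mkseq ?nth_mkseq.
have nu_None n k : (n <= k)%N -> elt_at (nu n) k = None.
  by move=> nk; apply: onth_default; rewrite size_mkseq.
have f_val := ipath_gval (IPath f_path).
have nu_path n : fpath (nu n).
  split; last first.
    move=> k m; have [/nu_None //|kn] := leqP n k.
      by rewrite -[onth _ k]/(elt_at (nu n) k) => ->.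
    by rewrite -[onth _ k]/(elt_at (nu n) k) nu_at // => -[<-]; apply: f_path.2.
  split=> [m|k m m'].
    have [/nu_None->//|n0] := leqP n 0%N.
    by rewrite nu_at // => -[<-].
  have [/nu_None->//|kn] := leqP n k.+1.
  by rewrite !nu_at ?(ltnW kn) // => -[<-] [<-]; apply: f_val.1.2.
(* One element more than [kappa] has: elements of [nu n] are matched exactly only before its last
   position. *)
exists nu => //; split=> // kappa k_path; exists (psize kappa).+1 => n kn.
have agree y : Z (nu n) y -> Z kappa (IPath f_path) <-> Z kappa y.
  move=> ny; have y_at k m : elt_at kappa k = Some m -> elt_at y k = Some (f k).
    move=> /(elt_at_psize k_path) kk; rewrite -(nu_at n k); last first.
      exact: ltn_trans kk kn.
    apply: (pext_at (nu_path n) ny); rewrite /= size_mkseq.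
    exact: leq_ltn_trans kk kn.
  have y_org : porg y = o by have := ny.1.
  split=> -[k_org k_at]; split; rewrite -?k_org ?y_org // => k m kk.
    by have := k_at _ _ kk; rewrite (y_at _ _ kk).
  by have := k_at _ _ kk; rewrite (y_at _ _ kk).
by split=> kx y /agree; [move=> <-|move=> kxy /kxy].
Qed.

(** Finite elements at the front are cancelled until a vertex or an element with an infinite
    coordinate is left. In particular a path that stops at u_i after an element of type D is
    approximated from the vertex u_i by product paths, which avoid the removed alpha_i and
    epsilon_i. *)
Lemma approx_exists x : exists2 nu : nat -> opath, approximates nu x & forall n, porg (nu n) = porg x.
Proof.
case: x => [[o s|f] x_path]; last exact: approx_infinite.
elim: s o x_path => [|m s IHs] o x_path.
  case: o x_path => [i|i y z] x_path; first by case: x_path.2.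
  apply: (@approx_elt (Some i) (Fin y [::], Fin z [::])) => //.
    by case: x_path.2 => ? ?; split; right; eexists.
  by move=> k b; rewrite /= onth0n.
have x_val := ipath_gval (IPath x_path); have x_max := ipath_pmax (IPath x_path).
have [m_val m_nz] := x_val.2 0%N m erefl.
have x_org : o = eorg (tagged m) by apply: x_val.1.1.
have [m_fin|m_inf] := boolP (efin (tagged m)); last first.
  case: s IHs x_path x_val x_max => [|m' s] IHs x_path x_val x_max; last first.
    by have := gval_at_fin x_val (n := 0%N) erefl erefl; rewrite (negbTE m_inf).
  apply: (@approx_elt _ (tagged m)) => //=.
  by move=> k b /onth1P[-> <-]; case: (m).
have [o' mo'] := fin_eter v w m_fin.
have [z_val z_org x_eq] := pshiftP x_val (erefl : elt_at (Str o (m :: s)) 0%N = Some m) mo'.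
have {}x_eq : Str o (m :: s) = pcons m (Str o' s) := x_eq.
rewrite /= in z_val z_org.
have mz : joinable m (Str o' s) by split.
have z_path : is_ipath v w (Str o' s).
  by apply/is_ipathE; split=> //; apply/(pmax_pcons z_val mz); rewrite -x_eq.
have c_path : fpath (Str (eorg (tagged m)) [:: m]).
  case: m m_val m_nz m_fin {IHs x_path x_val x_max x_org mo' x_eq mz z_val} => t a a_val a_nz a_fin.
  by apply: is_fpath_elt; apply/is_fin_eltE.
have cz : pter (Str (eorg (tagged m)) [:: m]) = Some (porg (IPath z_path)) by [].
have -> : IPath x_path = lmul (Str (eorg (tagged m)) [:: m]) (IPath z_path).
  by apply: ipath_inj; rewrite lmulE.
have [nu nu_lim nu_org] := IHs _ z_path.
exists (fun n => pcat (Str (eorg (tagged m)) [:: m]) (nu n)).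
  exact: approx_lmul.
by move=> n; rewrite porg_pcat ?porg_lmul ?nu_org //; apply: nu_lim.1.
Qed.

(** The sets that contain all but finitely many [Z (nu n)] form a filter. It contains every base set
    around the limit, as each of the finitely many removed cylinders is eventually missed. *)
Lemma open_contains_Z A : open A -> A !=set0 ->
  exists2 nu, fpath nu & Z nu `<=` (A : set ipath).
Proof.
move=> A_open [x Ax]; have [nu [nu_path nu_lim] _] := approx_exists x.
pose Phi := [set B : set ipath | exists N, forall n, (N <= n)%N -> Z (nu n) `<=` B].
have Phi_filter : Filter Phi.
  split=> [|P Q [M MP] [N NQ]|P Q PQ [N NP]]; first by exists 0%N.
    exists (maxn M N) => n; rewrite geq_max => /andP[/MP nP /NQ nQ] y ny.
    by split; [apply: nP|apply: nQ].
  by exists N => n /NP nP y /nP/PQ.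
suff [N /(_ N (leqnn N)) NA] : Phi A by exists (nu N).
apply: (ipath_base_filter Phi_filter _ A_open Ax).
move=> B [kappa k_path kx|kappa i a b P Q k_path k_ter [P_fin Q_fin [Pa Qb] _ _] Vx].
  have [N Nlim] := nu_lim kappa k_path.
  by exists N => n /Nlim[/(_ kx)].
have := Vx; move=> /(VBCP _ _ _ _ (o := Vprod a b))[//|kx no].
have [N Nlim] := nu_lim kappa k_path.
have [M Mlim] : Phi (\bigcap_(c in removed (Vprod a b) a b P Q) ~` Z (pcat kappa c)).
  apply: filter_bigcap_finite; first exact: finite_removed.
  move=> c c_rem; have [/edge_path_fpath c_path c_org] := removed_edge Pa Qb c_rem.
  have kc_path : fpath (pcat kappa c) by apply: is_fpath_pcat; rewrite // c_org.
  have [M Mlim] := nu_lim _ kc_path.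
  by exists M => n /Mlim[_ /(_ (no c c_rem)) out] y /out.
exists (maxn M N) => n; rewrite geq_max => /andP[/Mlim nM /Nlim[/(_ kx) nN _]] y ny.
by apply/(VBCP _ _ _ _ (o := Vprod a b)) => //; split; [apply: nN|apply: nM].
Qed.

(** * Irreducibility of Omega *)

Definition reachable (o o' : overt E F) : Prop :=
  exists rho, [/\ fpath rho, porg rho = o & pter rho = Some o'].

Lemma reachable_refl o : reachable o o.
Proof. by exists (Str o [::]); split=> //; apply: is_fpath_nil. Qed.

Lemma reachable_trans o1 o2 o3 : reachable o1 o2 -> reachable o2 o3 -> reachable o1 o3.
Proof.
move=> [rho [rho_path rho_org rho_ter]] [sigma [sigma_path sigma_org sigma_ter]].
exists (pcat rho sigma); have rs : pter rho = Some (porg sigma) by rewrite sigma_org.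
by split; [apply: is_fpath_pcat|rewrite porg_pcat|rewrite pter_pcat].
Qed.

Lemma reachable_D d : reachable (of_D v w (D_org d)) (of_D v w (D_ter d)).
Proof. by exists (D_edge_path v w d); split=> //; apply/edge_path_fpath/edge_path_D. Qed.

Hypothesis E_irr : forall i, irreducible (E i).
Hypothesis F_irr : forall i, irreducible (F i).

Lemma reachable_prod i (y y' : vert (E i)) (z z' : vert (F i)) :
  reachable (Vprod y z) (Vprod y' z').
Proof.
have [s [s_chain s_ter]] := E_irr y y'; have [t [t_chain t_ter]] := F_irr z z'.
have [/andP[s0 t0]|nz] := boolP (zero_length (Fin y s) && zero_length (Fin z t)).
  case: s t s0 t0 s_ter t_ter {s_chain t_chain} => [|//] [|//] _ _ [<-] [<-].
  exact: reachable_refl.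
exists (Str (Vprod y z) [:: Tagged elt ((Fin y s, Fin z t) : elt (Some i))]); split=> //.
  exact: (@is_fpath_elt (Some i) (Fin y s, Fin z t)).
by move: s_ter t_ter => /= [->] [->].
Qed.

(** Irreducibility of the factors moves within one product; epsilon_j passes between the products
    and delta_j leads out of a_j. *)
Lemma reachable_to_prod o i (y : vert (E i)) (z : vert (F i)) :
  reachable o (Vprod y z).
Proof.
have u_to j : reachable (of_D v w (U j)) (Vprod y z).
  apply: reachable_trans (reachable_prod (v i) y (w i) z).
  have [->|ij] := eqVneq i j; first exact: reachable_refl.
  by have := reachable_D (epsilon j); rewrite /=; case: (i) (j) ij => -[].
case: o => [j|j a b]; first exact: reachable_trans (reachable_D (delta j)) (u_to _).
exact: reachable_trans (reachable_prod a (v j) b (w j)) (u_to j).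
Qed.

(** Every finite path can be continued to u_0, and the vertex u_0 is itself an infinite path. *)
Lemma Z_nonempty mu : fpath mu -> exists x, Z mu x.
Proof.
move=> mu_path; have [_ [o mu_ter]] := (is_fpathE mu).1 mu_path.
have [rho [rho_path rho_org rho_ter]] := reachable_to_prod o (v false) (w false).
have u_path : is_ipath v w (Str (of_D v w (U false)) [::]).
  by apply/is_ipathE; split; [apply/fpath_gval/is_fpath_nil|split].
have mr : pter mu = Some (porg (lmul rho (IPath u_path))) by rewrite porg_lmul // rho_org.
by exists (lmul mu (lmul rho (IPath u_path))); apply: Z_lmul_self.
Qed.

(** * Separating tails in D *)

(* A path of D from [u_0] that repeats the loop [beta_0] after [alpha_0]: long
   repetitions separate distinct paths ending at [u_0]. *)
Definition tail_D N : gpath D := Fin (G := D) (U false) (alpha false :: nseq N (beta false)).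

Definition tail N : opath := Str (of_D v w (U false)) [:: Tagged elt (tail_D N : elt None)].

Lemma tail_D_path N : is_gpath (tail_D N).
Proof. by split=> //=; elim: N => [|N IHN]. Qed.

Lemma tail_fpath N : fpath (tail N).
Proof. by apply: (@is_fpath_elt None (tail_D N)); split=> //; apply: tail_D_path. Qed.

Lemma pter_tail N : pter (tail N) = Some (Va E F false).
Proof. by rewrite /=; elim: N. Qed.

Lemma tail_D_at N n : (0 < n <= N)%N -> gat (tail_D N) n = Some (beta false).
Proof. by case: n => [//|n] /= nN; rewrite onth_nseq nN. Qed.

(** The tail merges with a last element of type D and is appended otherwise. Letting [p] be that
    last element, or a path of length zero if there is none, gives both cases one form. *)
Lemma pcat_tail lam : fpath lam -> pter lam = Some (of_D v w (U false)) ->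
  exists s (p : gpath D), [/\ is_gpath p, gter p = Some (U false),
    lam = Str (porg lam) (if zero_length p then s else rcons s (Tagged elt (p : elt None))) &
    forall N, pcat lam (tail N) =
      Str (porg lam) (rcons s (Tagged elt (gcat p (tail_D N) : elt None)))].
Proof.
move=> lam_path; elim/fpath_ind: lam / lam_path => [o [->]|o m s].
  by exists [::], (Fin (G := D) (U false) [::]); split.
move=> m_val m_nz mo s_path apart IHs; rewrite (pter_cons _ mo) => s_ter.
case: s s_path apart IHs s_ter => [|m1 s] s_path apart IHs s_ter.
  rewrite /= in s_ter; case: m m_val m_nz mo {apart IHs s_path} => [[i|] a] /= a_val a_nz ao.
    exists [:: Tagged elt a], (Fin (G := D) (U false) [::]); split=> // N.
  exists [::], a; split=> //=.
  - move: s_ter ao => [->]; case: (gter a) => //= x [x_eq].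
    by rewrite (@of_D_inj _ _ v w x (U false)).
  - by rewrite (negbTE a_nz).
  - by move=> N; rewrite /merge /= tagged_asE.
have [s1 [p [p_path p_ter s_eq s_cat]]] := IHs s_ter.
have {}s_eq : m1 :: s = if zero_length p then s1 else rcons s1 (Tagged elt (p : elt None)).
  by case: s_eq.
exists (m :: s1), p; split=> //; first by rewrite s_eq /=; case: ifP.
move=> N; rewrite -[pcat _ _]/(pcons m (pcat (Str o (m1 :: s)) (tail N))) s_cat.
have {apart} m_m1 := apart m1 erefl.
case: s1 s_eq {s_cat} => [|m2 s1] s_eq.
  have m1_eq : m1 = Tagged elt (p : elt None) by move: s_eq; case: ifP => // _ [].
  by rewrite m1_eq /= in m_m1; rewrite /= /merge; case: eqP.
have m1_eq : m1 = m2 by move: s_eq; case: ifP => _ [].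
by rewrite m1_eq in m_m1; rewrite /= /merge; case: eqP.
Qed.

(** Only elements of type D are bounded: these are the ones that a tail, which lies in D, can be
    confused with. *)
Definition D_bounded N lam : Prop :=
  forall n (b : elt None), elt_at lam n = Some (Tagged elt b) -> (glen b <= N)%N.

Lemma D_bounded_exists lam : fpath lam -> exists N, D_bounded N lam.
Proof.
case: lam => [o s|f []] // _; elim: s => [|[[i|] a] s [N sN]].
- by exists 0%N => n b; rewrite /= onth0n.
- by exists N => -[|n] b //=; apply: sN.
- exists (maxn (glen a) N) => -[|n] b /=; last by move=> /sN bN; rewrite leq_max bN orbT.
  by move=> /Some_inj/(@Tagged_inj _ elt) <-; rewrite leq_max leqnn.
Qed.

Lemma D_bounded_leq M N lam : (M <= N)%N -> D_bounded M lam -> D_bounded N lam.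
Proof. by move=> MN bounded n b /bounded bM; apply: leq_trans MN. Qed.

(** The last element of each prolonged path is too long to occur inside the other one, so both have
    equally many elements and agree before the last. Inside that last word the positions of the two
    tails are compared. *)
Lemma tail_separates N lam lam' x : fpath lam -> fpath lam' ->
  pter lam = Some (of_D v w (U false)) -> pter lam' = Some (of_D v w (U false)) ->
  D_bounded N lam -> D_bounded N lam' ->
  Z (pcat lam (tail N)) x -> Z (pcat lam' (tail N)) x -> lam = lam'.
Proof.
move=> lam_path lam'_path lam_ter lam'_ter lamN lam'N.
have [s [p [p_path p_ter lam_eq lam_cat]]] := pcat_tail lam_path lam_ter.
have [s' [p' [p'_path p'_ter lam'_eq lam'_cat]]] := pcat_tail lam'_path lam'_ter.
have lamt_path : fpath (pcat lam (tail N)) by apply: is_fpath_pcat => //; apply: tail_fpath.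
have lam't_path : fpath (pcat lam' (tail N)) by apply: is_fpath_pcat => //; apply: tail_fpath.
move: lamt_path lam't_path; rewrite lam_cat lam'_cat => lamt_path lam't_path lamx lam'x.
have rcons_at (o1 : overt E F) (s1 : seq pelt) c : elt_at (Str o1 (rcons s1 c)) (size s1) = Some c /\
    elt_at (Str o1 (rcons s1 c)) (size s1).+1 = None.
  split; last by apply: onth_default; rewrite size_rcons.
  by rewrite /elt_at -cats1 onth_cat ltnn subnn.
have rcons_lt (o1 : overt E F) (s1 : seq pelt) c n : (n < size s1)%N -> elt_at (Str o1 (rcons s1 c)) n = onth s1 n.
  by move=> ns; rewrite /elt_at -cats1 onth_cat ns.
have bounded lam1 s1 p1 : D_bounded N lam1 ->
    lam1 = Str (porg lam1) (if zero_length p1 then s1 else rcons s1 (Tagged elt (p1 : elt None))) ->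
    (forall n (b : elt None), onth s1 n = Some (Tagged elt b) -> (glen b <= N)%N) /\
    (glen p1 <= N)%N.
  move=> lam1N lam1_eq; split=> [n b s1n|].
    apply: (lam1N n); rewrite lam1_eq; case: ifP => // _.
    rewrite rcons_lt //; rewrite ltnNge; apply/negP => /onth_default.
    by rewrite s1n.
  case: (boolP (zero_length p1)) lam1_eq => [|_ lam1_eq].
    by move=> /[dup] /zero_length_fin p1_fin; rewrite zero_length_glen // => /eqP ->.
  apply: (lam1N (size s1) p1); rewrite lam1_eq.
  exact: (rcons_at (porg lam1) s1 (Tagged elt (p1 : elt None))).1.
have [sN pN] := bounded _ _ _ lamN lam_eq.
have [s'N p'N] := bounded _ _ _ lam'N lam'_eq.
have p_fin := gter_fin p_ter; have p'_fin := gter_fin p'_ter.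
have pt_path : is_gpath (gcat p (tail_D N)) by apply: is_gpath_cat => //; apply: tail_D_path.
have p't_path : is_gpath (gcat p' (tail_D N)) by apply: is_gpath_cat => //; apply: tail_D_path.
have tail_big (r : gpath D) (b : gpath D) : ~~ infinite_gpath r -> is_gpath (gcat r (tail_D N)) ->
    ~~ infinite_gpath b -> gext (gcat r (tail_D N)) b -> (N < glen b)%N.
  move=> r_fin rt_path b_fin /(gext_glen rt_path); rewrite infinite_cat // glen_cat //=.
  by rewrite size_nseq => /(_ isT b_fin); apply: leq_trans; rewrite addnS ltnS leq_addl.
(* If [s1] were shorter, the final element of the first path, which has more than [N] edges, would
   be a prefix of an element of [s2], which has at most [N]. *)
have size_le o1 o2 s1 s2 (p1 p2 : gpath D) : ~~ infinite_gpath p1 ->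
    is_gpath (gcat p1 (tail_D N)) ->
    (forall n (b : elt None), onth s2 n = Some (Tagged elt b) -> (glen b <= N)%N) ->
    fpath (Str o2 (rcons s2 (Tagged elt (gcat p2 (tail_D N) : elt None)))) ->
    pext (Str o1 (rcons s1 (Tagged elt (gcat p1 (tail_D N) : elt None)))) x ->
    pext (Str o2 (rcons s2 (Tagged elt (gcat p2 (tail_D N) : elt None)))) x ->
    (size s2 <= size s1)%N.
  move=> p1_fin p1t_path s2N s2_path s1x s2x; rewrite leqNgt; apply/negP => s12.
  have [c xs] := s1x.2 _ _ (rcons_at o1 s1 _).1; rewrite (rcons_at _ _ _).2.
  move=> /pelt_extP[b c_eq p1b]; rewrite c_eq (pext_at s2_path s2x) in xs; last first.
    by rewrite /= size_rcons.
  have [_ b_fin _] := is_fpath_fin s2_path xs; rewrite rcons_lt // in xs.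
  by have := tail_big _ _ p1_fin p1t_path b_fin p1b; rewrite ltnNge (s2N _ _ xs).
have ss'_size : size s = size s'.
  by apply/eqP; rewrite eqn_leq (size_le _ _ _ _ _ _ p'_fin p't_path sN lamt_path lam'x lamx)
    (size_le _ _ _ _ _ _ p_fin pt_path s'N lam't_path lamx lam'x).
have ss' : s = s'.
  apply: eq_from_onth_le => n; rewrite -ss'_size maxnn => ns.
  rewrite -(rcons_lt (porg lam) s (Tagged elt (gcat p (tail_D N) : elt None)) n ns).
  rewrite -(pext_at lamt_path lamx); last by rewrite /= size_rcons.
  rewrite (pext_at lam't_path lam'x) ?rcons_lt -?ss'_size //.
  by rewrite /= size_rcons -ss'_size.
have [c xs] := lamx.2 _ _ (rcons_at (porg lam) s _).1; rewrite (rcons_at _ _ _).2.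
move=> /pelt_extP[b c_eq pb]; rewrite {}c_eq in xs.
have [c'] := lam'x.2 _ _ (rcons_at (porg lam') s' _).1; rewrite (rcons_at _ _ _).2 -ss'_size xs.
move=> [<-] /pelt_extP[b' /(@Tagged_inj _ elt) <-] p'b.
have b_path := gext_gpath pt_path pb.
have lt_absurd (r r' : gpath D) : is_gpath r -> ~~ infinite_gpath r ->
    is_gpath (gcat r (tail_D N)) -> ~~ infinite_gpath r' ->
    is_gpath (gcat r' (tail_D N)) -> (glen r' <= N)%N ->
    gext (gcat r (tail_D N)) b -> gext (gcat r' (tail_D N)) b -> (glen r' <= glen r)%N.
  move=> r_path r_fin rt_path r'_fin r't_path r'N rb r'b; rewrite leqNgt; apply/negP => rr'.
  have rt_fin : ~~ infinite_gpath (gcat r (tail_D N)) by rewrite infinite_cat.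
  have r't_fin : ~~ infinite_gpath (gcat r' (tail_D N)) by rewrite infinite_cat.
  have /(gextP rt_path rt_fin b_path)[_ rb_at] := rb.
  have /(gextP r't_path r't_fin b_path)[_ r'b_at] := r'b.
  (* At index [glen r'] the path [b] would have alpha_0, which opens the later tail, and also beta_0
     from the earlier tail; [glen r' <= N] keeps the index within its run of loops. *)
  have := r'b_at (glen r') (alpha false); rewrite gat_cat // ltnn subnn => /(_ erefl).
  rewrite (rb_at (glen r') (beta false)) // gat_cat // ltnNge (ltnW rr') /=.
  by apply: tail_D_at; rewrite subn_gt0 rr' (leq_trans (leq_subr _ _)).
have pp'_len : glen p = glen p'.
  apply/eqP; rewrite eqn_leq (lt_absurd p' p) // (lt_absurd p p') //.
have p_pt : gext p (gcat p (tail_D N)) by exists (tail_D N); split=> //; apply: tail_D_path.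
have p'_p't : gext p' (gcat p' (tail_D N)) by exists (tail_D N); split=> //; apply: tail_D_path.
have pp' : p = p'.
  apply: (gext_fin_eq (r := b)) pp'_len => //.
    by apply: gext_trans pb => //; rewrite infinite_cat.
  by apply: gext_trans p'b => //; rewrite infinite_cat.
have lam_org : porg lam = porg lam' by have := lamx.1; rewrite lam'x.1.
by rewrite lam_eq lam'_eq lam_org ss' pp'.
Qed.

(** * Arrows and the topology of the groupoid *)

Section Arrows.
Local Notation sarrow := (sarrow v w).
Implicit Types g h : sarrow.

Lemma sarrow_inj g h : sa_rng g = sa_rng h -> sa_deg g = sa_deg h ->
  sa_src g = sa_src h -> g = h.
Proof.
case: g h => [a d b gP] [a' d' b' hP] /= aa' dd' bb'.
case: a' / aa' hP => hP; case: d' / dd' hP => hP; case: b' / bb' hP => hP.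
by rewrite (Prop_irrelevance gP hP).
Qed.

(* The arrow [(mu z, l(mu) - l(nu), nu z)]. *)
Definition links mu nu g z : Prop :=
  [/\ pter mu = Some (porg z), pter nu = Some (porg z), sa_rng g = lmul mu z,
      sa_src g = lmul nu z & sa_deg g = plen mu - plen nu].

Lemma UbisP mu nu g : fpath mu -> fpath nu ->
  Ubis mu nu g <-> exists z, links mu nu g z.
Proof.
move=> mu_path nu_path; split=> [[z [[mz nz] [rz sz] dz _]]|[z [mz nz rz sz dz]]].
  by exists z; split=> //; apply: ipath_inj; rewrite lmulE.
exists z; split=> //; rewrite rz sz.
  by split; apply: lmulE.
by split; apply: Z_lmul_self.
Qed.

Lemma links_exists mu nu z : fpath mu -> fpath nu -> pter mu = Some (porg z) ->
  pter nu = Some (porg z) -> exists g, links mu nu g z.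
Proof.
move=> mu_path nu_path mz nz.
have g_proof : exists mu' nu' (z' : ipath),
    [/\ fpath mu', fpath nu', pter mu' = Some (porg z') /\ pter nu' = Some (porg z'),
        lmul mu z = pcat mu' z' :> opath /\ lmul nu z = pcat nu' z' :> opath
      & plen mu - plen nu = plen mu' - plen nu'].
  by exists mu, nu, z; split=> //; rewrite !lmulE.
by exists (SArrow g_proof); split.
Qed.

Lemma sarrow_links g : exists mu nu z,
  [/\ fpath mu, fpath nu & links mu nu g z].
Proof.
case: g => [a d b gP]; have [mu [nu [z [mu_path nu_path [mz nz] [rz sz] dz]]]] := gP.
by exists mu, nu, z; split=> //; split=> //; apply: ipath_inj; rewrite lmulE.
Qed.

Lemma links_src_inj mu nu g h y z : fpath mu -> fpath nu ->
  links mu nu g y -> links mu nu h z -> sa_src g = sa_src h -> g = h.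
Proof.
move=> mu_path nu_path [my ny rg sg dg] [mz nz rh sh dh] gh.
have yz : y = z by apply: (lmulI nu_path ny nz); rewrite -sg -sh.
by apply: sarrow_inj => //; rewrite ?rg ?rh ?dg ?dh ?yz.
Qed.

(** The length of [rho] cancels in the degree. This is the freedom to change the presentation of an
    arrow that the topological lemmas below exploit. *)
Lemma links_pcat mu nu rho g z : fpath mu -> fpath nu -> fpath rho ->
  pter mu = Some (porg rho) -> pter nu = Some (porg rho) ->
  pter rho = Some (porg z) ->
  links (pcat mu rho) (pcat nu rho) g z <-> links mu nu g (lmul rho z).
Proof.
move=> mu_path nu_path rho_path mr nr rz.
rewrite /links !pter_pcat // !porg_lmul // !lmulA // !plen_pcat //.
rewrite opprD addrACA subrr addr0.
by split=> -[].
Qed.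

Lemma sarrow_base_open C : @sarrow_base E F v w C -> open C.
Proof.
move=> C_base; exists [set C]; last by rewrite bigcup_set1.
move=> _ ->; exists [fset C]%fset; last by rewrite set_fset1 bigcap_set1.
by move=> B /fset1P ->; apply/mem_set.
Qed.

Lemma sarrow_base_filter g (Phi : set_system sarrow) : Filter Phi ->
  (forall B, @sarrow_base E F v w B -> B g -> Phi B) ->
  forall A, open A -> A g -> Phi A.
Proof.
move=> Phi_filter base_Phi A [A' A'_base <-] [B A'B Bg].
have [D D_base B_eq] := A'_base B A'B.
suff : Phi B by apply: filterS => y By; exists B.
rewrite -[B]B_eq in Bg *; apply: filter_bigI => C CD.
by apply: base_Phi; [apply: set_mem (D_base C CD)|apply: Bg].
Qed.

Lemma nbhs_sarrow_base g C : @sarrow_base E F v w C -> C g -> nbhs g C.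
Proof. by move=> C_base Cg; apply: open_nbhs_nbhs; split=> //; apply: sarrow_base_open. Qed.

Lemma Ubis_base mu nu o : fpath mu -> fpath nu -> pter mu = Some o ->
  pter nu = Some o -> @sarrow_base E F v w (Ubis mu nu).
Proof. by move=> mu_path nu_path mo no; apply: base_U; rewrite // mo no. Qed.

(* [nbhs_links] and [links_nbhs] say that [z |-> (mu z, l(mu) - l(nu), nu z)]
   is an open map and continuous. *)
Lemma nbhs_links mu nu g z A : fpath mu -> fpath nu -> links mu nu g z ->
  nbhs z A -> nbhs g [set h | exists2 x, A x & links mu nu h x].
Proof.
move=> mu_path nu_path gz; have [mz nz rz sz dz] := gz.
pose img A := [set h | exists2 x : ipath, A x & links mu nu h x].
have nbhs_Ubis kappa x : fpath kappa -> pter mu = Some (porg kappa) ->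
    pter nu = Some (porg kappa) -> pter kappa = Some (porg x) ->
    links mu nu g (lmul kappa x) -> nbhs g (Ubis (pcat mu kappa) (pcat nu kappa)).
  move=> k_path mk nk kx gx.
  have mk_path := is_fpath_pcat mu_path k_path mk.
  have nk_path := is_fpath_pcat nu_path k_path nk.
  apply: nbhs_sarrow_base; first by apply: (Ubis_base (o := porg x)); rewrite ?pter_pcat.
  by apply/UbisP => //; exists x; apply/links_pcat.
have img_filter : Filter [set A | nbhs g (img A)].
  split=> [|P Q|P Q PQ] /=.
  - have := nbhs_sarrow_base (Ubis_base mu_path nu_path mz nz).
    move=> /(_ g) gU; apply: filterS (gU _); last by apply/UbisP => //; exists z.
    by move=> h /UbisP[//|//|x hx]; exists x.
  - move=> zP zQ; apply: filterS (filterI zP zQ) => h [[x Px hx] [x' Qx' hx']].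
    exists x => //; split=> //; suff -> : x = x' by [].
    have [mx nx _ sx _] := hx; have [mx' nx' _ sx' _] := hx'.
    by apply: (lmulI nu_path nx nx'); rewrite -sx -sx'.
  - by apply: filterS => h [x Px hx]; exists x => //; apply: PQ.
move=> zA; apply: (ipath_nbhs_filter img_filter _ zA) => B B_base Bz.
case: B_base Bz => [kappa k_path kz|kappa i a b P Q k_path k_ter [P_fin Q_fin [Pa Qb] Pn Qn] Vz].
  have [mk nk] : pter mu = Some (porg kappa) /\ pter nu = Some (porg kappa).
    by rewrite -(Z_porg kz).
  have [x kx z_eq] := (ZP z k_path).1 kz; rewrite z_eq in gz.
  rewrite /=; apply: filterS (nbhs_Ubis _ _ k_path mk nk kx gz) => h.
  move=> /UbisP[||y hy]; try exact: is_fpath_pcat.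
  have ky : pter kappa = Some (porg y) by have [+ _ _ _ _] := hy; rewrite pter_pcat.
  by exists (lmul kappa y); [apply: Z_lmul_self|apply/links_pcat].
have kz : Z kappa z by case: Vz => -[].
have [mk nk] : pter mu = Some (porg kappa) /\ pter nu = Some (porg kappa).
  by rewrite -(Z_porg kz).
have mk_path := is_fpath_pcat mu_path k_path mk.
have nk_path := is_fpath_pcat nu_path k_path nk.
(* Prolonging both paths by [kappa] turns V(kappa;B,C) around [z] into a base set around [g]; by
   [VBC_lmul] range and source obey the same condition. *)
have C_base : @sarrow_base E F v w (U0bis (pcat mu kappa) (pcat nu kappa) a b P Q).
  by apply: base_U0; rewrite ?pter_pcat.
have Cg : U0bis (pcat mu kappa) (pcat nu kappa) a b P Q g.
  have [x kx z_eq] := (ZP z k_path).1 kz.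
  split; last 2 first.
  - by rewrite rz; apply/VBC_lmul.
  - by rewrite sz; apply/VBC_lmul.
  by apply/UbisP => //; exists x; apply/links_pcat; rewrite // -z_eq.
rewrite /=; apply: filterS (nbhs_sarrow_base C_base Cg) => h [/UbisP[//|//|y hy] Vr _].
have ky : pter kappa = Some (porg y) by have [+ _ _ _ _] := hy; rewrite pter_pcat.
have {}hy : links mu nu h (lmul kappa y) by apply/links_pcat.
exists (lmul kappa y) => //; have [my _ ry _ _] := hy.
by move: Vr; rewrite ry => /VBC_lmul; apply.
Qed.

Lemma links_nbhs mu nu g z A : fpath mu -> fpath nu -> links mu nu g z ->
  nbhs g A -> nbhs z [set x : ipath | forall h, links mu nu h x -> A h].
Proof.
move=> mu_path nu_path gz; have [mz nz rz sz dz] := gz.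
rewrite nbhsE => -[O [O_open Og] OA].
pose Phi := [set B | nbhs z [set x : ipath | forall h, links mu nu h x -> B h]].
have Phi_filter : Filter Phi.
  rewrite /Phi; split=> [|P Q zP zQ|P Q PQ] /=.
  - by apply: filterS filterT.
  - apply: (@filterS _ (nbhs z) _ _ _ _ (@filterI _ (nbhs z) _ _ _ zP zQ)).
    by move=> x [Px Qx] h hx; split; [apply: Px|apply: Qx].
  - by apply: filterS => x Px h /Px/PQ.
suff : Phi O by rewrite /Phi /=; apply: filterS => x Ox h /Ox/OA.
apply: (sarrow_base_filter Phi_filter _ O_open Og).
(* Two presentations of [g] are compared. Their source paths have a join nu rho = mu2 sigma;
   equality of degrees then gives mu rho and mu1 sigma the same length, and as prefixes of the range
   of [g] they coincide. So both presentations yield the same arrows for parameters in Z(rho). *)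
have Ubis_Phi mu1 mu2 : fpath mu1 -> fpath mu2 -> Ubis mu1 mu2 g -> Phi (Ubis mu1 mu2).
  move=> mu1_path mu2_path /UbisP[//|//|z1 [m1z m2z r1 s1 d1]].
  have nx : Z nu (sa_src g) by rewrite sz; apply: Z_lmul_self.
  have m2x : Z mu2 (sa_src g) by rewrite s1; apply: Z_lmul_self.
  have [rho [sigma [[rho_path sigma_path] nr m2s rs_eq rsE]]] := Z_common nu_path mu2_path nx m2x.
  have nr_path := is_fpath_pcat nu_path rho_path nr.
  have [z2 + x_eq] := (ZP _ nr_path).1 (rsE _ nx m2x); rewrite pter_pcat // => rz2.
  have sz2 : pter sigma = Some (porg z2).
    by rewrite -rz2 -(pter_pcat mu2_path sigma_path m2s) -rs_eq pter_pcat.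
  have z_eq : z = lmul rho z2.
    apply: (lmulI nu_path nz); first by rewrite porg_lmul.
    by rewrite -sz x_eq lmulA.
  have z1_eq : z1 = lmul sigma z2.
    apply: (lmulI mu2_path m2z); first by rewrite porg_lmul.
    by rewrite -s1 x_eq rs_eq lmulA.
  have mr : pter mu = Some (porg rho) by rewrite mz z_eq porg_lmul.
  have m1s : pter mu1 = Some (porg sigma) by rewrite m1z z1_eq porg_lmul.
  have mr_path := is_fpath_pcat mu_path rho_path mr.
  have m1s_path := is_fpath_pcat mu1_path sigma_path m1s.
  have mr_eq : pcat mu rho = pcat mu1 sigma.
    apply: (Z_plen_eq (x := sa_rng g)) => //.
    - by rewrite rz z_eq -lmulA //; apply: Z_lmul_self; rewrite ?pter_pcat.
    - by rewrite r1 z1_eq -lmulA //; apply: Z_lmul_self; rewrite ?pter_pcat.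
    have := congr1 (@plen E F) rs_eq; rewrite !plen_pcat // => rs_len.
    move: dz; rewrite d1 => /(congr1 (+%R^~ (plen mu2 + plen sigma))).
    by rewrite -{2}rs_len !addrA !subrK.
  have rz_Z : Z rho z by rewrite z_eq; apply: Z_lmul_self.
  apply: filterS (nbhs_Z rho_path rz_Z) => x /ZP[//|x2 rx2 ->] h hx.
  apply/UbisP => //; exists (lmul sigma x2).
  have sx2 : pter sigma = Some (porg x2) by rewrite sz2 -rz2.
  by apply/links_pcat; rewrite // -mr_eq -rs_eq; apply/links_pcat.
move=> C [mu1 mu2 mu1_path mu2_path _|mu1 mu2 i a b P Q mu1_path mu2_path m1_ter m2_ter adm].
  exact: Ubis_Phi.
move=> [Ug Vr Vs]; have := Ubis_Phi mu1 mu2 mu1_path mu2_path Ug; rewrite /Phi /=.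
rewrite rz in Vr; have rV := lmul_nbhs mu_path mz (nbhs_VBC mu1_path m1_ter adm Vr).
rewrite sz in Vs; have sV := lmul_nbhs nu_path nz (nbhs_VBC mu2_path m2_ter adm Vs).
apply: filterS2 (filterI rV sV) => x [rVx sVx] Ux h hx; split; first exact: Ux.
  by have [mx _ -> _ _] := hx; apply: rVx.
by have [_ nx _ -> _] := hx; apply: sVx.
Qed.

Lemma continuous_sa_src : continuous (@sa_src E F v w).
Proof.
move=> g A; have [mu [nu [z [mu_path nu_path gz]]]] := sarrow_links g.
have [mz nz rz sz dz] := gz; rewrite sz => /(lmul_nbhs nu_path nz) Az.
apply: filterS (nbhs_links mu_path nu_path gz Az) => h [x Ax hx].
by have [_ nx _ sx _] := hx; rewrite /= sx; apply: Ax.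
Qed.

End Arrows.

(** * The restriction: bisections, pure infiniteness, compactness *)

Variables (y0 : vert (E false)) (z0 : vert (F false)).
Let o0 : overt E F := Vprod y0 z0.
Let W : set ipath := Z (vertex_path y0 z0).
Local Notation H := (restriction (G := spielberg_groupoid v w) W).

Definition cylinder nu : set (units H) := [set x | Z nu (val x)].
Definition bisection mu nu : set (arrow H) := [set g | Ubis mu nu (val g)].

Lemma unit_org (x : units H) : porg (val x : ipath) = o0.
Proof. by have /Z_nilE := set_mem (valP x). Qed.

Lemma unit_of x : porg x = o0 -> exists x' : units H, val x' = x.
Proof. by move=> /Z_nilE Wx; exists (SigSub (mem_set (Wx : W x))). Qed.

Lemma arrow_of mu nu g z : fpath mu -> fpath nu -> porg mu = o0 -> porg nu = o0 ->
  links mu nu g z -> exists g' : arrow H, val g' = g.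
Proof.
move=> mu_path nu_path mu_org nu_org [mz nz rz sz _].
have Wg : restr_arrows (G := spielberg_groupoid v w) W g.
  by split; apply/Z_nilE; rewrite /= ?rz ?sz porg_lmul.
by exists (SigSub (mem_set Wg)).
Qed.

Lemma cylinder_open nu : fpath nu -> open (cylinder nu).
Proof. by move=> nu_path; exists (Z nu) => //; apply: Z_open. Qed.

Lemma bisection_open mu nu o : fpath mu -> fpath nu -> pter mu = Some o ->
  pter nu = Some o -> open (bisection mu nu).
Proof.
move=> mu_path nu_path mo no; exists (Ubis mu nu) => //.
exact/sarrow_base_open/(Ubis_base mu_path nu_path mo no).
Qed.

Lemma continuous_src : continuous (@src H).
Proof.
apply/continuousP => _ [O O_open <-]; exists (@sa_src E F v w @^-1` O) => //.
exact: (continuousP _).1 continuous_sa_src O O_open.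
Qed.

Lemma bisectionP mu nu (g : arrow H) : fpath mu -> fpath nu ->
  bisection mu nu g <-> exists z, links mu nu (val g) z.
Proof. exact: UbisP. Qed.

Section Bisection.
Variables (mu nu : opath) (o : overt E F).
Hypotheses (mu_path : fpath mu) (nu_path : fpath nu).
Hypotheses (mu_org : porg mu = o0) (nu_org : porg nu = o0).
Hypotheses (mu_ter : pter mu = Some o) (nu_ter : pter nu = Some o).

Lemma bisection_src : @src H @` bisection mu nu = cylinder nu.
Proof.
apply/seteqP; split=> [_ [g /bisectionP[//|//|z [mz nz rz sz dz]] <-]|x].
  by rewrite /cylinder /= sz; apply: Z_lmul_self.
move=> /ZP[//|z nz x_eq]; have mz : pter mu = Some (porg z) by rewrite mu_ter -nu_ter.
have [g gz] := links_exists mu_path nu_path mz nz.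
have [g' g'g] := arrow_of mu_path nu_path mu_org nu_org gz.
exists g'; first by apply/bisectionP => //; exists z; rewrite g'g.
by apply: val_inj; rewrite /= g'g x_eq; case: gz.
Qed.

Lemma bisection_rng : @rng H @` bisection mu nu = cylinder mu.
Proof.
apply/seteqP; split=> [_ [g /bisectionP[//|//|z [mz nz rz sz dz]] <-]|x].
  by rewrite /cylinder /= rz; apply: Z_lmul_self.
move=> /ZP[//|z mz x_eq]; have nz : pter nu = Some (porg z) by rewrite nu_ter -mu_ter.
have [g gz] := links_exists mu_path nu_path mz nz.
have [g' g'g] := arrow_of mu_path nu_path mu_org nu_org gz.
exists g'; first by apply/bisectionP => //; exists z; rewrite g'g.
by apply: val_inj; rewrite /= g'g x_eq; case: gz.
Qed.

Lemma bisection_s_section : open_s_section (bisection mu nu).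
Proof.
have src_inj (g h : arrow H) : bisection mu nu g -> bisection mu nu h ->
    src g = src h -> g = h.
  move=> /bisectionP[//|//|y gy] /bisectionP[//|//|z hz] /(congr1 val) gh.
  by apply: val_inj; apply: (links_src_inj mu_path nu_path gy hz gh).
split; first exact: bisection_open mu_ter nu_ter.
  by rewrite bisection_src; apply: cylinder_open.
split; first exact/continuous_subspaceT/continuous_src.
(* The inverse of the source map, chosen pointwise; off the image [idn x] is a mere default. *)
pose t (x : units H) : arrow H :=
  if pselect (exists g, bisection mu nu g /\ src g = x) is left ex
  then sval (cid ex) else idn x.
have tP g : bisection mu nu g -> t (src g) = g.
  move=> Bg; rewrite /t; case: pselect => [ex|[]]; last by exists g.
  by case: (cid ex) => h /= [Bh hg]; apply: src_inj.
exists t; split=> //; rewrite continuous_open_subspace; last first.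
  by rewrite bisection_src; apply: cylinder_open.
move=> x /set_mem[g Bg <-] A; rewrite tP // nbhsE => -[_ [[O O_open <-] Og] OA].
have /bisectionP[//|//|z gz] := Bg; have [mz nz rz sz dz] := gz.
(* The inverse sends nu z to the arrow with parameter z. It is continuous because the arrow depends
   continuously on z, while z is recovered continuously from nu z, left multiplication being
   open. *)
have Oz := links_nbhs mu_path nu_path gz (open_nbhs_nbhs (conj O_open Og)).
have := nbhs_lmul nu_path nz Oz; rewrite -sz nbhsE => -[P [P_open Pg] PO].
change (nbhs (src g) (t @^-1` A)).
rewrite nbhsE; exists (val @^-1` P `&` cylinder nu).
  split; last by split=> //; rewrite /cylinder /= sz; apply: Z_lmul_self.
  by apply: openI; [exists P|apply: cylinder_open].
move=> x' [Px']; rewrite -bisection_src => -[h Bh hx'].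
rewrite -hx' /= tP //; apply: OA => /=.
have [z' [Oz' nz' x'z']] := PO _ Px'; have /bisectionP[//|//|z'' hz''] := Bh.
apply: Oz'; have [mz'' nz'' rz'' sz'' dz''] := hz''.
suff -> : z' = z'' by [].
by apply: (lmulI nu_path) => //; rewrite -x'z' -sz'' -hx'.
Qed.

End Bisection.

Lemma cylinder_nonempty nu : fpath nu -> porg nu = o0 -> cylinder nu !=set0.
Proof.
move=> nu_path nu_org; have [x nx] := Z_nonempty nu_path.
have [|x' x'x] := unit_of (x := x); first by rewrite (Z_porg nx).
by exists x'; rewrite /cylinder /= x'x.
Qed.

Lemma open_cylinder (O : set (units H)) : open O -> O !=set0 ->
  exists nu, [/\ fpath nu, porg nu = o0, pter nu = Some o0 & cylinder nu `<=` O].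
Proof.
move=> [O' O'_open <-] [x O'x].
(* Intersecting with [W] forces the origin of [nu] to be [o0]. *)
have [|nu nu_path nuO] := @open_contains_Z (O' `&` W) (openI O'_open (Z_open (is_fpath_nil _))).
  by exists (val x); split=> //; apply/Z_nilE/unit_org.
have [y ny] := Z_nonempty nu_path.
have nu_org : porg nu = o0 by rewrite -(Z_porg ny); apply/Z_nilE; have [] := nuO _ ny.
have [_ [o nu_ter]] := (is_fpathE nu).1 nu_path.
have [rho [rho_path rho_org rho_ter]] := reachable_to_prod o y0 z0.
have nr : pter nu = Some (porg rho) by rewrite rho_org.
exists (pcat nu rho); split.
- exact: is_fpath_pcat.
- by rewrite porg_pcat.
- by rewrite pter_pcat.
- by move=> z /(Z_pcat_sub nu_path rho_path nr)/nuO[].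
Qed.

Lemma prec_open (K O : set (units H)) : open O -> O !=set0 -> prec K O.
Proof.
move=> O_open /(open_cylinder O_open)[nu [nu_path nu_org nu_ter nuO]].
have o_path := is_fpath_nil o0.
exists (bisection (Str o0 [::]) nu); split.
- exact: (bisection_s_section o_path nu_path _ nu_org _ nu_ter).
- rewrite (bisection_rng o_path nu_path _ nu_org _ nu_ter) // => x _.
  exact/Z_nilE/unit_org.
- by rewrite (bisection_src o_path nu_path _ nu_org _ nu_ter).
Qed.

Lemma restriction_purely_infinite : purely_infinite H.
Proof.
move=> O1 O2 _ _ O2_open O2_n0 _ K _ _.
have [nu [nu_path nu_org nu_ter nuO]] := open_cylinder O2_open O2_n0.
have [rho [rho_path rho_org rho_ter]] := reachable_to_prod o0 (v false) (w false).
have nr : pter nu = Some (porg rho) by rewrite rho_org.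
have nr_path := is_fpath_pcat nu_path rho_path nr.
have nr_ter : pter (pcat nu rho) = Some (of_D v w (U false)) by rewrite pter_pcat.
have d_path d := edge_path_fpath (edge_path_D d).
(* Once u_0 is reached, the two edges alpha_0 and epsilon_0 split off disjoint cylinders. *)
pose piece d := cylinder (pcat (pcat nu rho) (D_edge_path v w d)).
have piece_open d : D_org d = U false -> [/\ open (piece d), piece d !=set0 & piece d `<=` O2].
  move=> d_org; have nd : pter (pcat nu rho) = Some (porg (D_edge_path v w d)).
    by rewrite nr_ter /= d_org.
  have nrd_path := is_fpath_pcat nr_path (d_path d) nd.
  split; first exact: cylinder_open.
    by apply: cylinder_nonempty; rewrite ?porg_pcat.
  by move=> x /(Z_pcat_sub nr_path (d_path d) nd)/(Z_pcat_sub nu_path rho_path nr)/nuO.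
have [a_open a_n0 aO] := piece_open (alpha false) erefl.
have [e_open e_n0 eO] := piece_open (epsilon false) erefl.
exists (piece (alpha false)), (piece (epsilon false)); split=> //; last first.
  by split; apply: prec_open.
rewrite -subset0 => x [].
rewrite /piece /cylinder /= => ax ex.
have /ZP[//|z nz x_eq] := Z_pcat_sub nr_path (d_path (alpha false)) nr_ter ax.
rewrite x_eq in ax ex; move: ax ex.
by move=> /Z_lmul az /Z_lmul ez; have := Z_DD (az nr_path (d_path _) nr_ter nz)
  (ez nr_path (d_path _) nr_ter nz).
Qed.

(** The ultrafilter is pushed forward to the space of all infinite paths, where limits were
    constructed; the limit has origin [o0] and so lies in [W] again. *)
Lemma restriction_compact : compact [set: units H].
Proof.
rewrite compact_ultra => Psi Psi_ultra _.
pose Phi := [set A : set ipath | Psi (val @^-1` A)].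
have Phi_filter : Filter Phi.
  rewrite /Phi; split=> [|P Q|P Q PQ] /=.
  - exact: filterT.
  - exact: filterI.
  - by apply: filterS => x; apply: PQ.
have Phi_proper : ProperFilter Phi.
  apply: Build_ProperFilter_ex => A PsiA.
  by have [x Ax] := @filter_ex _ Psi _ _ PsiA; exists (val x).
have Phi_ultra : UltraFilter Phi.
  split=> // G G_proper PhiG; apply/seteqP; split=> // A GA.
  have [//|nA] := in_ultra_setVsetC (val @^-1` A) Psi_ultra.
  have /PhiG GnA : Phi (~` A) by apply: nA.
  by have [x []] := filter_ex (filterI GA GnA).
have [|x x_org x_lim] := @germ_limit Phi Phi_ultra o0.
  by rewrite /Phi /=; apply: filterS filterT => x _; apply/Z_nilE/unit_org.
have [x' x'x] := unit_of x_org; exists x'; split=> // A.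
rewrite nbhsE => -[_ [[O O_open <-] Ox'] OA].
apply: filterS OA _; apply: x_lim; apply: open_nbhs_nbhs; split=> //.
by rewrite -x'x.
Qed.

(** * Castles and almost elementarity *)

Lemma links_inv mu nu (g : sarrow v w) z : links mu nu g z -> links nu mu (sa_inv g) z.
Proof. by move=> [mz nz rz sz dz]; split=> //; rewrite /= dz opprB. Qed.

Lemma links_comp mu nu rho (g h k : sarrow v w) y z : fpath nu ->
  links mu nu g y -> links nu rho h z -> sa_comp g h k -> links mu rho k y.
Proof.
move=> nu_path [my ny rg sg dg] [nz rz rh sh dh] [gh kr kd ks].
have yz : y = z by apply: (lmulI nu_path ny nz); rewrite -sg -rh gh.
split=> //; first by rewrite yz.
- by rewrite kr.
- by rewrite ks sh yz.
- by rewrite kd dg dh addrA subrK.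
Qed.

Lemma inv_inv (g : arrow H) : inv (inv g) = g.
Proof. by apply: val_inj; apply: sarrow_inj => //=; rewrite opprK. Qed.

Lemma comp_inv (g h k : arrow H) : comp g h k -> comp (inv h) (inv g) (inv k).
Proof. by move=> [gh kr kd ks]; split=> //=; rewrite kd opprD addrC. Qed.

Lemma bisection_inv mu nu : fpath mu -> fpath nu ->
  @inv H @` bisection mu nu = bisection nu mu.
Proof.
have sub mu1 nu1 (g : arrow H) : fpath mu1 -> fpath nu1 -> bisection mu1 nu1 g ->
    bisection nu1 mu1 (inv g).
  move=> mu1_path nu1_path /bisectionP[//|//|z gz]; apply/bisectionP => //.
  by exists z; apply: links_inv.
move=> mu_path nu_path; apply/seteqP; split=> [_ [g Bg <-]|g Bg]; first exact: sub.
by exists (inv g); [apply: sub|apply: inv_inv].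
Qed.

Lemma bisection_idn mu o : fpath mu -> pter mu = Some o ->
  @idn H @` cylinder mu = bisection mu mu.
Proof.
move=> mu_path mu_ter; apply/seteqP; split=> [_ [x /ZP[//|z mz x_eq] <-]|g].
  by apply/bisectionP => //; exists z; split=> //=; rewrite subrr.
move=> /bisectionP[//|//|z [mz _ rz sz dz]]; exists (src g).
  by rewrite /cylinder /= sz; apply: Z_lmul_self.
apply: val_inj; apply: sarrow_inj => //=; first by rewrite rz sz.
by rewrite dz subrr.
Qed.

Section Tower.
Variables (Lam : set opath) (o : overt E F).
Hypothesis Lam_finite : finite_set Lam.
Hypothesis Lam_path : forall lam, Lam lam ->
  [/\ fpath lam, porg lam = o0 & pter lam = Some o].
Hypothesis Lam_apart : forall lam lam' x, Lam lam -> Lam lam' ->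
  Z lam x -> Z lam' x -> lam = lam'.

(** The bisections between finitely many disjoint cylinders with a common terminus multiply like
    matrix units, which is what the castle axioms ask for. *)
Definition tower : set (set (arrow H)) :=
  [set bisection lam lam' | lam in Lam & lam' in Lam].

Lemma tower_open : open_castle tower.
Proof.
have Lam_cyl lam lam' : Lam lam -> Lam lam' -> cylinder lam = cylinder lam' -> lam = lam'.
  move=> Llam Llam' cyl; have [lam_path lam_org _] := Lam_path Llam.
  have [x lx] := cylinder_nonempty lam_path lam_org.
  by apply: (Lam_apart Llam Llam' lx); have : cylinder lam' x by rewrite -cyl.
have srcE lam lam' : Lam lam -> Lam lam' -> @src H @` bisection lam lam' = cylinder lam'.
  move=> /Lam_path[lam_path lam_org lam_ter] /Lam_path[lam'_path lam'_org lam'_ter].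
  exact: bisection_src lam_ter lam'_ter.
have rngE lam lam' : Lam lam -> Lam lam' -> @rng H @` bisection lam lam' = cylinder lam.
  move=> /Lam_path[lam_path lam_org lam_ter] /Lam_path[lam'_path lam'_org lam'_ter].
  exact: bisection_rng lam_ter lam'_ter.
have idnE lam : Lam lam -> tower (@idn H @` cylinder lam).
  move=> Llam; have [lam_path _ lam_ter] := Lam_path Llam.
  by rewrite (bisection_idn lam_path lam_ter); exists lam => //; exists lam.
split; last first.
  move=> _ [lam /Lam_path[lam_path _ lam_ter] [lam' /Lam_path[lam'_path _ lam'_ter] <-]].
  exact: bisection_open lam_ter lam'_ter.
split.
- split; first exact: finite_image2.
  move=> _ [lam Llam [lam' Llam' <-]].
  have [lam_path lam_org _] := Lam_path Llam.
  have [x] := cylinder_nonempty lam_path lam_org.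
  by rewrite -(rngE _ _ Llam Llam') => -[g Bg _]; exists g.
- move=> _ _ [lam Llam [lam' Llam' <-]] [kap Lkap [kap' Lkap' <-]] [g [gl gk]].
  have eq_by f lam1 lam2 (x : units H) : Lam lam1 -> Lam lam2 -> f = cylinder lam1 -> f x ->
      cylinder lam2 x -> lam1 = lam2.
    by move=> L1 L2 ->; apply: Lam_apart.
  have -> : lam = kap.
    apply: (eq_by _ _ _ (rng g) Llam Lkap (rngE _ _ Llam Llam')); first by exists g.
    by rewrite -(rngE _ _ Lkap Lkap'); exists g.
  have -> // : lam' = kap'.
  apply: (eq_by _ _ _ (src g) Llam' Lkap' (srcE _ _ Llam Llam')); first by exists g.
  by rewrite -(srcE _ _ Lkap Lkap'); exists g.
- move=> _ [lam Llam [lam' Llam' <-]]; rewrite rngE // srcE //; split; [exact: idnE..|].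
  have [lam_path _ _] := Lam_path Llam; have [lam'_path _ _] := Lam_path Llam'.
  by rewrite bisection_inv //; exists lam' => //; exists lam.
- move=> _ _ [lam Llam [lam' Llam' <-]] [kap Lkap [kap' Lkap' <-]].
  have [lam_path lam_org lam_ter] := Lam_path Llam; have [lam'_path lam'_org lam'_ter] := Lam_path Llam'.
  have [kap_path kap_org kap_ter] := Lam_path Lkap; have [kap'_path kap'_org kap'_ter] := Lam_path Lkap'.
  have [lk|lk] := pselect (lam' = kap); [left|right].
    exists lam => //; exists kap' => //; rewrite -lk.
    apply/seteqP; split=> [k /bisectionP[//|//|z kz]|k [g [h [/bisectionP[//|//|y gy] ]]]].
      have [lz kz' kr ks kd] := kz.
      have l'z : pter lam' = Some (porg z) by rewrite lam'_ter -lam_ter.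
      have [g gz] := links_exists lam_path lam'_path lz l'z.
      have [h hz] := links_exists lam'_path kap'_path l'z kz'.
      have [g' g'g] := arrow_of lam_path lam'_path lam_org lam'_org gz.
      have [h' h'h] := arrow_of lam'_path kap'_path lam'_org kap'_org hz.
      exists g', h'; split.
      + by apply/bisectionP => //; exists z; rewrite g'g.
      + by apply/bisectionP => //; exists z; rewrite h'h.
      + have [_ _ gr gs gd] := gz; have [_ _ hr hs hd] := hz.
        split; rewrite /= ?g'g ?h'h ?gs ?hr ?kr ?gr ?ks ?hs //.
        by rewrite kd gd hd addrA subrK.
    move=> /bisectionP[//|//|z hz] ghk; apply/bisectionP => //; exists y.
    exact: links_comp lam'_path gy hz ghk.
  rewrite -subset0 => k [g [h [gl hk [gh _ _ _]]]]; case: lk.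
  apply: (Lam_apart (x := sa_src (val g)) Llam' Lkap).
    by have : cylinder lam' (src g) by rewrite -(srcE _ _ Llam Llam'); exists g.
  by rewrite gh; have : cylinder kap (rng h) by rewrite -(rngE _ _ Lkap Lkap'); exists h.
- move=> _ _ [lam Llam [lam' Llam' <-]] [kap Lkap [kap' Lkap' <-]].
  by rewrite !rngE // !srcE // => /Lam_cyl-> // /Lam_cyl->.
Qed.

End Tower.

(** The members of [Q] are treated one at a time. Prolonging [nu] never undoes a decision: prefixes
    stay prefixes and disjoint cylinders stay disjoint. *)
Lemma pext_decide (Q : set opath) nu : finite_set Q -> fpath nu ->
  (forall kappa, Q kappa -> fpath kappa) ->
  exists nu', [/\ fpath nu', pext nu nu' & forall kappa, Q kappa ->
    pext kappa nu' \/ forall x, Z kappa x -> ~ Z nu' x].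
Proof.
move=> /finite_set_onth[s sQ] nu_path Q_path.
suff [nu' [nu'_path nn' nu'P]] : exists nu', [/\ fpath nu', pext nu nu' &
    forall n kappa, onth s n = Some kappa -> Q kappa ->
    pext kappa nu' \/ forall x, Z kappa x -> ~ Z nu' x].
  by exists nu'; split=> // kappa Qk; have [n sn] := sQ kappa Qk; apply: nu'P sn Qk.
elim: s {sQ} => [|a s [mu [mu_path nm muP]]].
  by exists nu; split=> // [|n kappa]; [apply: pext_refl|rewrite onth0n].
have keep mu' : fpath mu' -> pext mu mu' ->
    (Q a -> pext a mu' \/ forall x, Z a x -> ~ Z mu' x) ->
    exists nu', [/\ fpath nu', pext nu nu' &
      forall n kappa, onth (a :: s) n = Some kappa -> Q kappa ->
      pext kappa nu' \/ forall x, Z kappa x -> ~ Z nu' x].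
  move=> mu'_path mm' mu'a; exists mu'; split=> //.
    exact: (pext_trans nu_path mu_path (fpath_gval mu'_path) nm mm').
  case=> [|n] kappa /=; first by move=> [<-].
  move=> /muP/[swap] Qk /(_ Qk)[km|km]; [left|right].
    exact: (pext_trans (Q_path _ Qk) mu_path (fpath_gval mu'_path) km mm').
  by move=> x /km + /(pext_Z mu_path mu'_path mm').
have [Qa|nQa] := pselect (Q a); last by apply: (keep mu); [|apply: pext_refl|].
have a_path := Q_path _ Qa.
have [[x [mx ax]]|no] := pselect (exists x, Z mu x /\ Z a x); last first.
  apply: (keep mu) => //; first exact: pext_refl.
  by move=> _; right=> x ax mx; apply: no; exists x.
have [rho [sigma [[rho_path sigma_path] mr as_ rs_eq _]]] := Z_common mu_path a_path mx ax.
apply: (keep (pcat mu rho)); first exact: is_fpath_pcat.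
  exact: pext_pcat_self.
by move=> _; left; rewrite rs_eq; apply: pext_pcat_self.
Qed.

Definition linkable (q : opath * opath) : Prop :=
  [/\ fpath q.1 /\ fpath q.2, porg q.1 = o0, porg q.2 = o0 &
    exists o, pter q.1 = Some o /\ pter q.2 = Some o].

Lemma arrow_linkable (g : arrow H) : exists2 q, linkable q & bisection q.1 q.2 g.
Proof.
have [mu [nu [z [mu_path nu_path gz]]]] := sarrow_links (val g).
have [mz nz rz sz dz] := gz; exists (mu, nu); last by apply/bisectionP => //; exists z.
split=> //=; last by exists (porg z).
  by rewrite -(porg_lmul mu_path mz) -rz; apply: (unit_org (rng g)).
by rewrite -(porg_lmul nu_path nz) -sz; apply: (unit_org (src g)).
Qed.

(** Compactness is used as near-covering along the filter generated by supersets of finite sets of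
    pairs: each arrow is covered as soon as one pair presenting it has been included. *)
Lemma compact_linkable (K : set (arrow H)) : compact K ->
  exists Q, [/\ finite_set Q, Q `<=` linkable &
    K `<=` \bigcup_(q in Q) bisection q.1 q.2].
Proof.
move=> /compact_near_coveringP K_cover.
pose D := [set Q : set (opath * opath) | finite_set Q /\ Q `<=` linkable].
pose Phi := filter_from D (fun Q => [set Q' | Q `<=` Q']).
have Phi_filter : Filter Phi.
  apply: filter_from_filter; first by exists set0; split=> //.
  move=> P Q [P_fin P_link] [Q_fin Q_link]; exists (P `|` Q).
    by split; [rewrite finite_setU|move=> q [/P_link|/Q_link]].
  by move=> R PQR; split=> q ?; apply: PQR; [left|right].
have [] := K_cover _ Phi (fun Q g => (\bigcup_(q in Q) bisection q.1 q.2) g) Phi_filter.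
  move=> g _; have [q q_link gq] := arrow_linkable g.
  have [[q1_path q2_path] _ _ [o [q1_ter q2_ter]]] := q_link.
  exists (bisection q.1 q.2, [set Q' | [set q] `<=` Q']); last first.
    by move=> [h Q'] /= [qh qQ']; exists q => //; apply: qQ'.
  split=> /=.
    apply: open_nbhs_nbhs; split=> //; exact: bisection_open q1_ter q2_ter.
  by exists [set q] => //; split=> // _ ->.
move=> Q [Q_fin Q_link] QK; exists Q; split=> //.
exact: (QK Q).
Qed.

Lemma restriction_almost_elementary : almost_elementary H.
Proof.
split; first exact: restriction_compact.
move=> K VV O K_compact _ VV_open VV_cover O_open O_n0.
have [Q0 [Q0_fin Q0_link KQ0]] := compact_linkable K_compact.
have o_path := is_fpath_nil o0.
(* The swapped pairs cover the inverses of [K]; the trivial pair makes [nu2] itself one of the paths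
   in [Lam]. *)
pose Q := Q0 `|` [set (q.2, q.1) | q in Q0] `|` [set (Str o0 [::], Str o0 [::])].
have Q_fin : finite_set Q by rewrite !finite_setU; split; [split=> //; apply: finite_image|].
have Q_link : Q `<=` linkable.
  move=> q [[/Q0_link//|[q' /Q0_link[[? ?] ? ? [o [? ?]]] <-]]|->]; last by split=> //; exists o0.
  by split=> //; exists o.
have KQ : K `|` @inv H @` K `<=` \bigcup_(q in Q) bisection q.1 q.2.
  move=> g [/KQ0[q Qq gq]|[h /KQ0[q Qq hq] <-]]; first by exists q => //; left; left.
  exists (q.2, q.1); first by left; right; exists q.
  have [[q1_path q2_path] _ _ _] := Q0_link q Qq.
  by rewrite -(bisection_inv q1_path q2_path); exists h.
have K_inv g : (K `|` @inv H @` K) g -> (K `|` @inv H @` K) (inv g).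
  by move=> [Kg|[h Kh <-]]; [right; exists g|left; rewrite inv_inv].
(* Any nonempty member of the cover will do. [nu0] is put inside it at the outset, since later
   prolongations only shrink the cylinder. *)
have [x0 _] := cylinder_nonempty o_path erefl.
have [V0 VV0 V0x0] : (\bigcup_(V in VV) V) x0 by rewrite VV_cover.
have [nu0 [nu0_path nu0_org nu0_ter nu0V0]] := open_cylinder (VV_open _ VV0) (ex_intro _ x0 V0x0).
have [|||nu1 [nu1_path nu01 nu1Q]] := @pext_decide (snd @` Q) nu0; rewrite //.
- exact: finite_image.
- by move=> _ [q /Q_link[[_ q2_path] _ _ _] <-].
have nu1_org : porg nu1 = o0 by rewrite nu01.1.
have [_ [o1 nu1_ter]] := (is_fpathE nu1).1 nu1_path.
(* The path is led to u_0, where the tail can be attached. *)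
have [rho [rho_path rho_org rho_ter]] := reachable_to_prod o1 (v false) (w false).
have nr : pter nu1 = Some (porg rho) by rewrite rho_org.
pose nu2 := pcat nu1 rho; have nu2_path : fpath nu2 by apply: is_fpath_pcat.
have nu2_org : porg nu2 = o0 by rewrite porg_pcat.
have nu2_ter : pter nu2 = Some (of_D v w (U false)) by rewrite pter_pcat.
have nu12 : pext nu1 nu2 by apply: pext_pcat_self.
pose Lam := [set lam | exists q sigma, [/\ Q q, fpath sigma, pter q.2 = Some (porg sigma),
  nu2 = pcat q.2 sigma & lam = pcat q.1 sigma]].
have Lam_path lam : Lam lam ->
    [/\ fpath lam, porg lam = o0 & pter lam = Some (of_D v w (U false))].
  move=> [q [sigma [/Q_link[[q1_path q2_path] q1_org q2_org [o [q1_ter q2_ter]]]]]].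
  move=> sigma_path q2s nu2_eq ->; have q1s : pter q.1 = Some (porg sigma) by rewrite q1_ter -q2_ter.
  split; rewrite ?porg_pcat ?pter_pcat //; first exact: is_fpath_pcat.
  by rewrite -nu2_ter nu2_eq pter_pcat.
have Lam_fin : finite_set Lam.
  (* By left cancellation the pair [q] determines [sigma], so [Lam] is an image of part of the
     finite set [Q]. *)
  have /choice[f fP] q : exists lam, Q q -> forall sigma, fpath sigma ->
      pter q.2 = Some (porg sigma) -> nu2 = pcat q.2 sigma -> lam = pcat q.1 sigma.
    have [[sigma [sigma_path q2s nu2_eq]]|no] := pselect (exists sigma, [/\ fpath sigma,
        pter q.2 = Some (porg sigma) & nu2 = pcat q.2 sigma]); last first.
      by exists (Str o0 [::]) => _ sigma sigma_path q2s nu2_eq; case: no; exists sigma.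
    exists (pcat q.1 sigma) => /Q_link[[_ q2_path] _ _ _] sigma' sigma'_path q2s' nu2_eq'.
    congr pcat; apply: (pcatI q2_path (fpath_gval _) (fpath_gval _) q2s q2s') => //.
    by rewrite -nu2_eq.
  apply: (@sub_finite_set _ _ (f @` Q)); last exact: finite_image.
  by move=> lam [q [sigma [Qq sigma_path q2s nu2_eq ->]]]; exists q => //; apply: fP.
have [N LamN] : exists N, forall lam, Lam lam -> D_bounded N lam.
  apply: finite_set_bound Lam_fin _ _ => [M N lam|lam /Lam_path[lam_path _ _]].
    exact: D_bounded_leq.
  exact: D_bounded_exists lam_path.
have t_path := tail_fpath N.
pose Lam' := [set pcat lam (tail N) | lam in Lam].
have Lam'_path lam' : Lam' lam' ->
    [/\ fpath lam', porg lam' = o0 & pter lam' = Some (Va E F false)].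
  move=> [lam /Lam_path[lam_path lam_org lam_ter] <-].
  by split; rewrite ?porg_pcat ?pter_pcat ?pter_tail //; apply: is_fpath_pcat.
have Lam'_apart lam lam' x : Lam' lam -> Lam' lam' -> Z lam x -> Z lam' x -> lam = lam'.
  move=> [kap Lkap <-] [kap' Lkap' <-] kx kx'.
  have [kap_path _ kap_ter] := Lam_path _ Lkap; have [kap'_path _ kap'_ter] := Lam_path _ Lkap'.
  by rewrite (tail_separates kap_path kap'_path kap_ter kap'_ter (LamN _ Lkap) (LamN _ Lkap') kx kx').
have Lam_nu2 : Lam nu2.
  by exists (Str o0 [::], Str o0 [::]), nu2; split=> //=; [right|rewrite nu2_org].
pose nu3 := pcat nu2 (tail N); have Lam'_nu3 : Lam' nu3 by exists nu2.
have [nu3_path nu3_org nu3_ter] := Lam'_path _ Lam'_nu3.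
have nu3Z : Z nu3 `<=` (Z nu2 : set ipath) by apply: Z_pcat_sub.
have T_castle : open_castle (tower Lam').
  by apply: (tower_open _ Lam'_path Lam'_apart); apply: finite_image.
(* The castle to be extended consists of a single set of units. *)
have S_castle : open_castle (tower [set nu3]).
  apply: (@tower_open _ (Va E F false)); first exact: finite_set1.
    by move=> _ ->.
  by move=> lam lam' x -> ->.
have idn_nu3 := bisection_idn nu3_path nu3_ter.
have KC_T : set_mul (K `|` @inv H @` K) (bisection nu3 nu3) `<=` \bigcup_(C in tower Lam') C.
  move=> k [g [h [/KQ[q Qq gq] hnu3 ghk]]].
  have [[q1_path q2_path] q1_org q2_org [o [q1_ter q2_ter]]] := Q_link q Qq.
  have /bisectionP[//|//|z gz] := gq; have [q1z q2z gr gs gd] := gz.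
  have /bisectionP[//|//|z' hz'] := hnu3; have [n3z' _ hr hs hd] := hz'.
  have [gh _ _ _] := ghk.
  have nu3_src : Z nu3 (sa_src (val g)) by rewrite gh hr; apply: Z_lmul_self.
  have q2_src : Z q.2 (sa_src (val g)) by rewrite gs; apply: Z_lmul_self.
  (* The source of [g] lies in both cylinders, which rules out the disjoint alternative of
     [pext_decide]. *)
  have q2nu2 : pext q.2 nu2.
    have [||no] := nu1Q q.2; first by exists q.
      by move=> qn1; apply: (pext_trans q2_path nu1_path (fpath_gval nu2_path) qn1 nu12).
    case: (no _ q2_src); apply: (pext_Z nu1_path nu2_path nu12); exact: nu3Z.
  have [sigma [sigma_path q2s nu2_eq]] := pext_pcatE q2_path nu2_path q2nu2.
  have q1s : pter q.1 = Some (porg sigma) by rewrite q1_ter -q2_ter.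
  have Lam_q : Lam (pcat q.1 sigma) by exists q, sigma.
  exists (bisection (pcat (pcat q.1 sigma) (tail N)) nu3).
    by exists (pcat (pcat q.1 sigma) (tail N)); [exists (pcat q.1 sigma)|exists nu3].
  have tz' : pter (tail N) = Some (porg z') by rewrite pter_tail -nu3_ter.
  have s_tail : pter sigma = Some (porg (tail N)).
    by have := nu2_ter; rewrite nu2_eq pter_pcat.
  have st_path := is_fpath_pcat sigma_path t_path s_tail.
  have [q1st q2st] : pter q.1 = Some (porg (pcat sigma (tail N))) /\
      pter q.2 = Some (porg (pcat sigma (tail N))) by rewrite porg_pcat.
  have stz' : pter (pcat sigma (tail N)) = Some (porg z') by rewrite pter_pcat.
  (* The source of [g] is factored through [q.2] and through [nu3], which itself starts with [q.2];
     cancelling [q.2] compares the parameters. *)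
  have z_eq : z = lmul (pcat sigma (tail N)) z'.
    apply: (lmulI q2_path q2z); first by rewrite porg_lmul.
    rewrite -gs gh hr -lmulA //; congr lmul.
    by rewrite /nu3 nu2_eq pcatA //; apply: fpath_gval.
  have t_val := fpath_gval t_path.
  apply/bisectionP; [by have [] := Lam'_path (pcat (pcat q.1 sigma) (tail N)); first by exists (pcat q.1 sigma)|by []|].
  exists z'; apply: (links_comp nu3_path _ hz' ghk).
  rewrite /nu3 nu2_eq !pcatA //; apply/links_pcat => //.
  by rewrite -z_eq.
exists (tower [set nu3]); split=> //.
- by exists (bisection nu3 nu3); exists nu3 => //; exists nu3.
- exists (tower Lam') => // _ [_ -> [_ -> <-]]; split=> //; first by exists nu3 => //; exists nu3.
  move=> k [g [h [gn3 Kh ghk]]].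
  (* Products on the other side follow by inversion, under which the union of [K] and its inverse,
     the level and the tower are all stable. *)
  have [|_ [lam Llam [lam' Llam' <-]] Ck] := KC_T (inv k).
    exists (inv h), (inv g); split; [exact: K_inv| |exact: comp_inv].
    by rewrite -(bisection_inv nu3_path nu3_path); exists g.
  have [lam_path _ _] := Lam'_path _ Llam; have [lam'_path _ _] := Lam'_path _ Llam'.
  exists (bisection lam' lam); first by exists lam' => //; exists lam.
  by rewrite -(bisection_inv lam_path lam'_path); exists (inv k) => //; apply: inv_inv.
- move=> _ [[_ -> [_ -> <-]] _]; exists V0 => //; rewrite -idn_nu3.
  apply: image_subset => x nx; apply: nu0V0.
  apply: (pext_Z nu0_path nu1_path nu01); apply: (pext_Z nu1_path nu2_path nu12).
  exact: nu3Z.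
(* The complement of the one level may be large; like every set of units it is below [O]. *)
- exact: prec_open.
Qed.

End OmegaPaths.

Theorem proposition5p11 (E F : bool -> digraph)
    (E_countable : forall i, countable_digraph (E i))
    (F_countable : forall i, countable_digraph (F i))
    (E_irreducible : forall i, irreducible (E i))
    (F_irreducible : forall i, irreducible (F i))
    (v : forall i, vert (E i)) (w : forall i, vert (F i))
    (v_infinite : forall i, infinite_emitters (E i) (v i))
    (w_infinite : forall i, infinite_emitters (F i) (w i))
    (y : vert (E false)) (z : vert (F false)) :
  let H := restriction (G := spielberg_groupoid v w)
             (Z (vertex_path y z)) in
  purely_infinite H /\ almost_elementary H.
Proof.
move=> H; split; first exact: restriction_purely_infinite.
exact: restriction_almost_elementary.
Qed.
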